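(* Let $(\mathcal{C},\sigma)$ be a real algebraic curve of genus $g\ge 0$. (a) Let $d\in\{2,3\}$ and let $f:\mathcal{C}\to\mathbb{CP}^1$ be a meromorphic function of degree $d$ such that (i) all its critical points and critical values are distinct, and (ii) all its critical points belong to $\mathcal{C}_\sigma$. Then there exists a real structure $\tau'$ on $\mathbb{CP}^1$ such that $\tau'\circ f\circ\sigma=f$. (b) If $g>0$ and $f:\mathcal{C}\to\mathbb{CP}^1$ is a meromorphic function of degree $2$ having at least one critical point in $\mathcal{C}_\sigma$, then there exists a real structure $\tau'$ on $\mathbb{CP}^1$ such that $\tau'\circ f\circ\sigma=f$.
   Context: A real algebraic curve $(\mathcal{C},\sigma)$ is a compact (connected) Riemann surface $\mathcal{C}$ together with an antiholomorphic involution $\sigma:\mathcal{C}\to\mathcal{C}$; its real part $\mathcal{C}_\sigma$ is the set of fixed points of $\sigma$. A real structure on $\mathbb{CP}^1$ is an antiholomorphic involution of $\mathbb{CP}^1$. A meromorphic function of degree $d$ on $\mathcal{C}$ is a holomorphic map $f:\mathcal{C}\to\mathbb{CP}^1$ of degree $d$. Condition (i) means that $f$ has $2d-2+2g$ distinct critical points and that their images (critical values) are pairwise distinct. *)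

(* Defs.v *)
From HB Require Import structures.
From mathcomp Require Import all_boot all_order all_algebra.
From mathcomp Require Import all_classical all_reals all_analysis.
From mathcomp Require Import complex.

Set Implicit Arguments.
Unset Strict Implicit.
Unset Printing Implicit Defensive.

Import Order.TTheory GRing.Theory Num.Theory numFieldNormedType.Exports.
Local Open Scope ring_scope.
Local Open Scope classical_set_scope.

(* Declared as a numClosedFieldType so that the library's generic topology and
   complex derivative ([derivable], [derive1] with scalar field C) apply.     *)
Definition Cplx (R : realType) : numClosedFieldType := complex R.

(* The inverse charts are total functions; they are only meaningful on the
   open sets [chart i @` dom i].                                              *)
Record riemannSurface (R : realType) := RiemannSurface {
  surface_space :> topologicalType;
  chart_index : Type;
  dom : chart_index -> set surface_space;
  chart : chart_index -> surface_space -> Cplx R;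
  chartV : chart_index -> Cplx R -> surface_space;
  surface_hausdorff : hausdorff_space surface_space;
  surface_connected : connected [set: surface_space];
  surface_nonempty : [set: surface_space] !=set0;
  dom_cover : forall p, exists i, dom i p;
  dom_open : forall i, open (dom i);
  chart_open : forall i, open (chart i @` dom i);
  chartK : forall i p, dom i p -> chartV i (chart i p) = p;
  chart_continuous : forall i p, dom i p -> {for p, continuous (chart i)};
  chartV_continuous : forall i p, dom i p ->
    {for chart i p, continuous (chartV i)};
  transition_derivable : forall i j p, dom i p -> dom j p ->
    derivable (chart j \o chartV i) (chart i p) 1 }.

Arguments dom {R X} i : rename.
Arguments chart {R X} i : rename.
Arguments chartV {R X} i : rename.

Section Maps.
Context {R : realType} {X Y : riemannSurface R}.
Implicit Types f : X -> Y.

Definition local_expr f (i : chart_index X) (j : chart_index Y) :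
    Cplx R -> Cplx R :=
  chart j \o f \o chartV i.

Definition holomorphic f :=
  continuous f /\
  forall i j p, dom i p -> dom j (f p) ->
    derivable (local_expr f i j) (chart i p) 1.

(* Conjugate local expressions are holomorphic. *)
Definition antiholomorphic f :=
  continuous f /\
  forall i j p, dom i p -> dom j (f p) ->
    derivable (fun z => Num.conj (local_expr f i j z)) (chart i p) 1.

Definition critical_points f : set X :=
  [set p | forall i j, dom i p -> dom j (f p) ->
           derive1 (local_expr f i j) (chart i p) = 0].

(* The order of vanishing at chart i p of local_expr f i j minus its value. *)
Definition is_multiplicity f (p : X) (m : nat) :=
  (0 < m)%N /\
  forall i j, dom i p -> dom j (f p) ->
    derive1n m (local_expr f i j) (chart i p) != 0 /\
    forall k, (0 < k < m)%N ->
      derive1n k (local_expr f i j) (chart i p) = 0.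

(* 0 when f is constant near p, where no m satisfies [is_multiplicity]. *)
Definition multiplicity f (p : X) : nat := xget 0%N (is_multiplicity f p).

(* Every fibre has d points counted with multiplicity. *)
Definition has_degree f (d : nat) :=
  forall q : Y, finite_set (f @^-1` [set q]) /\
    \big[addn/0%N]_(p \in f @^-1` [set q]) multiplicity f p = d.

End Maps.

Section Genus.
Context {R : realType} (X : riemannSurface R).

(* The form is w i dz_i on dom i, where z_i = chart i; the values of w i
   outside dom i are irrelevant.                                              *)
Definition holomorphic_form (w : chart_index X -> X -> Cplx R) :=
  (forall i p, dom i p -> derivable (w i \o chartV i) (chart i p) 1) /\
  (forall i j p, dom i p -> dom j p ->
     w i p = w j p * derive1 (chart j \o chartV i) (chart i p)).

(* The genus is the dimension of the space of holomorphic 1-forms. *)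
Definition has_genus (g : nat) :=
  exists w : 'I_g -> chart_index X -> X -> Cplx R,
    [/\ forall k, holomorphic_form (w k),
        forall a : 'I_g -> Cplx R,
          (forall i p, dom i p -> \sum_k a k * w k i p = 0) ->
          forall k, a k = 0
      & forall eta, holomorphic_form eta ->
          exists a : 'I_g -> Cplx R, forall i p, dom i p ->
            eta i p = \sum_k a k * w k i p].

Definition real_structure (s : X -> X) := antiholomorphic s /\ involutive s.

Definition real_part (s : X -> X) : set X := [set p | s p = p].

End Genus.

Section RiemannSphere.
Variable R : realType.
Local Notation C := (Cplx R).
Local Notation sphere := (one_point_compactification C).

(* Chart [false] is z on C; chart [true] is 1/z on the complement of 0, with
   None the point at infinity.                                                *)
Definition sphere_dom (b : bool) : set sphere :=
  if b then [set p | p != Some 0] else [set p | p != None].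

Definition sphere_chart (b : bool) (p : sphere) : C :=
  if p is Some z then (if b then z^-1 else z) else 0.

Definition sphere_chartV (b : bool) (z : C) : sphere :=
  if b then (if z == 0 then None else Some z^-1) else Some z.

Let real_complex_continuous : continuous (real_complex R : R -> C).
Proof.
move=> x; apply/cvgrPdist_lt => e e0.
have eE : e = (complex.Re e)%:C%C.
  by rewrite RRe_real // realE ltW.
have e0' : 0 < complex.Re e by rewrite -ltcR -eE.
near=> y; rewrite -[X in X < _]/(`|x%:C%C - y%:C%C|) -rmorphB normc_def /=.
rewrite expr0n addr0 sqrtr_sqr eE ltcR.
near: y; exact: cvgr_dist_lt.
Unshelve. all: by end_near. Qed.

Lemma sphere_nbhs_infty (e : C) : 0 <= e ->
  nbhs (None : sphere) [set p | forall z, p = Some z -> e < `|z|].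
Proof.
move=> e0; pose r := complex.Re e.
pose toC (p : R * R) : C := p.1%:C%C + 'i%C * p.2%:C%C.
have toC_cont : continuous toC.
  move=> p; apply: cvgD.
    apply: (@cvg_comp _ _ _ (fun p : R * R => p.1) (real_complex R : R -> C));
      [exact: cvg_fst|exact: real_complex_continuous].
  apply: cvgM; first exact: cvg_cst.
  apply: (@cvg_comp _ _ _ (fun p : R * R => p.2) (real_complex R : R -> C));
    [exact: cvg_snd|exact: real_complex_continuous].
have cbox : compact (toC @` (`[-r, r] `*` `[-r, r])).
  apply: continuous_compact; first exact: continuous_subspaceT.
  by apply: compact_setX; exact: segment_compact.
exists (toC @` (`[-r, r] `*` `[-r, r])).
  by split=> //; apply: compact_closed => //; exact: norm_hausdorff.
move=> p Kp z pz; rewrite real_ltNge ?normr_real ?ger0_real //.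
apply/negP => ze; case: Kp => [[y nKy yp]|]; last by rewrite pz.
apply: nKy; move: yp; rewrite pz => -[->].
have zr : Num.sqrt (complex.Re z ^+ 2 + complex.Im z ^+ 2) <= r.
  by move: ze; rewrite normc_def lecE => /andP[].
exists (complex.Re z, complex.Im z); last by rewrite /toC /= -complexE.
by split; rewrite /= in_itv /= -ler_norml; apply: le_trans zr;
  rewrite -sqrtr_sqr ler_wsqrtr // ?lerDl ?lerDr sqr_ge0.
Qed.

Let near_neq0 (z : C) : z != 0 -> \forall y \near z, y != 0.
Proof. by move=> z0; apply: (@cvgr_neq0 _ C _ (nbhs z) _ id z). Qed.

Let Cplx_connected : connected [set: C].
Proof.
have -> : [set: C] = \bigcup_(z in [set: C])
    (fun t : R => t%:C%C * z : C) @` `[0, 1].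
  apply/seteqP; split=> // z _; exists z => //; exists 1; last exact: mul1r.
  by rewrite /= in_itv /= ler01 lexx.
apply: bigcup_connected.
  by exists 0 => z _; exists 0; [rewrite /= in_itv /= ler01 lexx|exact: mul0r].
move=> z _; apply: connected_continuous_connected;
  first exact: segment_connected.
apply: continuous_subspaceT => t.
by apply: cvgM; [exact: real_complex_continuous|exact: cvg_cst].
Qed.

Lemma sphere_hausdorff : hausdorff_space sphere.
Proof.
have disj (x : C) : ~ cluster (nbhs (Some x : sphere)) None.
  move=> /(_ (Some @` ball x 1)
             [set p | forall z, p = Some z -> `|x| + 1 < `|z|]).
  case.
  - exact/one_point_compactification_some_nbhs/nbhsx_ballx.
  - by apply: sphere_nbhs_infty; rewrite addr_ge0.
  - move=> _ [[z xz <-] /(_ z erefl) xz'].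
    suff /lt_trans/(_ xz') : `|z| < `|x| + 1 by rewrite ltxx.
    rewrite -ltrBlDl; apply: le_lt_trans (lerB_dist _ _) _.
    by rewrite distrC.
move=> [x|] [y|] // xy.
- congr Some; apply: (@norm_hausdorff _ C) => A B xA yB.
  have [_ [[a Aa <-] [b Bb [ba]]]] := xy _ _
    (one_point_compactification_some_nbhs _ _ xA)
    (one_point_compactification_some_nbhs _ _ yB).
  by exists a; split=> //; rewrite -ba.
- by case: (disj x).
- by case: (disj y) => A B yA nB; rewrite setIC; exact: xy.
Qed.

Lemma sphere_dom_cover p : exists b, sphere_dom b p.
Proof. by case: p => [z|]; [exists false|exists true]. Qed.

Lemma sphere_dom_open b : open (sphere_dom b).
Proof.
case: b; last first.
  suff -> : sphere_dom false = Some @` [set: C].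
    by apply: one_point_compactification_open_some; exact: openT.
  by apply/seteqP; split=> [[z|] //= _|_ [z _ <-] //]; exists z.
rewrite openE => -[z|] /=.
  move=> /eqP z0; have z0' : z != 0 by apply/eqP => zE; apply: z0; rewrite zE.
  by apply: filterS (near_neq0 z0') => y /= y0;
    apply/eqP => -[/eqP]; rewrite (negPf y0).
move=> _; apply: filterS (sphere_nbhs_infty (lexx 0)) => p pz /=.
by apply/eqP => /pz; rewrite normr0 ltxx.
Qed.

Lemma sphere_chart_image b : sphere_chart b @` sphere_dom b = setT.
Proof.
apply/seteqP; split=> // z _; case: b => /=; last by exists (Some z).
have [->|z0] := eqVneq z 0; first by exists None.
exists (Some z^-1) => /=; last by rewrite invrK.
by apply/eqP => -[] /eqP; rewrite invr_eq0 (negPf z0).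
Qed.

Lemma sphere_chartK b p :
  sphere_dom b p -> sphere_chartV b (sphere_chart b p) = p.
Proof.
case: b p => -[z|] //=; rewrite /sphere_chartV /= ?eqxx // invr_eq0 invrK.
by have [->|//] := eqVneq z 0; rewrite eqxx.
Qed.

Lemma sphere_chart_continuous b p :
  sphere_dom b p -> {for p, continuous (sphere_chart b)}.
Proof.
case: b p => -[z|] //=.
- move=> /eqP z0; have z0' : z != 0 by apply/eqP => zE; apply: z0; rewrite zE.
  exact: inv_continuous z0'.
- move=> _ U /(@nbhs_ballP _ C) [e /= e0 eU].
  have e1 : 0 <= e^-1 by rewrite invr_ge0 ltW.
  apply: (@filterS _ _ (nbhs_filter (None : sphere)) _ _ _
    (sphere_nbhs_infty e1)).
  move=> [z|] /= pz; apply: eU; rewrite -ball_normE /= ?subrr ?normr0 //.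
  have ez := pz z erefl; rewrite sub0r normrN normfV -[e]invrK ltf_pV2 //.
    by rewrite posrE; apply: lt_trans ez; rewrite invr_gt0.
  by rewrite posrE invr_gt0.
- by move=> _ U.
Qed.

Lemma sphere_chartV_continuous b : continuous (sphere_chartV b).
Proof.
case: b; last by move=> z U.
move=> z; have [->|z0] := eqVneq z 0; last first.
  have nz := near_neq0 z0.
  move=> U; rewrite {1}/sphere_chartV (negPf z0) => sU.
  have zU : nbhs z^-1 [set y : C | U (Some y)] by exact: sU.
  apply: filterS2 nz (inv_continuous z0 zU) => y /negPf y0 /=.
  by rewrite /sphere_chartV y0.
move=> U; rewrite {1}/sphere_chartV eqxx => -[K [cK _] KU].
have hK : \forall y \near (0 : C), K `<=` [set x | y != 0 -> y^-1 != x].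
  have cov := iffLR (compact_near_coveringP K) cK C (nbhs (0 : C)).
  apply: (cov (fun y x => y != 0 -> y^-1 != x)) => x _.
  have x1 : 0 < `|x| + 1 :> C by rewrite -[0]addr0 ler_ltD.
  exists (ball x 1, ball (0 : C) (`|x| + 1)^-1).
    by split; apply: (@nbhsx_ballx _ C); rewrite ?invr_gt0 ?ltr01.
  move=> [u y] /= []; rewrite -ball_normE /= => xu.
  rewrite sub0r normrN => yx y0; apply/eqP => yu.
  have : `|u| < `|x| + 1.
    rewrite -ltrBlDl; apply: le_lt_trans (lerB_dist _ _) _.
    by rewrite distrC.
  rewrite -yu normfV -ltf_pV2 ?posrE ?invr_gt0 ?normr_gt0 // invrK.
  by move=> /(lt_trans yx); rewrite ltxx.
apply: filterS hK => y Ky /=; apply: KU; rewrite /sphere_chartV.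
case: eqVneq => [_|y0]; first by right.
by left; exists y^-1 => // /Ky /(_ y0); rewrite eqxx.
Qed.

Lemma sphere_connected : connected [set: sphere].
Proof.
have -> : [set: sphere] =
    sphere_chartV true @` setT `|` sphere_chartV false @` setT.
  apply/seteqP; split=> // p _; have [[] pb] := sphere_dom_cover p.
    by left; exists (sphere_chart true p) => //; exact: sphere_chartK pb.
  by right; exists (sphere_chart false p) => //; exact: sphere_chartK pb.
apply: connectedU.
- exists (Some 1); split; exists 1 => //.
  by rewrite /sphere_chartV oner_eq0 invr1.
- apply: connected_continuous_connected; first exact: Cplx_connected.
  exact/continuous_subspaceT/sphere_chartV_continuous.
- apply: connected_continuous_connected; first exact: Cplx_connected.
  exact/continuous_subspaceT/sphere_chartV_continuous.
Qed.

Lemma sphere_transition b c p : sphere_dom b p -> sphere_dom c p ->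
  derivable (sphere_chart c \o sphere_chartV b) (sphere_chart b p) 1.
Proof.
move=> pb pc.
have [<-|bc] := eqVneq b c.
  suff -> : sphere_chart b \o sphere_chartV b = id by exact: derivable_id.
  apply/funext => z; rewrite /sphere_chartV /=; case: b {pb} => //.
  by case: eqP => [->|_] //=; rewrite invrK.
have -> : sphere_chart c \o sphere_chartV b = fun z => (id z)^-1.
  apply/funext => z; rewrite /sphere_chartV /=.
  case: b c bc {pb pc} => -[] //= _.
  by case: eqP => [->|_] //=; rewrite invr0.
apply: derivableV; last exact: derivable_id.
apply/eqP => p0; case: b c p bc pb pc p0 => -[] -[z|] //= _.
- by move=> /eqP z0 _ /eqP; rewrite invr_eq0 => /eqP z1; apply: z0; rewrite z1.
- by move=> _ /eqP z0 z1; apply: z0; rewrite z1.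
Qed.

Lemma sphere_chart_open b : open (sphere_chart b @` sphere_dom b).
Proof. by rewrite sphere_chart_image; exact: openT. Qed.

Definition CP1 : riemannSurface R :=
  @RiemannSurface R sphere bool sphere_dom sphere_chart sphere_chartV
    sphere_hausdorff sphere_connected (ex_intro _ None I)
    sphere_dom_cover sphere_dom_open sphere_chart_open sphere_chartK
    sphere_chart_continuous
    (fun b p _ => @sphere_chartV_continuous b (sphere_chart b p))
    sphere_transition.

End RiemannSphere.

(* Main.v *)
(* It suffices to find an automorphism M of the sphere for which F = M o f and its
   conjugate h = conj o F o sigma satisfy h = t F + r. On a compact surface a
   nonconstant meromorphic function has as many zeros as poles: the number of zeros
   of F - w does not depend on w, and for w != 0 it is also that of 1 / F - 1 / w.
   So divisors determine functions up to constants. A real critical point c is a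
   double point of its fibre for F and for h.

   Degree 2. Send one critical value to infinity. With a second real critical point,
   F - v and h - conj v have the same divisor. For g > 0, some h - k F has at most a
   simple pole, at c; if it were a nonconstant function u, then for every holomorphic
   1-form w the quotient w / du would have a double zero and no poles, so w = 0.

   Degree 3. Send three critical values to infinity, 0, 1, and let x be a fourth one.
   The combinations s4 = h - F, s3 = x h - conj x F and
   s2 = (h - 1) - (conj x - 1) / (x - 1) (F - 1) each vanish doubly at two critical
   points, so if none is zero their divisors are known, and y = s3 / s4,
   y' = s3 / s2 have only a double pole, at c3. Some u = y' - t y then has at most a
   simple pole. If u is constant, eliminating h gives an equation for F in y whose
   poles are inconsistent. If u is not constant, it makes the surface a sphere with a
   real coordinate v, in which F (v - be) = k v^2 (v - al); the double points at
   v = 1 and v = l force al be = l and al + 3 be = 2 (1 + l) with l real, hence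
   al, be, k and x are real. But then s4 would vanish at the fourth critical point
   too, which its divisor forbids. *)
Require Import Defs.
From HB Require Import structures.
From mathcomp Require Import all_boot all_order all_algebra.
From mathcomp Require Import all_classical all_reals all_analysis.
From mathcomp Require Import complex finmap.
From mathcomp Require Import ring lra zify.

Set Implicit Arguments.
Unset Strict Implicit.
Unset Printing Implicit Defensive.

Import Order.TTheory GRing.Theory Num.Theory numFieldNormedType.Exports.
Local Open Scope ring_scope.
Local Open Scope classical_set_scope.

(** * Complex derivatives *)

(** Nothing is integrated on the surface itself. Equality of zeros and poles rests on a local fact,
    that a zero of order e splits into e zeros of F - w for small w, proved in a chart by the
    argument principle on a square; compactness makes the count locally constant in w, and
    connectedness of the real line makes it constant. The integral of 1 / z is never computed, only
    shown to be nonzero. An affine relation h = t F + r suffices because it yields a map of the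
    sphere carrying f p to f (sigma p); f being surjective, this map is an involution without any
    condition on t and r. As the critical points are real, h takes at each of them the conjugate of
    the value of F, which is all that is known of h. In degree 3 the obstacle is the third point of
    each fibre, over which there is no control: the third poles b of F and b' = sigma b of h may
    differ. But s2, s3 and s4 share the pole bound 2 c1 + b + b', exhausted by their two double
    zeros, so the unknown points cancel from the quotients y and y'. *)

Section DerivableClosedField.
Variable K : numClosedFieldType.
Implicit Types (f h : K -> K) (x k : K).

Lemma derivableD_ptws f h x : derivable f x 1 -> derivable h x 1 ->
  derivable (fun z => f z + h z) x 1.
Proof. by move=> df dh; exact: derivableD. Qed.

Lemma derivableB_ptws f h x : derivable f x 1 -> derivable h x 1 ->
  derivable (fun z => f z - h z) x 1.
Proof. by move=> df dh; exact: derivableB. Qed.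

Lemma derivableM_ptws f h x : derivable f x 1 -> derivable h x 1 ->
  derivable (fun z => f z * h z) x 1.
Proof. by move=> df dh; exact: derivableM. Qed.

Lemma derivableV_ptws f x : f x != 0 -> derivable f x 1 ->
  derivable (fun z => (f z)^-1) x 1.
Proof. by move=> fx df; exact: derivableV. Qed.

Lemma derivable_cst_ptws k x : derivable (fun _ : K => k) x 1.
Proof. exact: derivable_cst. Qed.

Lemma derivable_id_ptws x : derivable (fun z : K => z) x 1.
Proof. exact: derivable_id. Qed.

Lemma derive1M_ptws f h x : derivable f x 1 -> derivable h x 1 ->
  derive1 (fun z => f z * h z) x = derive1 f x * h x + f x * derive1 h x.
Proof.
move=> df dh; rewrite !derive1E.
have -> : (fun z => f z * h z) = f * h by [].
by rewrite deriveM // addrC; congr (_ + _); rewrite [LHS]mulrC.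
Qed.

Lemma near_derivable f h x : (\forall z \near x, f z = h z) ->
  derivable f x 1 -> derivable h x 1.
Proof. exact: near_eq_derivable. Qed.

Lemma near_derive1 f h x : (\forall z \near x, f z = h z) ->
  derive1 f x = derive1 h x.
Proof. by move=> fh; rewrite !derive1E; exact: near_eq_derive. Qed.

End DerivableClosedField.

(** * Real-valued modulus and the increment form of the derivative *)

Section Norm.
Variable R : realType.
Local Notation C := (Cplx R).
Implicit Types (x y z w : C) (A : set C) (f : C -> C).

(** The norm of [C] takes its values in [C]; its real part brings estimates into the ordered field
    [R], where [lra] applies. *)
Definition nrm z : R := complex.Re `|z|.

Lemma nrmE z : `|z| = (nrm z)%:C%C :> C.
Proof. by rewrite /nrm RRe_real // normr_real. Qed.

Lemma nrm0 : nrm 0 = 0. Proof. by rewrite /nrm normr0. Qed.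

Lemma nrm1 : nrm 1 = 1. Proof. by rewrite /nrm normr1. Qed.

Lemma nrm_ge0 z : 0 <= nrm z.
Proof. by rewrite -lecR -nrmE normr_ge0. Qed.

Lemma nrm_eq0 z : (nrm z == 0) = (z == 0).
Proof. by rewrite -[RHS]normr_eq0 nrmE -(inj_eq (@complexI R)). Qed.

Lemma nrm_gt0 z : (0 < nrm z) = (z != 0).
Proof. by rewrite lt_def nrm_ge0 andbT nrm_eq0. Qed.

Lemma nrmD x y : nrm (x + y) <= nrm x + nrm y.
Proof. by rewrite -lecR rmorphD /= -!nrmE ler_normD. Qed.

Lemma nrmN x : nrm (- x) = nrm x.
Proof. by rewrite /nrm normrN. Qed.

Lemma nrmB x y : nrm (x - y) <= nrm x + nrm y.
Proof. by rewrite -(nrmN y) nrmD. Qed.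

Lemma nrmC x y : nrm (x - y) = nrm (y - x).
Proof. by rewrite -nrmN opprB. Qed.

Lemma nrm_tri z x y : nrm (x - y) <= nrm (x - z) + nrm (z - y).
Proof. by apply: le_trans (nrmD _ _); rewrite addrA subrK. Qed.

Lemma nrmM x y : nrm (x * y) = nrm x * nrm y.
Proof. by apply: (@complexI R); rewrite rmorphM /= -!nrmE normrM. Qed.

Lemma nrmV x : nrm x^-1 = (nrm x)^-1.
Proof. by apply: (@complexI R); rewrite fmorphV /= -!nrmE normfV. Qed.

Lemma nrmX x n : nrm (x ^+ n) = nrm x ^+ n.
Proof. by apply: (@complexI R); rewrite rmorphXn /= -!nrmE normrX. Qed.

Lemma nrmR (r : R) : nrm (r%:C%C : C) = `|r|.
Proof.
by apply: (@complexI R); rewrite -nrmE normc_def /= expr0n addr0 sqrtr_sqr.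
Qed.

Lemma nrm_conj z : nrm z^* = nrm z.
Proof. by rewrite /nrm norm_conjC. Qed.

Lemma Re_nrm z : complex.Re z <= nrm z.
Proof.
rewrite -lecR -nrmE; apply: le_trans (normc_ge_Re z).
by rewrite lecR ler_norm.
Qed.

Lemma nbhs_nrmP z A :
  nbhs z A <-> exists2 e : R, 0 < e & forall y, nrm (y - z) < e -> A y.
Proof.
split=> [/(@nbhs_ballP _ C) [e /= e0 eA]|[e e0 eA]].
  have eE : e = (complex.Re e)%:C%C by rewrite RRe_real // realE ltW.
  exists (complex.Re e); first by rewrite -ltcR -eE.
  move=> y; rewrite -ltcR -nrmE -eE => yz; apply: eA.
  by rewrite -ball_normE /= distrC.
apply/(@nbhs_ballP _ C); exists (e%:C%C) => /=; first by rewrite ltcR.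
by move=> y; rewrite -ball_normE /= distrC nrmE ltcR; exact: eA.
Qed.

Lemma near_nrm z (e : R) : 0 < e -> \forall y \near z, nrm (y - z) < e.
Proof. by move=> e0; apply/nbhs_nrmP; exists e. Qed.

Lemma cvg_nrmP T (F : set_system T) (FF : Filter F) (f : T -> C) l :
  f @ F --> l <-> forall e : R, 0 < e -> \forall t \near F, nrm (f t - l) < e.
Proof.
split=> [fl e e0|fl U /nbhs_nrmP [e e0 eU]].
  exact: (fl [set y | nrm (y - l) < e] (near_nrm l e0)).
by apply: filterS (fl _ e0) => t /eU.
Qed.

Lemma nrm_ub_closed (T : topologicalType) (F : set_system T) (FF : ProperFilter F)
    (f : T -> C) l c (M : R) :
  f @ F --> l -> (\forall t \near F, nrm (f t - c) <= M) -> nrm (l - c) <= M.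
Proof.
move=> /cvg_nrmP fl fM; apply/ler_addgt0Pr => e e0.
have [t [ft fc]] := filter_ex (filterI (fl _ e0) fM).
apply: le_trans (nrm_tri (f t) _ _) _; rewrite addrC lerD //.
by rewrite nrmC ltW.
Qed.

Definition cder (f : C -> C) x l := forall e : R, 0 < e ->
  \forall y \near x, nrm (f y - f x - l * (y - x)) <= e * nrm (y - x).

Lemma cderP f x l : cder f x l <-> is_derive x 1 f l.
Proof.
have key (e : R) : 0 < e -> (\forall h \near (0 : C)^', nrm (h^-1 *: (f (h *: (1 : C) + x) - f x) - l) < e) ->
     \forall y \near x, nrm (f y - f x - l * (y - x)) <= e * nrm (y - x).
  move=> e0 /nbhs_nrmP [d d0 dP]; apply/nbhs_nrmP; exists d => // y yx.
  have [->|nyx] := eqVneq y x.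
    by rewrite !subrr mulr0 subr0 nrm0 mulr0.
  have nyx' : y - x != 0 by rewrite subr_eq0.
  have := dP (y - x); rewrite subr0 => /(_ yx nyx').
  rewrite [_ *: 1]mulr1 subrK => /ltW.
  rewrite -(ler_pM2r (x := nrm (y - x))) ?nrm_gt0 // -nrmM mulrBl.
  by rewrite [_ *: _]mulrC divfK.
split=> [fl|].
- suff H : (fun h : C => h^-1 *: (f (h *: (1 : C) + x) - f x)) @ 0^' --> l.
    apply: DeriveDef; first by apply/cvg_ex; exists l.
    exact: cvg_lim.
  apply/cvg_nrmP => e e0; have e20 : 0 < e / 2 by rewrite divr_gt0.
  have /nbhs_nrmP [d d0 dP] := fl _ e20.
  apply/nbhs_nrmP; exists d => // h; rewrite subr0 => hd h0.
  have := dP (h + x); rewrite addrK => /(_ hd).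
  rewrite -ler_pdivrMr ?nrm_gt0 // -nrmV -nrmM mulrC mulrBr mulrCA mulVf // mulr1.
  by rewrite [_ *: 1]mulr1 => /le_lt_trans; apply; lra.
- move=> [df dl] e e0; apply: key => //.
  have H : (fun h : C => h^-1 *: (f (h *: (1 : C) + x) - f x)) @ 0^' --> l by rewrite -dl.
  by move/cvg_nrmP : H; apply.
Qed.

Lemma derivable_cder f x : derivable f x 1 -> cder f x (derive1 f x).
Proof. by move=> df; apply/cderP; rewrite derive1E; exact: derivableP. Qed.

Lemma cder_derivable f x l : cder f x l -> derivable f x 1.
Proof. by move=> /cderP []. Qed.

Lemma cder_derive1 f x l : cder f x l -> derive1 f x = l.
Proof. by move=> /cderP [_]; rewrite derive1E. Qed.

Lemma derivable_cts f x : derivable f x 1 -> {for x, continuous f}.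
Proof. by move=> /derivable1_diffP; exact: differentiable_continuous. Qed.

Lemma cder_comp f (h : C -> C) x a b :
  cder f x b -> cder h (f x) a -> cder (h \o f) x (a * b).
Proof.
move=> fb ha e e0.
have a1 : 0 < nrm a + 1 by rewrite ltr_wpDl ?nrm_ge0.
have b1 : 0 < nrm b + 1 by rewrite ltr_wpDl ?nrm_ge0.
have e1 : 0 < e / 2 / (nrm b + 1) by rewrite !divr_gt0.
have e2 : 0 < e / 2 / (nrm a + 1) by rewrite !divr_gt0.
have cf : {for x, continuous f} := derivable_cts (cder_derivable fb).
have := cf _ (ha _ e1).
rewrite -[X in X -> _]/(\forall y \near x, nrm (h (f y) - h (f x) - a * (f y - f x)) <=
   e / 2 / (nrm b + 1) * nrm (f y - f x)).
apply: filterS3 (fb _ e2) (fb _ ltr01) => y H2 H1 H3 /=.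
have -> : h (f y) - h (f x) - a * b * (y - x) =
  (h (f y) - h (f x) - a * (f y - f x)) + a * (f y - f x - b * (y - x)) by ring.
apply: le_trans (nrmD _ _) _; rewrite nrmM.
have H4 : nrm (f y - f x) <= (nrm b + 1) * nrm (y - x).
  have -> : f y - f x = (f y - f x - b * (y - x)) + b * (y - x) by ring.
  by apply: le_trans (nrmD _ _) _; rewrite nrmM; lra.
have H5 : e / 2 / (nrm b + 1) * nrm (f y - f x) <= e / 2 * nrm (y - x).
  apply: le_trans (ler_wpM2l (ltW e1) H4) _.
  by rewrite mulrA divfK // gt_eqF.
have H6 : nrm a * nrm (f y - f x - b * (y - x)) <= e / 2 * nrm (y - x).
  apply: le_trans (ler_wpM2l (nrm_ge0 a) H2) _.
  rewrite mulrA ler_wpM2r ?nrm_ge0 // mulrA ler_pdivrMr // mulrC ler_wpM2l //; lra.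
by lra.
Qed.

(* An inductive wrapper: unification must never unfold [derivable]. *)
Variant cdiff f x : Prop := Cdiff of derivable f x 1.

Lemma cdiffP f x : cdiff f x <-> derivable f x 1.
Proof. by split=> [[]|]. Qed.

Lemma cdiff_cder f x : cdiff f x -> cder f x (derive1 f x).
Proof. by move=> [] /derivable_cder. Qed.

Lemma cder_cdiff f x l : cder f x l -> cdiff f x.
Proof. by move=> /cder_derivable. Qed.

Lemma cdiff_cts f x : cdiff f x -> {for x, continuous f}.
Proof. by move=> [] /derivable_cts. Qed.

Lemma cdiff_comp f (h : C -> C) x :
  cdiff f x -> cdiff h (f x) -> cdiff (fun z => h (f z)) x.
Proof.
by move=> /cdiff_cder df /cdiff_cder /(cder_comp df) /cder_cdiff.
Qed.

Lemma derive1_compC f (h : C -> C) x : cdiff f x -> cdiff h (f x) ->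
  derive1 (fun z => h (f z)) x = derive1 h (f x) * derive1 f x.
Proof.
by move=> /cdiff_cder df /cdiff_cder /(cder_comp df) /cder_derive1.
Qed.

Lemma cdiffD f (h : C -> C) x :
  cdiff f x -> cdiff h x -> cdiff (fun z => f z + h z) x.
Proof. by move=> [df] [dh]; constructor; exact: (@derivableD_ptws C f h x df dh). Qed.

Lemma cdiffB f (h : C -> C) x :
  cdiff f x -> cdiff h x -> cdiff (fun z => f z - h z) x.
Proof. by move=> [df] [dh]; constructor; exact: (@derivableB_ptws C f h x df dh). Qed.

Lemma cdiffM f (h : C -> C) x :
  cdiff f x -> cdiff h x -> cdiff (fun z => f z * h z) x.
Proof. by move=> [df] [dh]; constructor; exact: (@derivableM_ptws C f h x df dh). Qed.

Lemma derive1M f (h : C -> C) x : cdiff f x -> cdiff h x ->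
  derive1 (fun z => f z * h z) x = derive1 f x * h x + f x * derive1 h x.
Proof.
by move=> [df] [dh]; exact: (@derive1M_ptws C f h x df dh).
Qed.

Lemma cdiffV f x : f x != 0 -> cdiff f x -> cdiff (fun z => (f z)^-1) x.
Proof. by move=> fx [df]; constructor; exact: (@derivableV_ptws C f x fx df). Qed.

Lemma cdiff_div f (h : C -> C) x :
  h x != 0 -> cdiff f x -> cdiff h x -> cdiff (fun z => f z / h z) x.
Proof. by move=> hx df dh; exact: cdiffM df (cdiffV hx dh). Qed.

Lemma cdiff_cst k x : cdiff (fun _ : C => k : C) x.
Proof. by constructor; exact: (@derivable_cst_ptws C k x). Qed.

Lemma cdiff_id x : cdiff (fun z : C => z) x.
Proof. by constructor; exact: (@derivable_id_ptws C x). Qed.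

Lemma cdiff_subc c x : cdiff (fun z : C => z - c) x.
Proof. exact: cdiffB (cdiff_id x) (cdiff_cst c x). Qed.

Lemma cdiffX f n x : cdiff f x -> cdiff (fun z => f z ^+ n) x.
Proof.
move=> df; elim: n => [|n IH]; first exact: cdiff_cst.
have -> : (fun z => f z ^+ n.+1) = (fun z => f z * f z ^+ n).
  by apply/funext => z; rewrite exprS.
exact: cdiffM.
Qed.

Lemma eq_cdiff f (h : C -> C) x :
  (\forall z \near x, f z = h z) -> cdiff f x -> cdiff h x.
Proof. by move=> fh [df]; constructor; exact: (@near_derivable C f h x fh df). Qed.

Lemma eq_derive1 f (h : C -> C) x :
  (\forall z \near x, f z = h z) -> derive1 f x = derive1 h x.
Proof. exact: (@near_derive1 C f h x). Qed.

End Norm.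

(** * Integrals and Cauchy's formula *)

Section Mean.
Variable R : realType.
Local Notation C := (Cplx R).
Implicit Types (x y z w a b c : C) (A B : set C) (f g : C -> C).

Lemma closed_nrm A :
  (forall z, (forall e : R, 0 < e -> exists2 y, A y & nrm (y - z) < e) -> A z) ->
  closed A.
Proof.
move=> HA z zA; apply: HA => e e0.
by have [y [Ay yz]] := zA _ (near_nrm z e0); exists y.
Qed.

(** The disc is a closed part of the continuous image of a real square, whose compactness comes from
    that of segments. *)
Lemma compact_nball c (r : R) : compact [set z : C | nrm (z - c) <= r].
Proof.
pose toC (p : R * R) : C := c + (p.1%:C%C + 'i%C * p.2%:C%C).
have real_cts : continuous (real_complex R : R -> C).
  move=> x; apply/cvg_nrmP => e e0.
  near=> y; rewrite -rmorphB nrmR distrC.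
  by near: y; apply: cvgr_dist_lt.
have toC_cont : continuous toC.
  move=> p; apply: cvgD; first exact: cvg_cst.
  apply: cvgD.
    apply: (@cvg_comp _ _ _ (fun p : R * R => p.1) (real_complex R : R -> C));
      [exact: cvg_fst|exact: real_cts].
  apply: cvgM; first exact: cvg_cst.
  apply: (@cvg_comp _ _ _ (fun p : R * R => p.2) (real_complex R : R -> C));
    [exact: cvg_snd|exact: real_cts].
have cbox : compact (toC @` (`[-r, r] `*` `[-r, r])).
  apply: continuous_compact; first exact: continuous_subspaceT.
  by apply: compact_setX; exact: segment_compact.
apply: (subclosed_compact _ cbox).
- apply: closed_nrm => z zr; apply/ler_addgt0Pr => e e0 /=.
  have [y yc yz] := zr _ e0.
  by apply: le_trans (nrm_tri y _ _) _; rewrite addrC lerD // nrmC ltW.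
- move=> z zr.
  have zr' : Num.sqrt (complex.Re (z - c) ^+ 2 + complex.Im (z - c) ^+ 2) <= r.
    by have := normc_def (z - c); rewrite -[ `|_| ]/(`|(z - c : C)|) nrmE => /(@complexI R) <-.
  exists (complex.Re (z - c), complex.Im (z - c)); last first.
    have E : toC (complex.Re (z - c), complex.Im (z - c)) = c + (z - c).
      by congr (c + _); rewrite [RHS](complexE (z - c)).
    by rewrite E addrC subrK.
  by split; rewrite /= in_itv /= -ler_norml; apply: le_trans zr';
    rewrite -sqrtr_sqr ler_wsqrtr // ?lerDl ?lerDr sqr_ge0.
Unshelve. all: by end_near. Qed.

(* Along a fixed ultrafilter every bounded sequence converges, so the Riemann
   sums below get a limit without any proof of integrability. *)
Lemma ultra_oo : exists U : set_system nat, UltraFilter U /\ \oo `<=` U.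
Proof. exact: (@ultraFilterLemma _ (\oo : set_system nat)). Qed.

Definition uoo : set_system nat := projT1 (cid ultra_oo).

Lemma uoo_ultra : UltraFilter uoo.
Proof. by rewrite /uoo; case: cid => U []. Qed.

Lemma uoo_proper : ProperFilter uoo.
Proof. exact: (@ultra_proper _ _ uoo_ultra). Qed.
#[local] Existing Instance uoo_proper.

Lemma uoo_oo : \oo `<=` uoo.
Proof. by rewrite /uoo; case: cid => U []. Qed.

Definition ulim (s : nat -> C) : C := lim (s @ uoo).

Lemma ulim_cvg (s : nat -> C) (M : R) :
  (forall n, nrm (s n) <= M) -> s @ uoo --> ulim s.
Proof.
move=> sM; have := @compact_nball 0 M; rewrite compact_ultra.
have sU : UltraFilter (s @ uoo).
  constructor; first exact: fmap_proper_filter.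
  move=> G GP sG; apply/seteqP; split=> A; last exact: sG.
  move=> GA; have [//|nA] := in_ultra_setVsetC (s @^-1` A) uoo_ultra.
  have GnA : G (~` A) by apply: sG.
  by have [x []] := filter_ex (filterI GA GnA).
move=> /(_ (s @ uoo) sU) [].
  by apply: nearW => n /=; rewrite subr0.
move=> l [_ sl]; suff -> : ulim s = l by [].
exact: cvg_lim sl.
Qed.

Lemma ulimE (s : nat -> C) l : s @ uoo --> l -> ulim s = l.
Proof. by move=> sl; apply: cvg_lim sl. Qed.

Lemma ulim_nrm (s : nat -> C) (M e : R) c N : (forall n, nrm (s n) <= M) ->
  (forall n, (N <= n)%N -> nrm (s n - c) <= e) -> nrm (ulim s - c) <= e.
Proof.
move=> /ulim_cvg sl sc; apply: nrm_ub_closed sl _.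
by apply: uoo_oo; exists N.
Qed.

(* Dyadic midpoint Riemann sum on [a, b], divided by b - a. *)
Fixpoint dsum n f a b : C :=
  if n is n'.+1 then (dsum n' f a ((a + b) / 2) + dsum n' f ((a + b) / 2) b) / 2
  else f ((a + b) / 2).

(** Dyadic sums sample only iterated midpoints, so midpoint convexity is enough and segments need no
    parametrisation. *)
Definition mconv A := forall x y, A x -> A y -> A ((x + y) / 2).

Definition bdd_on A f := exists M : R, forall z, A z -> nrm (f z) <= M.

Lemma nrm_half : nrm (2^-1 : C) = 2^-1.
Proof.
have -> : (2^-1 : C) = (2^-1 : R)%:C%C by rewrite fmorphV /= rmorph_nat.
by rewrite nrmR ger0_norm // invr_ge0.
Qed.

Lemma nrm_avg x y (M : R) : nrm x <= M -> nrm y <= M -> nrm ((x + y) / 2) <= M.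
Proof.
move=> xM yM; rewrite nrmM nrm_half; have := nrmD x y; lra.
Qed.

Lemma dsum_le A (M : R) f n a b : mconv A -> A a -> A b ->
  (forall z, A z -> nrm (f z) <= M) -> nrm (dsum n f a b) <= M.
Proof.
move=> cA Aa Ab fM; elim: n a b Aa Ab => [|n IH] a b Aa Ab /=.
  by apply: fM; exact: cA.
by apply: nrm_avg; apply: IH => //; exact: cA.
Qed.

Lemma dsumD f g k n a b :
  dsum n (fun z => f z + k * g z) a b = dsum n f a b + k * dsum n g a b.
Proof. by elim: n a b => //= n IH a b; rewrite !IH; ring. Qed.

Lemma eq_dsum A f g n a b : mconv A -> A a -> A b ->
  (forall z, A z -> f z = g z) -> dsum n f a b = dsum n g a b.
Proof.
move=> cA Aa Ab fg; elim: n a b Aa Ab => [|n IH] a b Aa Ab /=.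
  by apply: fg; exact: cA.
by rewrite !IH //; exact: cA.
Qed.

Lemma dsum_cst k n a b : dsum n (fun=> k) a b = k.
Proof. by elim: n a b => //= n IH a b; rewrite !IH; field. Qed.

Lemma dsum_id n a b : dsum n (fun z => z) a b = (a + b) / 2.
Proof. by elim: n a b => //= n IH a b; rewrite !IH; field. Qed.

Lemma dsum_rev f n a b : dsum n f a b = dsum n f b a.
Proof.
elim: n a b => [|n IH] a b /=; first by rewrite addrC.
by rewrite (IH a) (IH _ b) (addrC a b) (addrC (dsum _ _ _ _)).
Qed.

Lemma dsum_comp f k d n a b :
  dsum n f (k * a + d) (k * b + d) = dsum n (fun z => f (k * z + d)) a b.
Proof.
elim: n a b => [|n IH] a b /=; first by congr f; field.
have -> : (k * a + d + (k * b + d)) / 2 = k * ((a + b) / 2) + d by field.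
by rewrite !IH.
Qed.

End Mean.

(** * Goursat's theorem for Riemann sums *)

Section Goursat.
Variable R : realType.
Local Notation C := (Cplx R).
Implicit Types (x y z w a b c : C) (A B : set C) (f g : C -> C).

Lemma leq4 (m1 m2 m3 m4 n : nat) : (m1 + m2 + m3 + m4 <= n)%N ->
  [/\ m1 <= n, m2 <= n, m3 <= n & m4 <= n]%N.
Proof. by move=> H; split; lia. Qed.

Definition tri n f a b c := (b - a) * dsum n f a b + (c - b) * dsum n f b c
  + (a - c) * dsum n f c a.

(** An exact identity at every level, not only in the limit: the three inner edges are traversed in
    both directions and cancel by [dsum_rev]. This lets Goursat's subdivision run on Riemann
    sums. *)
Lemma triS n f a b c :
  tri n.+1 f a b c =
  tri n f a ((a + b) / 2) ((c + a) / 2) + tri n f ((a + b) / 2) b ((b + c) / 2)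
  + tri n f ((c + a) / 2) ((b + c) / 2) c
  + tri n f ((a + b) / 2) ((b + c) / 2) ((c + a) / 2).
Proof.
rewrite /tri /= (dsum_rev f n ((c + a) / 2) ((a + b) / 2)).
rewrite (dsum_rev f n ((b + c) / 2) ((a + b) / 2)).
rewrite (dsum_rev f n ((c + a) / 2) ((b + c) / 2)).
by field.
Qed.

Lemma triD n f g k a b c :
  tri n (fun z => f z + k * g z) a b c = tri n f a b c + k * tri n g a b c.
Proof. by rewrite /tri !dsumD; ring. Qed.

(** The midpoint rule is exact on affine functions, so the linear part of [f] at a point contributes
    nothing. *)
Lemma tri_affine n k l a b c : tri n (fun z => k + l * z) a b c = 0.
Proof. by rewrite triD /tri !dsum_cst !dsum_id; field. Qed.

Lemma tri_le n f A (M D : R) a b c : mconv A -> A a -> A b -> A c ->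
  (forall z, A z -> nrm (f z) <= M) ->
  nrm (b - a) <= D -> nrm (c - b) <= D -> nrm (a - c) <= D ->
  nrm (tri n f a b c) <= 3 * D * M.
Proof.
move=> cA Aa Ab Ac fM ab bc ca.
have M0 : 0 <= M by apply: le_trans (fM _ Aa); exact: nrm_ge0.
have key x y : A x -> A y -> nrm (y - x) <= D -> nrm ((y - x) * dsum n f x y) <= D * M.
  move=> Ax Ay xy; rewrite nrmM; apply: ler_pM => //; rewrite ?nrm_ge0 //.
  exact: dsum_le fM.
have := key _ _ Aa Ab ab; have := key _ _ Ab Ac bc; have := key _ _ Ac Aa ca.
have := nrmD ((b - a) * dsum n f a b) ((c - b) * dsum n f b c).
have := nrmD ((b - a) * dsum n f a b + (c - b) * dsum n f b c) ((a - c) * dsum n f c a).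
by rewrite -/(tri n f a b c); lra.
Qed.

Lemma mconv_ball c (r : R) : mconv [set z : C | nrm (z - c) <= r].
Proof.
move=> x y /= xr yr; have -> : (x + y) / 2 - c = ((x - c) + (y - c)) / 2 by field.
exact: nrm_avg.
Qed.

Lemma mconvI A B : mconv A -> mconv B -> mconv (A `&` B).
Proof. by move=> cA cB x y [Ax Bx] [Ay By]; split; [exact: cA|exact: cB]. Qed.

Lemma closed_lim A z : closed A ->
  (forall e : R, 0 < e -> exists2 y, A y & nrm (y - z) < e) -> A z.
Proof.
move=> cA zA; apply: cA => B /nbhs_nrmP [e e0 eB].
by have [y Ay yz] := zA _ e0; exists y; split=> //; exact: eB.
Qed.

(* The integral along the triangle vanishes, at the level of Riemann sums. *)
Definition tri_null f a b c := forall e : R, 0 < e ->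
  exists N : nat, forall n, (N <= n)%N -> nrm (tri n f a b c) <= e.

Definition tri_bad f (e : R) (t : C * C * C) :=
  forall N : nat, exists2 n, (N <= n)%N & e < nrm (tri n f t.1.1 t.1.2 t.2).

Lemma tri_badN f (e : R) t : ~ tri_bad f e t ->
  exists N : nat, forall n, (N <= n)%N -> nrm (tri n f t.1.1 t.1.2 t.2) <= e.
Proof.
move=> /existsNP [N HN]; exists N => n Nn; rewrite leNgt; apply/negP => en.
by apply: HN; exists n.
Qed.

(** If the sums over all four parts were eventually at most [e / 4], [triS] would bound those over
    [t] by [e]. The last clause makes the first vertices of successive triangles converge. *)
Lemma tri_bad_split f (e D : R) A t : mconv A ->
  A t.1.1 -> A t.1.2 -> A t.2 ->
  nrm (t.1.2 - t.1.1) <= D -> nrm (t.2 - t.1.2) <= D -> nrm (t.1.1 - t.2) <= D ->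
  tri_bad f e t ->
  exists t' : C * C * C, [/\ (A t'.1.1 /\ A t'.1.2) /\ A t'.2,
   nrm (t'.1.2 - t'.1.1) <= D / 2, nrm (t'.2 - t'.1.2) <= D / 2,
   nrm (t'.1.1 - t'.2) <= D / 2 & tri_bad f (e / 4) t' /\ nrm (t'.1.1 - t.1.1) <= D].
Proof.
case: t => [[a b] c] /= cA Aa Ab Ac ab bc ca bad.
have D0 : 0 <= D by apply: le_trans ab; exact: nrm_ge0.
pose m1 := (a + b) / 2; pose m2 := (b + c) / 2; pose m3 := (c + a) / 2.
have h x y : nrm (x - y) <= D -> nrm ((x - y) / 2) <= D / 2.
  by move=> xy; rewrite nrmM nrm_half ler_pM2r.
have Am1 : A m1 by exact: cA.
have Am2 : A m2 by exact: cA.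
have Am3 : A m3 by exact: cA.
have e1 : m1 - a = (b - a) / 2 by rewrite /m1; field.
have e1' : b - m1 = (b - a) / 2 by rewrite /m1; field.
have e2 : m2 - b = (c - b) / 2 by rewrite /m2; field.
have e2' : c - m2 = (c - b) / 2 by rewrite /m2; field.
have e3 : m3 - c = (a - c) / 2 by rewrite /m3; field.
have e3' : a - m3 = (a - c) / 2 by rewrite /m3; field.
have e21 : m2 - m1 = - ((a - c) / 2) by rewrite /m1 /m2; field.
have e32 : m3 - m2 = - ((b - a) / 2) by rewrite /m3 /m2; field.
have e13 : m1 - m3 = - ((c - b) / 2) by rewrite /m1 /m3; field.
apply: contrapT => H.
have good x y z : (A x /\ A y) /\ A z -> nrm (y - x) <= D / 2 ->
   nrm (z - y) <= D / 2 -> nrm (x - z) <= D / 2 -> nrm (x - a) <= D ->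
   exists N : nat, forall n, (N <= n)%N -> nrm (tri n f x y z) <= e / 4.
  move=> Axyz xy yz zx xa; apply: (@tri_badN f (e / 4) (x, y, z)) => bd.
  by apply: H; exists (x, y, z); split.
have [N1 H1] : exists N : nat, forall n, (N <= n)%N -> nrm (tri n f a m1 m3) <= e / 4.
  apply: good => //; last by rewrite subrr nrm0.
  - by rewrite e1; apply: h.
  - by rewrite -opprB nrmN e13 nrmN; apply: h.
  - by rewrite e3'; apply: h.
have [N2 H2] : exists N : nat, forall n, (N <= n)%N -> nrm (tri n f m1 b m2) <= e / 4.
  apply: good => //.
  - by rewrite e1'; apply: h.
  - by rewrite e2; apply: h.
  - by rewrite -opprB nrmN e21 nrmN; apply: h.
  - by rewrite e1; apply: le_trans (h _ _ ab) _; lra.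
have [N3 H3] : exists N : nat, forall n, (N <= n)%N -> nrm (tri n f m3 m2 c) <= e / 4.
  apply: good => //.
  - by rewrite -opprB nrmN e32 nrmN; apply: h.
  - by rewrite e2'; apply: h.
  - by rewrite e3; apply: h.
  - by rewrite nrmC e3'; apply: le_trans (h _ _ ca) _; lra.
have [N4 H4] : exists N : nat, forall n, (N <= n)%N -> nrm (tri n f m1 m2 m3) <= e / 4.
  apply: good => //.
  - by rewrite e21 nrmN; apply: h.
  - by rewrite e32 nrmN; apply: h.
  - by rewrite e13 nrmN; apply: h.
  - by rewrite e1; apply: le_trans (h _ _ ab) _; lra.
(* The successor gives a bad level of the form [n.+1] with [n] beyond all four thresholds, as [triS]
   requires. *)
have [n] := bad (N1 + N2 + N3 + N4).+1.
case: n => // n; rewrite ltnS => Nn; apply/negP; rewrite -leNgt triS.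
have [/H1 {}H1 /H2 {}H2 /H3 {}H3 /H4 {}H4] := leq4 Nn.
rewrite -/m1 -/m2 -/m3.
have := nrmD (tri n f a m1 m3) (tri n f m1 b m2).
have := nrmD (tri n f a m1 m3 + tri n f m1 b m2) (tri n f m3 m2 c).
have := nrmD (tri n f a m1 m3 + tri n f m1 b m2 + tri n f m3 m2 c) (tri n f m1 m2 m3).
lra.
Qed.

Lemma geom_limit (D : R) (u : nat -> C) : 0 <= D ->
  (forall k, nrm (u k.+1 - u k) <= D / 2 ^+ k) ->
  exists z, forall k, nrm (z - u k) <= 2 * D / 2 ^+ k.
Proof.
move=> D0 uD.
have two (k : nat) : 0 < (2 ^+ k : R) by rewrite exprn_gt0.
have key k j : nrm (u (k + j)%N - u k) <= 2 * D / 2 ^+ k - 2 * D / 2 ^+ (k + j).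
  elim: j => [|j IH]; first by rewrite addn0 !subrr nrm0.
  apply: le_trans (nrm_tri (u (k + j)%N) _ _) _.
  have := uD (k + j)%N; rewrite addnS exprS invfM.
  have := IH; set p := (2 ^+ (k + j))^-1; lra.
have key' k n : (k <= n)%N -> nrm (u n - u k) <= 2 * D / 2 ^+ k.
  move=> kn; rewrite -(subnKC kn); apply: le_trans (key _ _) _.
  by rewrite lerBlDr lerDl divr_ge0 // ?mulr_ge0 // ltW.
exists (ulim u) => k.
apply: (@ulim_nrm _ u (nrm (u 0%N) + 2 * D) _ _ k) => n; last exact: key'.
rewrite -[u n](subrK (u 0%N)); apply: le_trans (nrmD _ _) _.
by rewrite addrC lerD2l; have := key' 0%N n (leq0n _); rewrite expr0 divr1.
Qed.

Lemma goursat f A a b c : closed A -> mconv A ->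
  (forall z, A z -> cdiff f z) -> A a -> A b -> A c -> tri_null f a b c.
Proof.
move=> clA cA df Aa Ab Ac e e0; apply: (@tri_badN f e (a, b, c)) => bad.
have [D [D0 ab bc ca]] : exists D : R,
   [/\ 0 < D, nrm (b - a) <= D, nrm (c - b) <= D & nrm (a - c) <= D].
  exists (nrm (b - a) + nrm (c - b) + nrm (a - c) + 1).
  by have := nrm_ge0 (b - a); have := nrm_ge0 (c - b); have := nrm_ge0 (a - c); split; lra.
(* Badness divided by the square of the length bound survives subdivision: both lose a factor 4. *)
pose q := e / D ^+ 2.
pose good (t : C * C * C) (d : R) := [/\ (A t.1.1 /\ A t.1.2) /\ A t.2,
   nrm (t.1.2 - t.1.1) <= d, nrm (t.2 - t.1.2) <= d,
   nrm (t.1.1 - t.2) <= d & tri_bad f (q * d ^+ 2) t].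
have step (td : (C * C * C) * R) : exists t' : C * C * C, good td.1 td.2 ->
   good t' (td.2 / 2) /\ nrm (t'.1.1 - td.1.1.1) <= td.2.
  have [g|ng] := pselect (good td.1 td.2); last by exists td.1.
  have [[[A1 A2] A3] h1 h2 h3 h4] := g.
  have [t' [h1' h2' h3' h4' [h5 h6]]] := tri_bad_split cA A1 A2 A3 h1 h2 h3 h4.
  exists t' => _; split=> //; split=> //.
  by have -> : q * (td.2 / 2) ^+ 2 = q * td.2 ^+ 2 / 4 by field.
have [nxt nxtP] := choice step.
pose T := fix T k : C * C * C := if k is k'.+1 then nxt (T k', D / 2 ^+ k') else (a, b, c).
have gT k : good (T k) (D / 2 ^+ k).
  elim: k => [|k IH].
    rewrite expr0 divr1; split=> //.
    by rewrite /q divfK // expf_neq0 // gt_eqF.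
  rewrite exprSr invfM mulrA.
  by have [] := nxtP (T k, D / 2 ^+ k) IH.
have dT k : nrm ((T k.+1).1.1 - (T k).1.1) <= D / 2 ^+ k.
  by have [] := nxtP (T k, D / 2 ^+ k) (gT k).
have [z0 Hz0] := geom_limit (ltW D0) dT.
have two (k : nat) : 0 < (2 ^+ k : R) by rewrite exprn_gt0.
have small (d : R) : 0 < d -> exists k : nat, D / 2 ^+ k < d.
  move=> d0; exists (Num.truncn (D / d)).+1.
  rewrite ltr_pdivrMr // mulrC -ltr_pdivrMr //.
  apply: lt_trans (truncnS_gt _) _.
  by rewrite -natrX ltr_nat ltn_expl.
have Az0 : A z0.
  apply: closed_lim clA _ => d d0.
  have [k kd] := small (d / 2) ltac:(lra).
  exists (T k).1.1; first by have [[[]]] := gT k.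
  rewrite nrmC; apply: le_lt_trans (Hz0 k) _; lra.
have dz0 := cdiff_cder (df _ Az0).
pose l := derive1 f z0; rewrite -/l in dz0.
have q0 : 0 < q by rewrite divr_gt0 // exprn_gt0.
(* On the disc of radius [3 * D'] the remainder is at most [q / 9 * (3 * D')], so the sums over a
   triangle with sides at most [D'] are at most [3 * D' * (q / 9 * (3 * D')) = q * D' ^+ 2], against
   badness. *)
have [d d0 dP] : exists2 d : R, 0 < d & forall y, nrm (y - z0) < d ->
    nrm (f y - f z0 - l * (y - z0)) <= q / 9 * nrm (y - z0).
  by have := dz0 (q / 9) ltac:(lra) => /nbhs_nrmP.
have [k kd] := small (d / 3) ltac:(lra).
have := gT k; case: (T k) (Hz0 k) => [[x y] z] /= z0x [[[Ax Ay] Az] xy yz zx bd].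
set D' := D / 2 ^+ k in kd z0x xy yz zx bd *.
have D'0 : 0 < D' by rewrite divr_gt0.
have {}z0x : nrm (z0 - x) <= 2 * D' by rewrite /D' mulrA.
have [n _] := bd 0%N; apply/negP; rewrite -leNgt.
pose B := [set w : C | nrm (w - z0) <= 3 * D'].
have cB : mconv B by exact: mconv_ball.
have Bx : B x by rewrite /B /= nrmC; lra.
have By : B y.
  by rewrite /B /=; have := nrm_tri x y z0; rewrite (nrmC x z0); lra.
have Bz : B z.
  by rewrite /B /=; have := nrm_tri x z z0; rewrite (nrmC z x) (nrmC x z0); lra.
pose g w := f w - f z0 - l * (w - z0).
have -> : tri n f x y z = tri n g x y z.
  have <- : tri n (fun w => f w + (-1) * ((f z0 - l * z0) + l * w)) x y z = tri n g x y z.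
    by congr tri; apply/funext => w; rewrite /g; ring.
  by rewrite triD tri_affine mulr0 addr0.
have -> : q * D' ^+ 2 = 3 * D' * (q / 9 * (3 * D')) by field.
apply: (tri_le n cB Bx By Bz) => // w Bw.
apply: le_trans (dP _ _) _.
  by move: Bw; rewrite /B /=; lra.
by apply: ler_wpM2l => //; lra.
Qed.

End Goursat.

(** * Half-planes, and Goursat's theorem with an exceptional vertex *)

Section Cauchy.
Variable R : realType.
Local Notation C := (Cplx R).
Implicit Types (x y z w a b c : C) (A B : set C) (f g : C -> C).

Lemma cReD x y : complex.Re (x + y) = complex.Re x + complex.Re y.
Proof. by case: x; case: y. Qed.

Lemma cReN x : complex.Re (- x) = - complex.Re x.
Proof. by case: x. Qed.

Lemma cReMr (r : R) x : complex.Re (r%:C%C * x) = r * complex.Re x.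
Proof. by case: x => u v /=; rewrite mul0r subr0. Qed.

Lemma nrm2 z : nrm z ^+ 2 = complex.Re z ^+ 2 + complex.Im z ^+ 2.
Proof.
have := normc_def z; rewrite -[ `|_| ]/(`|z : C|) nrmE => /(@complexI R) ->.
by rewrite sqr_sqrtr // addr_ge0 // sqr_ge0.
Qed.

Definition halfplane a p (h : R) := [set z | h <= complex.Re (a * (z - p))].

Lemma mconv_halfplane a p h : mconv (halfplane a p h).
Proof.
move=> x y; rewrite /halfplane /= => hx hy.
have -> : a * ((x + y) / 2 - p) = (2^-1)%:C%C * (a * (x - p) + a * (y - p)).
  by rewrite fmorphV /= rmorph_nat; field.
by rewrite cReMr cReD; lra.
Qed.

Lemma closed_halfplane a p h : closed (halfplane a p h).
Proof.
apply: closed_nrm => z H; rewrite /halfplane /=; apply/ler_addgt0Pr => e e0.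
have a1 : 0 < nrm a + 1 by rewrite ltr_wpDl ?nrm_ge0.
have [y hy yz] := H _ (divr_gt0 e0 a1).
apply: le_trans hy _.
have -> : a * (y - p) = a * (z - p) + a * (y - z) by ring.
rewrite cReD lerD2l; apply: le_trans (Re_nrm _) _; rewrite nrmM.
move: yz; rewrite ltr_pdivlMr // => /ltW; apply: le_trans.
by rewrite mulrC ler_wpM2l ?nrm_ge0 //; lra.
Qed.

Lemma closed_nball c (r : R) : closed [set z : C | nrm (z - c) <= r].
Proof.
apply: closed_nrm => z H /=; apply/ler_addgt0Pr => e e0.
have [y /= yc yz] := H _ e0.
by have := nrm_tri y z c; rewrite (nrmC z y); lra.
Qed.

Lemma compact_bdd A f : compact A -> (forall z, A z -> {for z, continuous f}) ->
  bdd_on A f.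
Proof.
move=> /compact_near_coveringP cA cf.
have : \forall n \near \oo, A `<=` [set z | nrm (f z) <= n%:R].
  apply: (cA nat \oo (fun n z => nrm (f z) <= n%:R)) => x Ax.
  exists ([set z | nrm (f z - f x) < 1], [set n | (Num.truncn (nrm (f x) + 1) < n)%N]).
    split; last by exists (Num.truncn (nrm (f x) + 1)).+1.
    exact: (cf _ Ax _ (near_nrm (f x) ltr01)).
  move=> [z n] /= [zx xn].
  have := nrmD (f z - f x) (f x); rewrite subrK => /le_trans; apply.
  have : nrm (f x) + 1 < n%:R.
    by apply: lt_le_trans (truncnS_gt _) _; rewrite ler_nat.
  lra.
by move=> [n _ /(_ n (leqnn n)) An]; exists n%:R => z /An.
Qed.

(* Goursat with one exceptional vertex p where f is only bounded: halving towards
   p leaves triangles of vanishing perimeter. The half-plane keeps the discarded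
   triangles away from p. *)
Lemma tri_null_vertex f A p b c a (h M : R) : closed A -> mconv A ->
  A p -> A b -> A c -> 0 < h -> halfplane a p h b -> halfplane a p h c ->
  (forall z, A z -> z != p -> cdiff f z) ->
  (forall z, A z -> nrm (f z) <= M) -> tri_null f p b c.
Proof.
move=> clA cA Ap Ab Ac h0 hb hc df fM.
have [D [D0 pb bc cp]] : exists D : R,
   [/\ 0 < D, nrm (b - p) <= D, nrm (c - b) <= D & nrm (p - c) <= D].
  exists (nrm (b - p) + nrm (c - b) + nrm (p - c) + 1).
  by have := nrm_ge0 (b - p); have := nrm_ge0 (c - b); have := nrm_ge0 (p - c); split; lra.
have M0 : 0 <= M by apply: le_trans (fM _ Ap); exact: nrm_ge0.
(* After [k] halvings the triangle left at [p] accounts for the first term and the discarded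
   triangles for [e]. *)
have key k : forall e : R, 0 < e ->
   exists N : nat, forall n, (N <= n)%N -> nrm (tri n f p b c) <= 3 * D * M / 2 ^+ k + e.
  elim: k D h b c h0 D0 Ab Ac hb hc pb bc cp => [|k IH] D h b c h0 D0 Ab Ac hb hc pb bc cp e e0.
    exists 0%N => n _; rewrite expr0 divr1.
    by have := tri_le n cA Ap Ab Ac fM pb bc cp; lra.
  (* [h] is halved along with the triangle: [A'] contains the three discarded triangles and misses
     [p], so [goursat] applies to them. *)
  pose A' := A `&` halfplane a p (h / 2).
  have clA' : closed A' by apply: closedI => //; exact: closed_halfplane.
  have cA' : mconv A' by apply: mconvI => //; exact: mconv_halfplane.
  have dA' z : A' z -> cdiff f z.
    move=> [Az hz]; apply: df => //; apply/eqP => zp; move: hz.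
    by rewrite /halfplane /= zp subrr mulr0 /=; lra.
  pose m1 := (p + b) / 2; pose m2 := (b + c) / 2; pose m3 := (c + p) / 2.
  have half z : halfplane a p h z -> halfplane a p (h / 2) ((p + z) / 2).
    rewrite /halfplane /= => hz.
    have -> : a * ((p + z) / 2 - p) = (2^-1)%:C%C * (a * (z - p)).
      by rewrite fmorphV /= rmorph_nat; field.
    by rewrite cReMr; lra.
  have full z : halfplane a p h z -> halfplane a p (h / 2) z.
    by rewrite /halfplane /=; lra.
  have A'm1 : A' m1 by split; [exact: cA|exact: half].
  have A'm3 : A' m3 by rewrite /m3 addrC; split; [exact: cA|exact: half].
  have A'b : A' b by split => //; exact: full.
  have A'c : A' c by split => //; exact: full.
  have A'm2 : A' m2 by exact: cA'.
  have e40 : 0 < e / 4 by lra.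
  have [N1 H1] := goursat clA' cA' dA' A'm1 A'b A'm2 e40.
  have [N2 H2] := goursat clA' cA' dA' A'm3 A'm2 A'c e40.
  have [N3 H3] := goursat clA' cA' dA' A'm1 A'm2 A'm3 e40.
  have h20 : 0 < h / 2 by lra.
  have D20 : 0 < D / 2 by lra.
  have hf x y : nrm (x - y) <= D -> nrm ((x - y) / 2) <= D / 2.
    by move=> xy; rewrite nrmM nrm_half ler_pM2r.
  have [|||N4 H4] := IH _ _ _ _ h20 D20 A'm1.1 A'm3.1 A'm1.2 A'm3.2 _ _ _ _ e40.
  - by have -> : m1 - p = (b - p) / 2 by [rewrite /m1; field]; apply: hf.
  - by have -> : m3 - m1 = (c - b) / 2 by [rewrite /m3 /m1; field]; apply: hf.
  - by have -> : p - m3 = (p - c) / 2 by [rewrite /m3; field]; apply: hf.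
  exists (N1 + N2 + N3 + N4).+1 => -[//|n]; rewrite ltnS => Nn; rewrite triS.
  rewrite -/m1 -/m2 -/m3.
  have [/H1 {}H1 /H2 {}H2 /H3 {}H3 /H4 {}H4] := leq4 Nn.
  have := nrmD (tri n f p m1 m3) (tri n f m1 b m2).
  have := nrmD (tri n f p m1 m3 + tri n f m1 b m2) (tri n f m3 m2 c).
  have := nrmD (tri n f p m1 m3 + tri n f m1 b m2 + tri n f m3 m2 c) (tri n f m1 m2 m3).
  have -> : 3 * D * M / 2 ^+ k.+1 = 3 * (D / 2) * M / 2 ^+ k.
    by rewrite exprS; field.
  by lra.
move=> e e0.
have [k kd] : exists k : nat, 3 * D * M / 2 ^+ k < e / 2.
  exists (Num.truncn (3 * D * M / (e / 2))).+1.
  rewrite ltr_pdivrMr ?exprn_gt0 // [X in _ < X]mulrC -ltr_pdivrMr; last lra.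
  apply: lt_trans (truncnS_gt _) _.
  by rewrite -natrX ltr_nat ltn_expl.
have [N HN] := key k (e / 2) ltac:(lra).
by exists N => n /HN; lra.
Qed.

End Cauchy.

(** * Cauchy's formula on a square *)

Section Contour.
Variable R : realType.
Local Notation C := (Cplx R).
Implicit Types (x y z w a b : C) (A B : set C) (f g : C -> C).
Variables (c : C) (rho : R).
Hypothesis rho0 : 0 < rho.

#[local] Existing Instance uoo_proper.

Let iC : C := 'i%C.

Let iC2 : iC ^+ 2 = -1. Proof. exact: sqr_i. Qed.

Let iCii : iC * iC = -1. Proof. by rewrite -expr2. Qed.

Let nrm_iC : nrm iC = 1.
Proof.
apply/eqP; rewrite -(@eqrXn2 _ 2) ?nrm_ge0 ?ler01 //; apply/eqP.
by rewrite nrm2 /= expr0n add0r.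
Qed.

(** The corners, counterclockwise, of the square with centre [c] and half-side [rho]. *)
Definition cvert (k : nat) : C := c + rho%:C%C * iC ^+ k * (1 + iC).

Definition csum n f :=
  \sum_(k < 4) (cvert k.+1 - cvert k) * dsum n f (cvert k) (cvert k.+1).

Definition cint f := ulim (fun n => csum n f).

(** A convex region containing the edge from [cvert k] to [cvert k.+1]; multiplication by
    [(- iC) ^+ k.+1] turns the outer normal of that edge into the positive real direction. As only
    convexity and distances matter, the edge itself need not be described. *)
Definition side k := [set z : C | nrm (z - c) <= 2 * rho] `&`
   halfplane ((- iC) ^+ k.+1) c rho.

Definition contour := [set z | exists k, side k z].

Let mconv_side k : mconv (side k).
Proof. by apply: mconvI; [exact: mconv_ball|exact: mconv_halfplane]. Qed.

Let NiCi k : (- iC) ^+ k * iC ^+ k = 1.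
Proof. by rewrite -exprMn mulNr iCii opprK expr1n. Qed.

Let cvert_nrm k : nrm (cvert k - c) <= 2 * rho.
Proof.
rewrite /cvert addrC addKr !nrmM nrmX nrm_iC expr1n mulr1 nrmR gtr0_norm //.
rewrite mulrC ler_pM2r //; apply: le_trans (nrmD _ _) _.
by rewrite nrm_iC nrm1; lra.
Qed.

Let side_cvert k : side k (cvert k).
Proof.
split; first exact: cvert_nrm.
rewrite /halfplane /= /cvert [c + _]addrC addrK.
have -> : (- iC) ^+ k.+1 * (rho%:C%C * iC ^+ k * (1 + iC)) =
  rho%:C%C * (((- iC) ^+ k * iC ^+ k) * (- iC - iC * iC)) by rewrite exprS; ring.
by rewrite NiCi iCii mul1r cReMr /= oppr0 add0r opprK mulr1.
Qed.

Let side_cvertS k : side k (cvert k.+1).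
Proof.
split; first exact: cvert_nrm.
rewrite /halfplane /= /cvert [c + _]addrC addrK.
have -> : (- iC) ^+ k.+1 * (rho%:C%C * iC ^+ k.+1 * (1 + iC)) =
  rho%:C%C * (((- iC) ^+ k.+1 * iC ^+ k.+1) * (1 + iC)) by ring.
by rewrite NiCi mul1r cReMr /= addr0 mulr1.
Qed.

Let side_contour k : side k `<=` contour.
Proof. by move=> z zk; exists k. Qed.

Let bdd_side k f : bdd_on contour f -> bdd_on (side k) f.
Proof. by move=> [M fM]; exists M => z /side_contour /fM. Qed.

Let edge k : cvert k.+1 - cvert k = - 2 * (rho%:C%C * iC ^+ k).
Proof.
rewrite /cvert exprS.
have -> : c + rho%:C%C * (iC * iC ^+ k) * (1 + iC) - (c + rho%:C%C * iC ^+ k * (1 + iC)) =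
   (iC * iC - 1) * (rho%:C%C * iC ^+ k) by ring.
by rewrite iCii; congr (_ * _); ring.
Qed.

Let nrm_edge k : nrm (cvert k.+1 - cvert k) <= 4 * rho.
Proof.
have -> : cvert k.+1 - cvert k = (cvert k.+1 - c) - (cvert k - c) by ring.
apply: le_trans (nrmB _ _) _.
by have := cvert_nrm k; have := cvert_nrm k.+1; lra.
Qed.

(** The factor 16 is crude: four edges, each of length at most [4 * rho] because its ends are within
    [2 * rho] of [c]. *)
Lemma csum_le f (M : R) n : (forall z, contour z -> nrm (f z) <= M) ->
  nrm (csum n f) <= 16 * rho * M.
Proof.
move=> fM; have Hk k : nrm ((cvert k.+1 - cvert k) * dsum n f (cvert k) (cvert k.+1)) <= 4 * rho * M.
  rewrite nrmM; apply: ler_pM; rewrite ?nrm_ge0 //.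
  by apply: (@dsum_le _ (side k)) => // z /side_contour /fM.
rewrite /csum !big_ord_recr big_ord0 /= add0r.
set s0 := (X in X + _ + _ + _); set s1 := (X in s0 + X + _ + _).
set s2 := (X in s0 + s1 + X + _); set s3 := (X in s0 + s1 + s2 + X).
have := Hk 0%N; have := Hk 1%N; have := Hk 2%N; have := Hk 3%N.
rewrite -/s0 -/s1 -/s2 -/s3.
have := nrmD (s0 + s1 + s2) s3; have := nrmD (s0 + s1) s2; have := nrmD s0 s1.
lra.
Qed.

Lemma csumD n f g k : csum n (fun z => f z + k * g z) = csum n f + k * csum n g.
Proof.
rewrite /csum mulr_sumr -big_split; apply: eq_bigr => i _ /=.
by rewrite dsumD; ring.
Qed.

Lemma eq_csum n f g : (forall z, contour z -> f z = g z) -> csum n f = csum n g.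
Proof.
move=> fg; apply: eq_bigr => i _; congr (_ * _).
by apply: (@eq_dsum _ (side i)) => // z /side_contour /fg.
Qed.

Let cint_cvg f : bdd_on contour f -> (fun n => csum n f) @ uoo --> cint f.
Proof. by move=> [M fM]; apply: (@ulim_cvg _ _ (16 * rho * M)) => n; exact: csum_le. Qed.

Lemma cintD f g k : bdd_on contour f -> bdd_on contour g ->
  cint (fun z => f z + k * g z) = cint f + k * cint g.
Proof.
move=> bf bg; apply: ulimE; under eq_fun do rewrite csumD.
apply: cvgD; first exact: (cint_cvg bf).
by apply: cvgM; [exact: cvg_cst|exact: (cint_cvg bg)].
Qed.

Lemma cint_le f (M : R) : (forall z, contour z -> nrm (f z) <= M) ->
  nrm (cint f) <= 16 * rho * M.
Proof.
move=> fM; rewrite -[cint f]subr0.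
apply: (@ulim_nrm _ _ (16 * rho * M) _ _ 0%N) => n; first exact: csum_le.
by move=> _; rewrite subr0; exact: csum_le.
Qed.

Lemma eq_cint f g : (forall z, contour z -> f z = g z) -> cint f = cint g.
Proof. by move=> fg; rewrite /cint; under eq_fun do rewrite (eq_csum _ fg). Qed.

Lemma contour_far z : contour z -> rho <= nrm (z - c).
Proof.
move=> [k [_]]; rewrite /halfplane /= => /le_trans; apply.
apply: le_trans (Re_nrm _) _.
by rewrite nrmM nrmX nrmN nrm_iC expr1n mul1r.
Qed.

Lemma contour_near z : contour z -> nrm (z - c) <= 2 * rho.
Proof. by move=> [k [+ _]]. Qed.

Lemma contour_dist z w : contour z -> nrm (w - c) <= rho / 2 -> rho / 2 <= nrm (z - w).
Proof.
move=> /contour_far zc wc.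
by have := nrm_tri w z c; lra.
Qed.

Lemma contour_neq z w : contour z -> nrm (w - c) <= rho / 2 -> z - w != 0.
Proof. by move=> zc wc; rewrite -nrm_gt0; have := contour_dist zc wc; have := rho0; lra. Qed.

Lemma bdd_inv w : nrm (w - c) <= rho / 2 -> bdd_on contour (fun z => (z - w)^-1).
Proof.
move=> wc; exists (2 / rho) => z zc; rewrite nrmV.
have -> : 2 / rho = (rho / 2)^-1 by rewrite invf_div.
have := contour_dist zc wc => zw.
by rewrite lef_pV2 // posrE; have := rho0; lra.
Qed.

Lemma bdd_mul f g : bdd_on contour f -> bdd_on contour g ->
  bdd_on contour (fun z => f z * g z).
Proof.
move=> [M fM] [N gN]; exists (M * N) => z zc; rewrite nrmM.
by apply: ler_pM; rewrite ?nrm_ge0 ?fM ?gN.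
Qed.

Lemma bdd_cst k : bdd_on contour (fun=> k).
Proof. by exists (nrm k). Qed.

Let seg_bound n : nrm (dsum n (fun z => z^-1) (1 + iC) (iC - 1) - (- iC)) <= 3 / 4.
Proof.
pose A := [set z : C | complex.Im z = 1 /\ complex.Re z ^+ 2 <= 1].
have cA : mconv A.
  move=> [x1 x2] [y1 y2] /= [/= -> hx] [/= -> hy].
  have -> : ((x1 +i* 1)%C + (y1 +i* 1)%C) / (2 : C) = (((x1 + y1) / 2) +i* 1)%C :> C.
    have -> : (2 : C)^-1 = (2^-1 : R)%:C%C by rewrite fmorphV /= rmorph_nat.
    by apply/eqP; rewrite eq_complex /=; apply/andP; split; apply/eqP; field.
  by split=> //=; nra.
have A1 : A (1 + iC) by split=> /=; rewrite ?add0r // addr0 expr1n.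
have A2 : A (iC - 1) by split=> /=; rewrite ?subr0 // sub0r sqrrN expr1n.
have -> : dsum n (fun z => z^-1) (1 + iC) (iC - 1) - - iC =
   dsum n (fun z => z^-1 + 1 * iC) (1 + iC) (iC - 1).
  by rewrite dsumD dsum_cst; ring.
apply: (dsum_le _ cA) => // z [z1 z2].
have z0 : z != 0 by apply/eqP => zE; move: z1; rewrite zE /= => /eqP; rewrite eq_sym oner_eq0.
have -> : z^-1 + 1 * iC = (1 + iC * z) / z by field.
have -> : 1 + iC * z = iC * (complex.Re z)%:C%C.
  rewrite {1}(complexE z) z1 -[RHS]add0r mulrDr -/iC mulr1 addrCA iCii.
  by ring.
have nz : 0 < nrm z by rewrite nrm_gt0.
rewrite !nrmM nrm_iC mul1r nrmV nrmR ler_pdivrMr //.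
rewrite -(@ler_pXn2r _ 2) ?nnegrE ?mulr_ge0 ?nrm_ge0 ?normr_ge0 //.
by rewrite exprMn nrm2 z1 -normrX ger0_norm ?sqr_ge0 //; lra.
Qed.

(* The value 2 pi i is not needed, only that it is not 0: on the side Im z = 1
   one has |1/z + i| = |Re z| / |z| < 3/4, which keeps the integral within 6 of 8i. *)
Lemma cint_center : cint (fun z => (z - c)^-1) != 0.
Proof.
have H n : csum n (fun z => (z - c)^-1) = - 8 * dsum n (fun z => z^-1) (1 + iC) (iC - 1).
  (* Scaling by [rho * iC ^+ k] carries the segment from [1 + iC] to [iC - 1] onto each edge and
     cancels from [dz / (z - c)], so the four edges give the same sum. *)
  have Hk k : (cvert k.+1 - cvert k) * dsum n (fun z => (z - c)^-1) (cvert k) (cvert k.+1) =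
      -2 * dsum n (fun z => z^-1) (1 + iC) (iC - 1).
    have k0 : rho%:C%C * iC ^+ k != 0 :> C.
      by rewrite -nrm_gt0 nrmM nrmR nrmX nrm_iC expr1n mulr1 gtr0_norm.
    have -> : cvert k = rho%:C%C * iC ^+ k * (1 + iC) + c by rewrite addrC.
    have E : cvert k.+1 = rho%:C%C * iC ^+ k * (iC - 1) + c.
      rewrite /cvert exprS addrC; congr (_ + _).
      have -> : rho%:C%C * (iC * iC ^+ k) * (1 + iC) = rho%:C%C * iC ^+ k * (iC + iC * iC) by ring.
      by rewrite iCii.
    have := edge k; rewrite E [cvert k]addrC => ->.
    rewrite dsum_comp.
    have -> : (fun z => (rho%:C%C * iC ^+ k * z + c - c)^-1) =
      (fun z => 0 + (rho%:C%C * iC ^+ k)^-1 * z^-1).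
      by apply/funext => z; rewrite addrK invfM add0r.
    rewrite (dsumD (fun=> 0)) dsum_cst add0r.
    by rewrite mulrA -[_ * _ * (_)^-1]mulrA divff // mulr1.
  by rewrite /csum !big_ord_recr big_ord0 /= !Hk; ring.
have bs : bdd_on contour (fun z => (z - c)^-1).
  by apply: bdd_inv; rewrite subrr nrm0; have := rho0; lra.
have cv := cint_cvg bs.
apply/eqP => c0; rewrite c0 in cv.
have := @nrm_ub_closed R nat uoo _ _ _ (8 * iC) 6 cv.
have H' n : nrm (csum n (fun z => (z - c)^-1) - 8 * iC) <= 6.
  rewrite H; have -> : - 8 * dsum n (fun z => z^-1) (1 + iC) (iC - 1) - 8 * iC =
     - 8 * (dsum n (fun z => z^-1) (1 + iC) (iC - 1) - - iC) by ring.
  rewrite nrmM nrmN; have -> : nrm (8 : C) = 8.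
    by rewrite -(rmorph_nat (real_complex R)) nrmR ger0_norm.
  by have := seg_bound n; lra.
move=> /(_ _ (nearW _ H')).
rewrite sub0r nrmN nrmM nrm_iC mulr1.
have -> : nrm (8 : C) = 8 by rewrite -(rmorph_nat (real_complex R)) nrmR ger0_norm.
by lra.
Qed.

Let cvert4 : cvert 4 = cvert 0.
Proof. by rewrite /cvert -[4%N]/(2 * 2)%N exprM iC2 sqrrN !expr1n expr0. Qed.

(** The difference quotient [g] is bounded, and differentiable off [w]; cutting the square into four
    triangles with apex [w], [tri_null_vertex] makes its integral vanish. The integral of
    [1 / (z - w)] stays as a factor. *)
Lemma cauchy_square f w :
  (forall z, nrm (z - c) <= 2 * rho -> cdiff f z) -> nrm (w - c) <= rho / 2 ->
  cint (fun z => f z / (z - w)) = f w * cint (fun z => (z - w)^-1).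
Proof.
move=> df wc.
pose A := [set z : C | nrm (z - c) <= 2 * rho].
have cA : mconv A by exact: mconv_ball.
have clA : closed A by exact: closed_nball.
have Aw : A w by rewrite /A /=; have := rho0; lra.
have [Mf fM] : bdd_on A f.
  apply: compact_bdd; first exact: compact_nball.
  by move=> z /df /cdiff_cts.
(* At [w] division by zero gives the value 0, which need not be the derivative; only boundedness is
   asked there. *)
pose g z := (f z - f w) / (z - w).
have [M gM] : bdd_on A g.
  have /nbhs_nrmP [d d0 dP] := cdiff_cder (df _ Aw) ltr01.
  have Mf0 : 0 <= Mf by apply: le_trans (fM _ Aw); exact: nrm_ge0.
  have Md : 0 <= 2 * Mf / d by rewrite divr_ge0 // ?mulr_ge0 // ltW.
  exists (nrm (derive1 f w) + 1 + 2 * Mf / d) => z Az.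
  have [->|zw] := eqVneq z w.
    by rewrite /g subrr mul0r nrm0; have := nrm_ge0 (derive1 f w); lra.
  have zw0 : 0 < nrm (z - w) by rewrite nrm_gt0 subr_eq0.
  rewrite /g nrmM nrmV ler_pdivrMr //.
  have [zd|zd] := ltP (nrm (z - w)) d.
    have := dP z zd => h1.
    have -> : f z - f w = (f z - f w - derive1 f w * (z - w)) + derive1 f w * (z - w) by ring.
    apply: le_trans (nrmD _ _) _; rewrite nrmM.
    have : 0 <= 2 * Mf / d * nrm (z - w) by rewrite mulr_ge0 // nrm_ge0.
    by lra.
  apply: le_trans (nrmB _ _) _.
  have h1 := fM _ Az; have h2 := fM _ Aw.
  have h3 : 2 * Mf <= 2 * Mf / d * nrm (z - w).
    by rewrite mulrAC ler_pdivlMr // ler_wpM2l // mulr_ge0.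
  have : 0 <= nrm (derive1 f w) * nrm (z - w) by rewrite mulr_ge0 // nrm_ge0.
  by lra.
have Htri k : tri_null g w (cvert k) (cvert k.+1).
  (* Since [w] is within [rho / 2] of the centre, each edge keeps distance at least [rho / 2] from
     it. *)
  have hp z : side k z -> halfplane ((- iC) ^+ k.+1) w (rho / 2) z.
    move=> [_]; rewrite /halfplane /= => h1.
    have -> : (- iC) ^+ k.+1 * (z - w) = (- iC) ^+ k.+1 * (z - c) + - ((- iC) ^+ k.+1 * (w - c)) by ring.
    rewrite cReD cReN.
    have := Re_nrm ((- iC) ^+ k.+1 * (w - c)).
    by rewrite nrmM nrmX nrmN nrm_iC expr1n mul1r; lra.
  apply: (tri_null_vertex clA cA Aw (side_cvert k).1 (side_cvertS k).1 _
    (hp _ (side_cvert k)) (hp _ (side_cvertS k)) _ gM).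
  - by have := rho0; lra.
  - move=> z Az zw; have zw0 : z - w != 0 by rewrite subr_eq0.
    exact: (@cdiff_div _ (fun t => f t - f w) (fun t => t - w) z zw0 (cdiffB (df _ Az) (cdiff_cst (f w) z)) (cdiff_subc w z)).
(* The edges issuing from [w] are traversed in both directions and cancel. *)
have csumE n : csum n g = tri n g w (cvert 0) (cvert 1) + tri n g w (cvert 1) (cvert 2)
   + tri n g w (cvert 2) (cvert 3) + tri n g w (cvert 3) (cvert 4).
  rewrite /csum !big_ord_recr big_ord0 /= add0r /tri.
  rewrite !(dsum_rev g n _ w) cvert4; ring.
have bg : bdd_on contour g by exists M => z /contour_near /gM.
have cg : cint g = 0.
  apply/eqP; rewrite -nrm_eq0 eq_le nrm_ge0 andbT; apply/ler_addgt0Pr => e e0; rewrite add0r.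
  have e40 : 0 < e / 4 by lra.
  have [N1 H1] := Htri 0%N _ e40; have [N2 H2] := Htri 1%N _ e40.
  have [N3 H3] := Htri 2%N _ e40; have [N4 H4] := Htri 3%N _ e40.
  rewrite -[cint g]subr0.
  apply: (@ulim_nrm _ _ (16 * rho * M) _ _ (N1 + N2 + N3 + N4)%N) => n.
    by apply: csum_le => z /contour_near /gM.
  move=> /leq4 [/H1 {}H1 /H2 {}H2 /H3 {}H3 /H4 {}H4].
  rewrite subr0 csumE.
  set t1 := tri _ _ _ _ _ in H1 *; set t2 := tri _ _ _ _ _ in H2 *.
  set t3 := tri _ _ _ _ _ in H3 *; set t4 := tri _ _ _ _ _ in H4 *.
  have := nrmD t1 t2; have := nrmD (t1 + t2) t3; have := nrmD (t1 + t2 + t3) t4.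
  by lra.
have bf : bdd_on contour f by exists Mf => z /contour_near /fM.
have : cint g = cint (fun z => f z * (z - w)^-1 + (- f w) * (z - w)^-1).
  by apply: eq_cint => z _; rewrite /g mulrBl mulNr.
rewrite cg cintD; [|exact: bdd_mul bf (bdd_inv wc)|exact: bdd_inv].
by rewrite mulNr => /eqP; rewrite eq_sym subr_eq0 => /eqP.
Qed.

End Contour.

(** * Cauchy transforms and their derivatives *)

Section Transform.
Variable R : realType.
Local Notation C := (Cplx R).
Implicit Types (x y z w a b : C) (A B : set C) (f g : C -> C).
Variables (c : C) (rho : R).
Hypothesis rho0 : 0 < rho.
Local Notation cint := (cint c rho).
Local Notation contour := (contour c rho).

Definition ctrans f w := cint (fun z => f z / (z - w)).
Definition ctrans2 f w := cint (fun z => f z / (z - w) ^+ 2).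

Let inv_le z w : contour z -> nrm (w - c) <= rho / 2 -> nrm (z - w)^-1 <= 2 / rho.
Proof.
move=> zc wc; rewrite nrmV; have zw := contour_dist zc wc.
have -> : 2 / rho = (rho / 2)^-1 by rewrite invf_div.
by rewrite lef_pV2 // posrE; have := rho0; lra.
Qed.

Let bdd_ker f w : bdd_on contour f -> nrm (w - c) <= rho / 2 ->
  bdd_on contour (fun z => f z / (z - w)).
Proof. by move=> bf wc; apply: bdd_mul bf (bdd_inv rho0 wc). Qed.

Let bdd_ker2 f w : bdd_on contour f -> nrm (w - c) <= rho / 2 ->
  bdd_on contour (fun z => f z / (z - w) ^+ 2).
Proof.
move=> bf wc; have [M HM] := bdd_ker (bdd_ker bf wc) wc.
by exists M => z /HM; rewrite expr2 invfM mulrA.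
Qed.

(** The resolvent identity [1 / (z - w) = 1 / (z - w') + (w - w') / ((z - w) (z - w'))]. Iterating
    it gives both the derivative of the transform and its Taylor expansion. *)
Lemma ctrans_sub f w w' : bdd_on contour f ->
  nrm (w - c) <= rho / 2 -> nrm (w' - c) <= rho / 2 ->
  ctrans f w = ctrans f w' + (w - w') * ctrans (fun z => f z / (z - w')) w.
Proof.
move=> bf wc w'c; rewrite /ctrans -(cintD rho0 _ (bdd_ker bf w'c) (bdd_ker (bdd_ker bf w'c) wc)).
apply: (eq_cint rho0) => z zc.
have zw := contour_neq rho0 zc wc; have zw' := contour_neq rho0 zc w'c.
by field; rewrite zw zw'.
Qed.

Lemma cder_ctrans f w : bdd_on contour f -> nrm (w - c) < rho / 2 ->
  cder (ctrans f) w (ctrans2 f w).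
Proof.
move=> bf wc; have wc' := ltW wc; have [M fM] := bf.
(* Two uses of [ctrans_sub] leave [(y - w) ^+ 2] times an integral with three kernel factors, each
   at most [2 / rho]. *)
pose K := 16 * rho * (M * (2 / rho) ^+ 3).
suff key y : nrm (y - c) <= rho / 2 ->
   nrm (ctrans f y - ctrans f w - ctrans2 f w * (y - w)) <= nrm (y - w) ^+ 2 * K.
  move=> e e0; have K1 : 0 < `|K| + 1 by rewrite ltr_wpDl.
  have d0 : 0 < rho / 2 - nrm (w - c) by lra.
  have e1 : 0 < e / (`|K| + 1) by rewrite divr_gt0.
  apply: filterS2 (near_nrm w d0) (near_nrm w e1) => y yw1 yw2.
  have yc : nrm (y - c) <= rho / 2 by have := nrm_tri w y c; lra.
  apply: le_trans (key _ yc) _; rewrite expr2 -mulrA mulrC.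
  apply: ler_wpM2r; first exact: nrm_ge0.
  move: yw2; rewrite ltr_pdivlMr // => /ltW; apply: le_trans.
  apply: ler_wpM2l; first exact: nrm_ge0.
  by have := ler_norm K; lra.
move=> yc.
have -> : ctrans f y - ctrans f w - ctrans2 f w * (y - w) =
   (y - w) ^+ 2 * cint (fun z => f z / (z - y) / (z - w) ^+ 2).
  rewrite (ctrans_sub bf yc wc') (ctrans_sub (bdd_ker bf wc') yc wc').
  have -> : ctrans (fun z => f z / (z - w)) w = ctrans2 f w.
    by apply: (eq_cint rho0) => z _; rewrite expr2 invfM mulrA.
  have -> : ctrans (fun z => f z / (z - w) / (z - w)) y =
      cint (fun z => f z / (z - y) / (z - w) ^+ 2).
    by apply: (eq_cint rho0) => z _; rewrite expr2 invfM; ring.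
  by ring.
rewrite nrmM nrmX; apply: ler_wpM2l; first by rewrite exprn_ge0 // nrm_ge0.
apply: (cint_le rho0) => z zc.
have h1 := inv_le zc yc; have h2 := inv_le zc wc'; have h3 := fM _ zc.
rewrite !nrmM -exprVn nrmX.
have -> : M * (2 / rho) ^+ 3 = M * (2 / rho) * (2 / rho) ^+ 2 by ring.
apply: ler_pM; rewrite ?mulr_ge0 ?exprn_ge0 ?nrm_ge0 //.
  by apply: ler_pM; rewrite ?nrm_ge0.
by apply: lerXn2r => //; rewrite nnegrE ?nrm_ge0 ?divr_ge0 // ltW.
Qed.

(* A second derivative of the transform: this makes derivatives of holomorphic
   functions holomorphic again. *)
Lemma cder_ctrans2 f w : bdd_on contour f -> nrm (w - c) < rho / 2 ->
  cder (ctrans2 f) w (2 * cint (fun z => f z / (z - w) ^+ 3)).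
Proof.
move=> bf wc; have wc' := ltW wc; have [M fM] := bf.
have bk y : nrm (y - c) <= rho / 2 -> bdd_on contour (fun z => (z - y)^-1).
  exact: bdd_inv.
pose K := 16 * rho * (M * (14 * rho * (2 / rho) ^+ 5)).
suff key y : nrm (y - c) <= rho / 2 ->
   nrm (ctrans2 f y - ctrans2 f w - 2 * cint (fun z => f z / (z - w) ^+ 3) * (y - w))
   <= nrm (y - w) ^+ 2 * K.
  move=> e e0; have K1 : 0 < `|K| + 1 by rewrite ltr_wpDl.
  have d0 : 0 < rho / 2 - nrm (w - c) by lra.
  have e1 : 0 < e / (`|K| + 1) by rewrite divr_gt0.
  apply: filterS2 (near_nrm w d0) (near_nrm w e1) => y yw1 yw2.
  have yc : nrm (y - c) <= rho / 2 by have := nrm_tri w y c; lra.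
  apply: le_trans (key _ yc) _; rewrite expr2 -mulrA mulrC.
  apply: ler_wpM2r; first exact: nrm_ge0.
  move: yw2; rewrite ltr_pdivlMr // => /ltW; apply: le_trans.
  apply: ler_wpM2l; first exact: nrm_ge0.
  by have := ler_norm K; lra.
move=> yc.
(* With [a = z - w] and [b = y - w], one has [1 / (a - b)^2 - 1 / a^2 - 2 b / a^3 = b^2 (3 a - 2 b)
   / ((a - b)^2 a^3)], where [3 a - 2 b] is at most [14 * rho]. *)
pose ker z := f z * ((3 * (z - w) - 2 * (y - w)) * ((z - y)^-1 ^+ 2 * (z - w)^-1 ^+ 3)).
have bX n y' : nrm (y' - c) <= rho / 2 -> bdd_on contour (fun z => (z - y')^-1 ^+ n).
  move=> y'c; elim: n => [|n [N HN]]; first exact: bdd_cst.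
  have [N' HN'] := bdd_mul (bk _ y'c) (ex_intro _ N HN).
  by exists N' => z /HN'; rewrite exprS.
have bz a : bdd_on contour (fun z => 3 * (z - w) + a).
  exists (9 * rho + nrm a) => z zc.
  apply: le_trans (nrmD _ _) _; rewrite lerD2r nrmM.
  have -> : nrm (3 : C) = 3 by rewrite -(rmorph_nat (real_complex R)) nrmR ger0_norm.
  have := contour_near zc; have := nrm_tri c z w; rewrite (nrmC c w); have := rho0; lra.
have bker : bdd_on contour ker.
  by apply: bdd_mul bf _; apply: bdd_mul (bz _) _; apply: bdd_mul (bX _ _ _) (bX _ _ _).
have -> : ctrans2 f y - ctrans2 f w - 2 * cint (fun z => f z / (z - w) ^+ 3) * (y - w) =
   (y - w) ^+ 2 * cint ker.
  have b3 : bdd_on contour (fun z => f z / (z - w) ^+ 3).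
    have [N HN] := bdd_mul bf (bX 3%N w wc').
    by exists N => z /HN; rewrite exprVn.
  have E : ctrans2 f y = cint (fun z => (f z / (z - w) ^+ 2 +
      (2 * (y - w)) * (f z / (z - w) ^+ 3)) + (y - w) ^+ 2 * ker z).
    apply: (eq_cint rho0) => z zc; rewrite /ker.
    have zw := contour_neq rho0 zc wc'; have zy := contour_neq rho0 zc yc.
    by field; rewrite zw zy.
  rewrite E (cintD rho0 _ _ bker); last first.
    have [N1 HN1] := bdd_ker2 bf wc'; have [N2 HN2] := bdd_mul (bdd_cst c rho (2 * (y - w))) b3.
    exists (N1 + N2) => z zc; apply: le_trans (nrmD _ _) _.
    by apply: lerD; [exact: HN1|exact: HN2].
  rewrite (cintD rho0 _ (bdd_ker2 bf wc') b3) -/(ctrans2 f w); ring.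
rewrite nrmM nrmX; apply: ler_wpM2l; first by rewrite exprn_ge0 // nrm_ge0.
apply: (cint_le rho0) => z zc.
have h1 := inv_le zc yc; have h2 := inv_le zc wc'; have h3 := fM _ zc.
have r0 : 0 <= 2 / rho by rewrite divr_ge0 // ltW.
rewrite /ker nrmM; apply: ler_pM => //; rewrite ?nrm_ge0 //.
have -> : 14 * rho * (2 / rho) ^+ 5 = 14 * rho * ((2 / rho) ^+ 2 * (2 / rho) ^+ 3) by ring.
rewrite nrmM; apply: ler_pM => //; rewrite ?nrm_ge0 //.
  apply: le_trans (nrmB _ _) _; rewrite !nrmM.
  have nk (k : nat) : nrm (k%:R : C) = k%:R.
    by rewrite -(rmorph_nat (real_complex R)) nrmR ger0_norm.
  rewrite !nk.
  have := contour_near zc; have := nrm_tri c z w; have := nrm_tri c y w.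
  rewrite (nrmC c w); have := rho0; lra.
rewrite nrmM !nrmX; apply: ler_pM; rewrite ?exprn_ge0 ?nrm_ge0 //.
  by apply: lerXn2r => //; rewrite nnegrE ?nrm_ge0.
by apply: lerXn2r => //; rewrite nnegrE ?nrm_ge0.
Qed.

End Transform.

(** * Orders of vanishing *)

Section Holomorphic.
Variable R : realType.
Local Notation C := (Cplx R).
Implicit Types (x y z w a b c : C) (A B : set C) (f g h : C -> C).

Definition hol f c := \forall z \near c, cdiff f z.

Lemma nbhs_near (T : topologicalType) (p : T) (A : set T) :
  nbhs p A -> \forall q \near p, nbhs q A.
Proof. exact: nbhs_interior. Qed.

Lemma hol_cdiff f c : hol f c -> cdiff f c.
Proof. exact: nbhs_singleton. Qed.

Lemma hol_near f c : hol f c -> \forall z \near c, hol f z.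
Proof. exact: nbhs_near. Qed.

Lemma hol_cts f c : hol f c -> {for c, continuous f}.
Proof. by move=> /hol_cdiff /cdiff_cts. Qed.

Lemma eq_hol f g c : (\forall z \near c, f z = g z) -> hol f c -> hol g c.
Proof.
move=> /nbhs_near fg hf; apply: filterS2 fg hf => z {}fg.
exact: eq_cdiff.
Qed.

Lemma holD f g c : hol f c -> hol g c -> hol (fun z => f z + g z) c.
Proof. by move=> hf hg; apply: filterS2 hf hg => z; exact: cdiffD. Qed.

Lemma holB f g c : hol f c -> hol g c -> hol (fun z => f z - g z) c.
Proof. by move=> hf hg; apply: filterS2 hf hg => z; exact: cdiffB. Qed.

Lemma holM f g c : hol f c -> hol g c -> hol (fun z => f z * g z) c.
Proof. by move=> hf hg; apply: filterS2 hf hg => z; exact: cdiffM. Qed.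

Lemma cts_neq0 (T : topologicalType) (f : T -> C) p :
  {for p, continuous f} -> f p != 0 -> \forall q \near p, f q != 0.
Proof.
move=> cf fp0; have f0 : 0 < nrm (f p) by rewrite nrm_gt0.
have H : \forall q \near p, nrm (f q - f p) < nrm (f p) by exact: (cf _ (near_nrm (f p) f0)).
apply: filterS H => q /= fq.
by apply/eqP => q0; move: fq; rewrite q0 sub0r nrmN ltxx.
Qed.

Lemma holV f c : hol f c -> f c != 0 -> hol (fun z => (f z)^-1) c.
Proof.
move=> hf fc; have H := cts_neq0 (hol_cts hf) fc.
apply: filterS2 hf H => z df fz.
exact: cdiffV.
Qed.

Lemma hol_div f g c : hol f c -> hol g c -> g c != 0 ->
  hol (fun z => f z / g z) c.
Proof. by move=> hf hg gc; apply: (holM hf); exact: holV. Qed.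

Lemma hol_cst k c : hol (fun=> k) c.
Proof. by apply: filterS (near_nrm c ltr01) => z _; exact: cdiff_cst. Qed.

Lemma hol_id c : hol (fun z => z) c.
Proof. by apply: filterS (near_nrm c ltr01) => z _; exact: cdiff_id. Qed.

Lemma hol_subc a c : hol (fun z => z - a) c.
Proof. exact: holB (hol_id c) (hol_cst a c). Qed.

Lemma holX f n c : hol f c -> hol (fun z => f z ^+ n) c.
Proof. by move=> hf; apply: filterS hf => z; exact: cdiffX. Qed.

Lemma hol_comp f g c : hol f c -> hol g (f c) -> hol (fun z => g (f z)) c.
Proof.
move=> hf hg.
have H : \forall z \near c, cdiff g (f z) by exact: (hol_cts hf hg).
apply: filterS2 hf H => z df dg.
exact: cdiff_comp.
Qed.

(** The integral of [1 / (z - w)] is not shown to be independent of [w]. It is nonzero at [c], hence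
    near [c] by continuity, so [f] is a quotient of two Cauchy transforms there; all regularity of
    [f] is drawn from this. *)
Lemma hol_cauchy f c (r0 : R) : hol f c -> 0 < r0 ->
  exists2 rho : R, 0 < rho < r0 & [/\ forall z, nrm (z - c) <= 2 * rho -> cdiff f z,
    bdd_on (contour c rho) f &
    exists2 r : R, 0 < r < rho / 2 & forall w, nrm (w - c) < r ->
      ctrans c rho (fun=> 1) w != 0 /\
      f w = ctrans c rho f w / ctrans c rho (fun=> 1) w].
Proof.
move=> /nbhs_nrmP [e e0 eP] r00.
pose rho := Num.min (e / 3) (r0 / 2).
have rho0 : 0 < rho by rewrite lt_min; apply/andP; split; lra.
have rhoe : rho <= e / 3 by rewrite ge_min lexx.
have rhor : rho <= r0 / 2 by rewrite ge_min lexx orbT.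
exists rho; first by rewrite rho0 /=; lra.
have df z : nrm (z - c) <= 2 * rho -> cdiff f z by move=> zc; apply: eP; lra.
have bf : bdd_on (contour c rho) f.
  have [M HM] : bdd_on [set z : C | nrm (z - c) <= 2 * rho] f.
    by apply: compact_bdd; [exact: compact_nball|move=> z /df /cdiff_cts].
  by exists M => z /contour_near /HM.
split=> //.
have b1 : bdd_on (contour c rho) (fun=> 1) by exact: bdd_cst.
have cc : nrm (c - c) < rho / 2 by rewrite subrr nrm0; lra.
have I0 : ctrans c rho (fun=> 1) c != 0.
  have -> : ctrans c rho (fun=> 1) c = cint c rho (fun z => (z - c)^-1).
    by apply: (eq_cint rho0) => z _; rewrite mul1r.
  exact: cint_center.
have /cdiff_cts /cts_neq0 := cder_cdiff (cder_ctrans rho0 b1 cc).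
move=> /(_ I0) /nbhs_nrmP [d d0 dP].
exists (Num.min d (rho / 4)); first by rewrite lt_min d0 gt_min /=; apply/andP; split; lra.
move=> w; rewrite lt_min => /andP [wd wr].
have Iw := dP _ wd; split=> //.
apply: (canRL (mulfK Iw)).
have wc : nrm (w - c) <= rho / 2 by lra.
rewrite {2}/ctrans (cauchy_square rho0 df wc); congr (_ * _).
by apply: (eq_cint rho0) => z _; rewrite mul1r.
Qed.

(** Differentiating [f * I = T] gives [derive1 f = (T2 - f * I2) / I], and every term on the right
    is differentiable. *)
Lemma hol_derive1 f c : hol f c -> hol (derive1 f) c.
Proof.
move=> hf; have [rho /andP [rho0 _] [df bf [r /andP [r0 rr] fE]]] := hol_cauchy hf ltr01.
have b1 : bdd_on (contour c rho) (fun=> 1) by exact: bdd_cst.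
pose I := ctrans c rho (fun=> 1); pose T := ctrans c rho f.
pose I2 := ctrans2 c rho (fun=> 1); pose T2 := ctrans2 c rho f.
have dI w : nrm (w - c) < r -> cder I w (I2 w).
  by move=> wc; apply: cder_ctrans => //; lra.
have dT w : nrm (w - c) < r -> cder T w (T2 w).
  by move=> wc; apply: cder_ctrans => //; lra.
have dI2 w : nrm (w - c) < r -> cdiff I2 w.
  by move=> wc; apply: cder_cdiff; apply: cder_ctrans2 => //; lra.
have dT2 w : nrm (w - c) < r -> cdiff T2 w.
  by move=> wc; apply: cder_cdiff; apply: cder_ctrans2 => //; lra.
have E w : nrm (w - c) < r -> derive1 f w = (T2 w - f w * I2 w) / I w.
  move=> wc; have [Iw _] := fE w wc; apply: (canRL (mulfK Iw)).
  have dfw : cdiff f w by apply: df; lra.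
  have dIw := cder_cdiff (dI _ wc).
  have H : derive1 (fun z => f z * I z) w = T2 w.
    rewrite -(cder_derive1 (dT _ wc)); apply: eq_derive1.
    have d0 : 0 < r - nrm (w - c) by lra.
    apply: filterS (near_nrm w d0) => z zw.
    have zc : nrm (z - c) < r by have := nrm_tri w z c; lra.
    have [Iz ->] := fE z zc.
    by rewrite divfK.
  by rewrite -H derive1M // (cder_derive1 (dI _ wc)) addrK.
apply: (@eq_hol (fun w => (T2 w - f w * I2 w) / I w)).
  by apply: filterS (near_nrm c r0) => w /E.
apply: filterS (near_nrm c r0) => w wc.
have [Iw _] := fE w wc.
have dfw : cdiff f w by apply: df; lra.
exact: (@cdiff_div _ (fun w => T2 w - f w * I2 w) I w Iw
  (cdiffB (dT2 _ wc) (cdiffM dfw (dI2 _ wc))) (cder_cdiff (dI _ wc))).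
Qed.

Definition zord f c m :=
  exists2 g, hol g c /\ g c != 0 & \forall z \near c, f z = (z - c) ^+ m * g z.

(** The Taylor coefficients of [f * I] at [c] are the numbers [D m c]. The first nonzero one gives
    the order; if there is none, the remainder bound forces [f] to vanish near [c]. *)
Lemma hol_dich f c : hol f c ->
  (\forall z \near c, f z = 0) \/ exists m, zord f c m.
Proof.
move=> hf; have [rho /andP [rho0 _] [df bf [r /andP [r0 rr] fE]]] := hol_cauchy hf ltr01.
have b1 : bdd_on (contour c rho) (fun=> 1) by exact: bdd_cst.
pose I := ctrans c rho (fun=> 1).
pose fm m z := f z / (z - c) ^+ m.
have cc : nrm (c - c) <= rho / 2 by rewrite subrr nrm0; lra.
have [M fM] := bf.
have M1 : 0 <= `|M| + 1 by rewrite addr_ge0.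
have bm m z : contour c rho z -> nrm (fm m z) <= (`|M| + 1) / rho ^+ m.
  move=> zc; rewrite nrmM nrmV nrmX; apply: ler_pM; rewrite ?nrm_ge0 ?invr_ge0 ?exprn_ge0 ?nrm_ge0 //.
    by apply: le_trans (fM _ zc) _; have := ler_norm M; lra.
  have zr := contour_far zc.
  rewrite lef_pV2 ?posrE ?exprn_gt0 //; last lra.
  by apply: lerXn2r; rewrite ?nnegrE ?nrm_ge0 // ltW.
have bfm m : bdd_on (contour c rho) (fm m) by exists ((`|M| + 1) / rho ^+ m) => z /bm.
pose D m w := ctrans c rho (fm m) w.
have DS m w : nrm (w - c) <= rho / 2 -> D m w = D m c + (w - c) * D m.+1 w.
  move=> wc; rewrite /D (ctrans_sub rho0 (bfm m) wc cc); congr (_ + _ * _).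
  by apply: (eq_cint rho0) => z _; rewrite /fm exprSr invfM mulrA.
have fD m : (forall j, (j < m)%N -> D j c = 0) -> forall w, nrm (w - c) < r ->
    f w * I w = (w - c) ^+ m * D m w.
  elim: m => [_|m IH Dj] w wc.
    have [Iw {1}->] := fE w wc; rewrite divfK // expr0 mul1r.
    by apply: (eq_cint rho0) => z _; rewrite /fm expr0 divr1.
  rewrite (IH _ w wc); last by move=> j jm; apply: Dj; rewrite ltnW.
  rewrite DS; last lra.
  by rewrite Dj // add0r mulrA exprSr.
have [[m0 Dm0]|allD] := pselect (exists m, D m c != 0).
  right; have ex : exists m, D m c != 0 by exists m0.
  have [m Dm minm] := ex_minnP ex.
  exists m; exists (fun w => D m w / I w); last first.
    apply: filterS (near_nrm c r0) => w wc; have [Iw _] := fE w wc.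
    rewrite mulrA -fD ?mulfK // => j jm.
    by apply/eqP; apply: contraTT jm => /minm; rewrite -leqNgt.
  split; last first.
    have [Ic _] := fE c ltac:(by rewrite subrr nrm0).
    by rewrite mulf_neq0 ?invr_neq0.
  apply: filterS (near_nrm c r0) => w wc; have [Iw _] := fE w wc.
  have wc' : nrm (w - c) < rho / 2 by lra.
  exact: (@cdiff_div _ (D m) I w Iw (cder_cdiff (cder_ctrans rho0 (bfm m) wc'))
     (cder_cdiff (cder_ctrans rho0 b1 wc'))).
left; apply: filterS (near_nrm c r0) => w wc.
have [Iw _] := fE w wc.
have D0 m : D m c = 0 by apply: contrapT => /eqP Dm; apply: allD; exists m.
(* The contour stays at distance [rho] from [c] and [w] within [rho / 2], so each degree gains a
   factor 2. *)
pose K := 16 * rho * ((`|M| + 1) * (2 / rho)).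
have bnd m : nrm (f w * I w) <= K / 2 ^+ m.
  rewrite (fD m) // nrmM nrmX.
  have DK : nrm (D m w) <= 16 * rho * ((`|M| + 1) / rho ^+ m * (2 / rho)).
    apply: (cint_le rho0) => z zc; rewrite nrmM nrmV.
    apply: ler_pM; rewrite ?invr_ge0 ?nrm_ge0 ?bm //.
    have wc' : nrm (w - c) <= rho / 2 by lra.
    have zw := contour_dist zc wc'.
    have -> : 2 / rho = (rho / 2)^-1 by rewrite invf_div.
    by rewrite lef_pV2 ?posrE; lra.
  have wr : nrm (w - c) ^+ m <= (rho / 2) ^+ m.
    by apply: lerXn2r; rewrite ?nnegrE ?nrm_ge0 //; lra.
  have := ler_pM (exprn_ge0 m (nrm_ge0 (w - c))) (nrm_ge0 _) wr DK.
  have -> // : (rho / 2) ^+ m * (16 * rho * ((`|M| + 1) / rho ^+ m * (2 / rho))) = K / 2 ^+ m.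
  rewrite /K expr_div_n; field.
  by rewrite !expf_neq0 ?gt_eqF.
have : nrm (f w * I w) = 0.
  apply/eqP; rewrite eq_le nrm_ge0 andbT leNgt; apply/negP => n0.
  have := bnd (Num.truncn (K / nrm (f w * I w))).+1.
  rewrite ler_pdivlMr ?exprn_gt0 // mulrC -ler_pdivlMr // leNgt.
  apply/negP; rewrite negbK; apply: lt_trans (truncnS_gt _) _.
  by rewrite -natrX ltr_nat ltn_expl.
by move=> /eqP; rewrite nrm_eq0 mulf_eq0 (negPf Iw) orbF => /eqP.
Qed.

End Holomorphic.

(** * Orders of meromorphic functions of one variable *)

Section Order.
Variable R : realType.
Local Notation C := (Cplx R).
Implicit Types (x y z w a b c : C) (A B : set C) (f g h : C -> C) (k l : int).

Lemma cts_pnear0 f c : {for c, continuous f} -> (\forall z \near c^', f z = 0) -> f c = 0.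
Proof.
move=> cf f0; apply: contrapT => /eqP fc; have fc' := cts_neq0 cf fc.
have /nbhs_nrmP [e e0 eP] : nbhs c [set z | z != c -> f z = 0 /\ f z != 0].
  have f0' : \forall z \near c, z != c -> f z = 0 by exact: f0.
  by apply: filterS2 f0' fc' => z h1 h2 zc; split=> //; exact: h1.
have e2 : 0 < e / 2 by lra.
pose z := c + (e / 2)%:C%C.
have zc : nrm (z - c) = e / 2 by rewrite /z addrC addKr nrmR gtr0_norm.
have [||->] := eP z; rewrite ?eqxx // ?zc; first lra.
by apply/eqP => zE; move: zc; rewrite zE subrr nrm0 => E; move: e2; rewrite -E ltxx.
Qed.

(* Order at least k, resp. exactly k, at c; the value f c itself is irrelevant. *)
Definition mge f c k :=
  exists2 g, hol g c & \forall z \near c^', f z = (z - c) ^ k * g z.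

Definition mord f c k :=
  exists2 g, hol g c /\ g c != 0 & \forall z \near c^', f z = (z - c) ^ k * g z.

Lemma pnear_near c A : nbhs c A -> \forall z \near c^', A z.
Proof. by apply: filterS. Qed.

Lemma pnear_neq c : \forall z \near c^', z - c != 0.
Proof.
by apply: filterS (near_nrm c ltr01) => z _ zc; rewrite subr_eq0.
Qed.

Lemma mord_mge f c k : mord f c k -> mge f c k.
Proof. by move=> [g [hg _] fg]; exists g. Qed.

Lemma hol_exprz c k z : z != c -> hol (fun z => (z - c) ^ k) z.
Proof.
move=> zc; case: k => n; first exact: (holX n (hol_subc c z)).
have H := holX n.+1 (hol_subc c z).
have E : (z - c) ^+ n.+1 != 0 by rewrite expf_neq0 // subr_eq0.
exact: holV H E.
Qed.

Lemma mge_le f c k l : l <= k -> mge f c k -> mge f c l.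
Proof.
move=> lk [g hg fg]; have : 0 <= k - l by rewrite subr_ge0.
case E : (k - l) => [n|//] _.
exists (fun z => (z - c) ^+ n * g z); first exact: holM (holX n (hol_subc c c)) hg.
apply: filterS2 fg (pnear_neq c) => z -> zc.
rewrite mulrA -[(z - c) ^+ n]/((z - c) ^ n%:Z) -expfzDr //.
by congr (_ ^ _ * _); rewrite -E addrC subrK.
Qed.

Lemma hol_mge f c : hol f c -> mge f c 0.
Proof. by move=> hf; exists f => //; apply: filterS (pnear_neq c) => z _; rewrite expr0z mul1r. Qed.

Lemma hol_mord f c : hol f c -> f c != 0 -> mord f c 0.
Proof. by move=> hf fc; exists f => //; apply: filterS (pnear_neq c) => z _; rewrite expr0z mul1r. Qed.

Lemma eq_mge f g c k : (\forall z \near c^', f z = g z) -> mge f c k -> mge g c k.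
Proof. by move=> fg [h hh fh]; exists h => //; apply: filterS2 fg fh => z -> . Qed.

Lemma eq_mord f g c k : (\forall z \near c^', f z = g z) -> mord f c k -> mord g c k.
Proof. by move=> fg [h hh fh]; exists h => //; apply: filterS2 fg fh => z -> . Qed.

Lemma mgeD f g c k : mge f c k -> mge g c k -> mge (fun z => f z + g z) c k.
Proof.
move=> [f1 h1 e1] [g1 h2 e2]; exists (fun z => f1 z + g1 z); first exact: holD.
by apply: filterS2 e1 e2 => z -> ->; rewrite mulrDr.
Qed.

Lemma mgeM f g c k l : mge f c k -> mge g c l -> mge (fun z => f z * g z) c (k + l).
Proof.
move=> [f1 h1 e1] [g1 h2 e2]; exists (fun z => f1 z * g1 z); first exact: holM.
apply: filterS3 e1 e2 (pnear_neq c) => z -> -> zc.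
by rewrite expfzDr // mulrACA.
Qed.

Lemma mordM f g c k l : mord f c k -> mord g c l -> mord (fun z => f z * g z) c (k + l).
Proof.
move=> [f1 [h1 n1] e1] [g1 [h2 n2] e2]; exists (fun z => f1 z * g1 z).
  by split; [exact: holM|rewrite mulf_neq0].
apply: filterS3 e1 e2 (pnear_neq c) => z -> -> zc.
by rewrite expfzDr // mulrACA.
Qed.

Lemma mordV f c k : mord f c k -> mord (fun z => (f z)^-1) c (- k).
Proof.
move=> [f1 [h1 n1] e1]; exists (fun z => (f1 z)^-1).
  by split; [exact: holV|rewrite invr_eq0].
by apply: filterS e1 => z ->; rewrite invfM expfV exprz_inv.
Qed.

Lemma mge_dich f c k : mge f c k ->
  (\forall z \near c^', f z = 0) \/ exists2 l, k <= l & mord f c l.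
Proof.
move=> [g hg fg]; have [g0|[m [h hh gh]]] := hol_dich hg.
  left; apply: filterS2 fg (pnear_near g0) => z -> ->; exact: mulr0.
right; exists (k + m%:Z); first by rewrite lerDl.
exists h => //; apply: filterS3 fg (pnear_near gh) (pnear_neq c) => z -> -> zc.
by rewrite mulrA expfzDr.
Qed.

Lemma mord_mge_le f c k l : mord f c k -> mge f c l -> l <= k.
Proof.
move=> [g [hg gc] fg] [h hh fh]; rewrite leNgt; apply/negP => kl.
have : 0 < l - k by rewrite subr_gt0.
case E : (l - k) => [[|n]|//] // _.
have H : g c - (c - c) ^+ n.+1 * h c = 0.
  apply: (@cts_pnear0 (fun z => g z - (z - c) ^+ n.+1 * h z)).
    apply: hol_cts; apply: holB hg _; exact: holM (holX n.+1 (hol_subc c c)) hh.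
  apply: filterS3 fg fh (pnear_neq c) => z fz + zc; rewrite fz => e2.
  have zk : (z - c) ^ k != 0 by rewrite expfz_neq0.
  apply: (mulfI zk); rewrite mulrBr e2 mulr0 mulrA.
  rewrite -[(z - c) ^+ n.+1]/((z - c) ^ n.+1%:Z) -E -expfzDr //.
  by have -> : k + (l - k) = l by [rewrite addrC subrK]; rewrite subrr.
by move: H gc; rewrite subrr expr0n mul0r subr0 => ->; rewrite eqxx.
Qed.

Lemma mord_uniq f c k l : mord f c k -> mord f c l -> k = l.
Proof.
move=> h1 h2; apply/eqP; rewrite eq_le.
by rewrite (mord_mge_le h1 (mord_mge h2)) (mord_mge_le h2 (mord_mge h1)).
Qed.

Lemma mord_neq0 f c k : mord f c k -> \forall z \near c^', f z != 0.
Proof.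
move=> [g [hg gc] fg].
apply: filterS3 fg (pnear_near (cts_neq0 (hol_cts hg) gc)) (pnear_neq c) => z -> gz zc.
by rewrite mulf_neq0 // expfz_neq0.
Qed.

Lemma mge_hol_near f c k : mge f c k -> \forall z \near c^', hol f z.
Proof.
move=> [g hg fg].
have H : \forall z \near c, \forall y \near z, y != c -> f y = (y - c) ^ k * g y.
  exact: (nbhs_near fg).
apply: filterS3 (pnear_near H) (pnear_near (hol_near hg)) (pnear_neq c) => z fz gz zc.
have zc' : z != c by rewrite -subr_eq0.
apply: eq_hol (holM (hol_exprz k zc') gz).
have nc : \forall y \near z, y - c != 0 := cts_neq0 (hol_cts (hol_subc c z)) zc.
by apply: filterS2 fz nc => y fy yc; rewrite fy // -subr_eq0.
Qed.

Lemma mord_near f c k : mord f c k -> \forall z \near c^', mord f z 0.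
Proof.
move=> fk; apply: filterS2 (mge_hol_near (mord_mge fk)) (mord_neq0 fk) => z.
exact: hol_mord.
Qed.

(** [v] is the value at [c] of the continued function, which may differ from [f c]. *)
Lemma mge_val f c : mge f c 0 -> exists2 v, mge (fun z => f z - v) c 1 &
  forall w, mge (fun z => f z - w) c 1 -> w = v.
Proof.
move=> [g hg fg]; exists (g c).
  have : hol (fun z => g z - g c) c by exact: holB hg (hol_cst _ _).
  move=> /hol_dich [g0|[[|m] [h [hh hc] gh]]].
  - exists (fun=> 0); first exact: hol_cst.
    apply: filterS2 fg (pnear_near g0) => z ->.
    by rewrite expr0z mul1r mulr0 => ->.
  - have := nbhs_singleton gh; rewrite subrr expr0 mul1r => /esym h0.
    by rewrite h0 eqxx in hc.
  - exists (fun z => (z - c) ^+ m * h z); first exact: holM (holX m (hol_subc c c)) hh.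
    apply: filterS2 fg (pnear_near gh) => z ->.
    by rewrite expr0z mul1r => ->; rewrite exprS mulrA.
move=> w [h hh fh]; apply/esym/eqP; rewrite -subr_eq0.
have H : g c - w - (c - c) * h c = 0.
  apply: (@cts_pnear0 (fun z => g z - w - (z - c) * h z)).
    apply: hol_cts; apply: holB; first exact: holB hg (hol_cst _ _).
    exact: holM (hol_subc c c) hh.
  by apply: filterS2 fg fh => z; rewrite expr0z mul1r expr1z => -> ->; rewrite subrr.
by move: H; rewrite subrr mul0r subr0 => ->.
Qed.

(** [h z - h c] is [z - c] times a unit [u], so a power of it contributes the same exponent; this
    makes orders independent of the chart. *)
Lemma mge_comp f h c k : mge f (h c) k -> hol h c ->
  mord (fun z => h z - h c) c 1 -> mge (fun z => f (h z)) c k.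
Proof.
move=> [g hg fg] hh [u [hu uc] hE].
have hcts : \forall z \near c, h z != h c -> f (h z) = (h z - h c) ^ k * g (h z).
  exact: (hol_cts hh fg).
have u0 := cts_neq0 (hol_cts hu) uc.
exists (fun z => u z ^ k * g (h z)).
  apply: holM; last exact: hol_comp hh hg.
  have K : hol (fun y => (y - 0) ^ k) (u c) by exact: hol_exprz.
  by apply: eq_hol (hol_comp hu K); apply: filterS u0 => z _; rewrite subr0.
have N : \forall z \near c^', u z != 0 /\ z - c != 0.
  by apply: filterS2 (pnear_near u0) (pnear_neq c).
apply: filterS3 (pnear_near hcts) hE N => z hz hzE [uz zc].
rewrite expr1z in hzE.
rewrite hz; last by rewrite -subr_eq0 hzE mulf_neq0.
by rewrite hzE expfzMl mulrA.
Qed.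

Lemma mord_comp f h c k : mord f (h c) k -> hol h c ->
  mord (fun z => h z - h c) c 1 -> mord (fun z => f (h z)) c k.
Proof.
move=> [g [hg gc] fg] hh [u [hu uc] hE].
have hcts : \forall z \near c, h z != h c -> f (h z) = (h z - h c) ^ k * g (h z).
  exact: (hol_cts hh fg).
have u0 := cts_neq0 (hol_cts hu) uc.
exists (fun z => u z ^ k * g (h z)).
  split; last by rewrite mulf_neq0 // expfz_neq0.
  apply: holM; last exact: hol_comp hh hg.
  have K : hol (fun y => (y - 0) ^ k) (u c) by exact: hol_exprz.
  by apply: eq_hol (hol_comp hu K); apply: filterS u0 => z _; rewrite subr0.
have N : \forall z \near c^', u z != 0 /\ z - c != 0.
  by apply: filterS2 (pnear_near u0) (pnear_neq c).
apply: filterS3 (pnear_near hcts) hE N => z hz hzE [uz zc].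
rewrite expr1z in hzE.
rewrite hz; last by rewrite -subr_eq0 hzE mulf_neq0.
by rewrite hzE expfzMl mulrA.
Qed.

Lemma cder_conj f c (l : C) : cder f c l ->
  cder (fun z => (f z^*)^* : C) (c^* : C) (l^* : C).
Proof.
move=> fl e e0; have /nbhs_nrmP [d d0 dP] := fl _ e0.
apply/nbhs_nrmP; exists d => // y yc.
have yc' : nrm (y^* - c) = nrm (y - c^*) by rewrite -nrm_conj rmorphB /= conjCK.
have := dP (y^* : C); rewrite yc' => /(_ yc); apply: le_trans.
by rewrite -[X in X <= _]nrm_conj !rmorphB /= rmorphM /= rmorphB /= !conjCK.
Qed.

Lemma hol_conj f c : hol f c -> hol (fun z => (f z^*)^* : C) (c^* : C).
Proof.
move=> /nbhs_nrmP [d d0 dP]; apply/nbhs_nrmP; exists d => // y yc.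
have /dP /cdiff_cder /cder_conj : nrm (y^* - c) < d.
  by rewrite -nrm_conj rmorphB /= conjCK.
by rewrite conjCK => /cder_cdiff.
Qed.

Lemma conj_exprz z k : ((z ^ k)^* : C) = (z^*) ^ k.
Proof. by case: k => n; rewrite ?fmorphV /= rmorphXn. Qed.

Lemma mge_conj f c k : mge f c k -> mge (fun z => (f z^*)^* : C) (c^* : C) k.
Proof.
move=> [g hg /nbhs_nrmP [d d0 dP]]; exists (fun z => (g z^*)^* : C); first exact: hol_conj.
apply/nbhs_nrmP; exists d => // y yc yc'.
have h1 : nrm (y^* - c) < d by rewrite -nrm_conj rmorphB /= conjCK.
have h2 : (y^* : C) != c by apply: contra_neq yc' => <-; rewrite conjCK.
have h3 : ((y^* : C) - c)^* = y - c^* by rewrite rmorphB /= conjCK.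
by rewrite (dP _ h1 h2) rmorphM /= conj_exprz h3.
Qed.

End Order.

Section Isolated.

(** The filter [F] of finite sequences, directed by inclusion, turns the near-covering form of
    compactness into a finiteness statement. *)
Lemma finite_isolated (T : topologicalType) (K P : set T) : compact K ->
  (forall p, K p -> \forall q \near p, q != p -> ~ P q) ->
  exists s : seq T, forall p, K p -> P p -> p \in s.
Proof.
move=> /compact_near_coveringP cK iso.
pose F : set_system (seq T) := [set A : set (seq T) | exists s0 : seq T,
  forall s : seq T, {subset s0 <= s} -> A s].
have FF : Filter F.
  constructor.
  - by exists [::].
  - move=> A B [s1 h1] [s2 h2]; exists (s1 ++ s2) => s ss; split.
      by apply: h1 => x xs; apply: ss; rewrite mem_cat xs.
    by apply: h2 => x xs; apply: ss; rewrite mem_cat xs orbT.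
  - by move=> A B AB [s0 h]; exists s0 => s /h /AB.
have /= := cK (seq T) F (fun s q => P q -> q \in s) FF.
case.
  move=> x /iso xP; exists ([set q | q != x -> ~ P q], [set s : seq T | x \in s]).
    split; first exact: xP.
    by exists [:: x] => s; apply; rewrite inE.
  move=> [q s] /= [qP xs] Pq; have [->//|qx] := eqVneq q x.
  by case: (qP qx).
by move=> s0 h; exists s0 => p Kp; apply: h.
Qed.

End Isolated.

(** * Factoring out zeros, and logarithmic derivatives *)

Section Count.
Variable R : realType.
Local Notation C := (Cplx R).
Implicit Types (x y z w a b c : C) (A B : set C) (f g h F G : C -> C) (k : int).

Lemma hol_mord_val f c (m : nat) : hol f c -> mord f c m%:Z -> (f c != 0) = (m == 0%N).
Proof.
move=> hf [g [hg gc] fg].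
have E : f c = (c - c) ^+ m * g c.
  apply/eqP; rewrite -subr_eq0; apply/eqP.
  apply: (@cts_pnear0 _ (fun z => f z - (z - c) ^+ m * g z)).
    by apply: hol_cts; apply: holB hf (holM (holX m (hol_subc c c)) hg).
  by apply: filterS fg => z ->; rewrite subrr.
by rewrite E subrr expr0n; case: (m == 0%N); rewrite ?mul1r ?gc // mul0r eqxx.
Qed.

Lemma hol_mord_eq f c (m : nat) : hol f c -> mord f c m%:Z ->
  exists2 g, hol g c /\ g c != 0 & \forall z \near c, f z = (z - c) ^+ m * g z.
Proof.
move=> hf fm; have v := hol_mord_val hf fm; have [g [hg gc] fg] := fm.
exists g => //.
have fg' : \forall z \near c, z != c -> f z = (z - c) ^+ m * g z by exact: fg.
have E : f c = (c - c) ^+ m * g c.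
  apply/eqP; rewrite -subr_eq0; apply/eqP.
  apply: (@cts_pnear0 _ (fun z => f z - (z - c) ^+ m * g z)).
    by apply: hol_cts; apply: holB hf (holM (holX m (hol_subc c c)) hg).
  by apply: filterS fg => z ->; rewrite subrr.
by apply: filterS fg' => z h; have [->|/h] := eqVneq z c.
Qed.

Lemma derive1_var z : derive1 (fun y : C => y) z = 1.
Proof.
apply: cder_derive1 => e e0; apply: filterS (near_nrm z ltr01) => y _.
by rewrite mul1r subrr nrm0 mulr_ge0 ?nrm_ge0 // ltW.
Qed.

Lemma derive1_subc a z : derive1 (fun y : C => y - a) z = 1.
Proof.
apply: cder_derive1 => e e0; apply: filterS (near_nrm z ltr01) => y _.
have -> : y - a - (z - a) - 1 * (y - z) = 0 by ring.
by rewrite nrm0 mulr_ge0 ?nrm_ge0 // ltW.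
Qed.

Lemma derive1_Xsubc a n z :
  derive1 (fun y : C => (y - a) ^+ n.+1) z = n.+1%:R * (z - a) ^+ n.
Proof.
elim: n => [|n IH].
  by rewrite expr0 mulr1; exact: derive1_subc.
have -> : (fun y : C => (y - a) ^+ n.+2) = (fun y => (y - a) * (y - a) ^+ n.+1).
  by apply/funext => y; rewrite exprS.
rewrite derive1M ?IH ?derive1_subc; [|exact: cdiff_subc|exact/cdiffX/cdiff_subc].
by rewrite -[in RHS]natr1 exprS; ring.
Qed.

Lemma mord_derive1 f c (m : nat) : hol f c -> mord f c m.+1%:Z ->
  mord (derive1 f) c m%:Z.
Proof.
move=> hf fm; have [g [hg gc] fg] := hol_mord_eq hf fm.
exists (fun z => m.+1%:R * g z + (z - c) * derive1 g z).
  split; last by rewrite subrr mul0r addr0 mulf_neq0 // pnatr_eq0.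
  apply: holD; first exact: holM (hol_cst _ _) hg.
  exact: holM (hol_subc c c) (hol_derive1 hg).
apply: filterS2 (pnear_near (nbhs_near fg)) (pnear_near (hol_near hg)) => z fz gz.
rewrite (eq_derive1 fz) derive1M; [|exact/cdiffX/cdiff_subc|exact: hol_cdiff].
by rewrite derive1_Xsubc -[(z - c) ^ m]/((z - c) ^+ m) exprS; ring.
Qed.

Lemma derive1_subk f a z : cdiff f z -> derive1 (fun y => f y - a) z = derive1 f z.
Proof.
move=> /cdiff_cder df; apply: cder_derive1 => e e0.
by apply: filterS (df e e0) => y; rewrite opprB addrA subrK.
Qed.

(** Each derivation lowers the order by one until it is 0. This links orders to [is_multiplicity],
    which is stated with derivatives. *)
Lemma derive1n_mord f c a (e : nat) : hol f c ->
  mord (fun z => f z - a) c e.+1%:Z ->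
  derive1n e.+1 f c != 0 /\ forall j, (0 < j < e.+1)%N -> derive1n j f c = 0.
Proof.
move=> hf fe.
have key j : (j <= e)%N -> hol (derive1n j.+1 f) c /\ mord (derive1n j.+1 f) c (e - j)%N%:Z.
  elim: j => [_|j IH je].
    rewrite subn0; have hfa : hol (fun z => f z - a) c by exact: holB hf (hol_cst _ _).
    have E : \forall z \near c, derive1 (fun y => f y - a) z = derive1 f z.
      by apply: filterS hf => z; exact: derive1_subk.
    split; first exact: hol_derive1.
    exact: eq_mord (pnear_near E) (mord_derive1 hfa fe).
  have [h m] := IH (ltnW je).
  split; first by rewrite derive1nS; exact: hol_derive1.
  rewrite derive1nS; apply: mord_derive1 => //.
  by have -> : ((e - j.+1).+1 = e - j)%N by lia.
split.
  have [h m] := key e (leqnn e).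
  by rewrite (hol_mord_val h m) subnn.
case=> // j je; have {}je : (j < e)%N := je; have [h m] := key j (ltnW je).
have := hol_mord_val h m.
by rewrite subn_eq0 leqNgt je /= => /negbFE /eqP.
Qed.

Lemma mord_subc a b : mord (fun z => z - a) b ((b == a)%:Z).
Proof.
have [->|ba] := eqVneq b a.
  exists (fun=> 1); first by split; [exact: hol_cst|exact: oner_neq0].
  by apply: filterS (near_nrm a ltr01) => z _ _; rewrite expr1z mulr1.
by apply: hol_mord; [exact: hol_subc|rewrite subr_eq0].
Qed.

(** Zeros are divided out one at a time; the order clause keeps track of what is left at every point
    of [B], so the induction can continue at repeated points. *)
Lemma extract_zeros B F (s : seq C) : (forall z, B z -> hol F z) ->
  (forall a, a \in s -> B a /\ exists2 m : nat, (count_mem a s <= m)%N & mord F a m%:Z) ->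
  exists G, [/\ forall z, B z -> hol G z, forall z, F z = (\prod_(a <- s) (z - a)) * G z &
    forall b k, B b -> mord F b k -> mord G b (k - (count_mem b s)%:Z)].
Proof.
move=> hF; elim: s => [|a s IH] Hs.
  exists F; split=> // [z|b k _]; first by rewrite big_nil mul1r.
  by rewrite subr0.
have [|G' [hG' FG' oG']] := IH.
  move=> b bs; have [|Bb [m mb om]] := Hs b; first by rewrite inE bs orbT.
  split=> //; exists m => //; apply: leq_trans mb; exact: leq_addl.
have [|Ba [m ma om]] := Hs a; first by rewrite inE eqxx.
rewrite /= eqxx add1n in ma.
have := oG' _ _ Ba om; rewrite subzn; last exact: ltnW.
have : (0 < m - count_mem a s)%N by rewrite subn_gt0.
case: (m - count_mem a s)%N => // n _ oa.
have [g [hg ga] G'E] := hol_mord_eq (hG' _ Ba) oa.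
have G'a : G' a = 0 by have := nbhs_singleton G'E; rewrite subrr expr0n mul0r.
(* The plain quotient would read 0 at [a]; there the local factor of [G'] supplies the continued
   value. *)
pose G z := if z == a then (z - a) ^+ n * g z else G' z / (z - a).
have GE z : G' z = (z - a) * G z.
  rewrite /G; case: eqVneq => [->|za]; first by rewrite subrr mul0r.
  by rewrite mulrC divfK // subr_eq0.
have Gnear b : \forall z \near b^', G z = G' z / (z - a).
  apply: filterS2 (pnear_neq b) (pnear_near (_ : \forall z \near b, b != a -> z != a)).
    move=> z zb h; rewrite /G; case: eqVneq => // za.
    have [ba|/h] := eqVneq b a; last by rewrite za eqxx.
    by move: zb; rewrite za ba subrr eqxx.
  have [->|ba] := eqVneq b a; first exact: filterS (near_nrm a ltr01).
  have bas : (fun z => z - a) b != 0 by rewrite subr_eq0.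
  apply: filterS (cts_neq0 (hol_cts (hol_subc a b)) bas) => z zas _.
  by rewrite -subr_eq0.
exists G; split.
- move=> z Bz; have [->|za] := eqVneq z a.
    apply: eq_hol (holM (holX n (hol_subc a a)) hg).
    apply: filterS G'E => y yE; rewrite /G; case: eqVneq => // ya.
    by rewrite yE exprS; field; rewrite subr_eq0.
  have zas : z - a != 0 by rewrite subr_eq0.
  apply: eq_hol (hol_div (hG' _ Bz) (hol_subc a z) zas).
  apply: filterS (cts_neq0 (hol_cts (hol_subc a z)) zas) => y yas.
  by rewrite /G; case: eqVneq => // ya; rewrite ya subrr eqxx in yas.
- by move=> z; rewrite FG' big_cons GE mulrCA mulrA.
- move=> b k Bb ob; have o1 := oG' _ _ Bb ob.
  have o2 := mordM o1 (mordV (mord_subc a b)).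
  rewrite /= PoszD opprD addrA (addrAC k) eq_sym.
  by apply: eq_mord o2; apply: filterS (Gnear b) => z ->.
Qed.

Lemma logder_prod (s : seq C) z : z \notin s ->
  cdiff (fun y => \prod_(a <- s) (y - a)) z /\
  derive1 (fun y => \prod_(a <- s) (y - a)) z / (\prod_(a <- s) (z - a)) =
    \sum_(a <- s) (z - a)^-1.
Proof.
elim: s => [|a s IH].
  move=> _; under eq_fun do rewrite big_nil; rewrite !big_nil.
  split; first exact: cdiff_cst.
  rewrite (@cder_derive1 _ _ _ 0) ?mul0r // => e e0.
  apply: filterS (near_nrm z ltr01) => y _.
  by rewrite subrr mul0r subrr nrm0 mulr_ge0 ?nrm_ge0 // ltW.
rewrite inE negb_or => /andP [za zs]; have [dP lP] := IH zs.
have -> : (fun y => \prod_(a0 <- a :: s) (y - a0)) = (fun y => (y - a) * \prod_(a0 <- s) (y - a0)).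
  by apply/funext => y; rewrite big_cons.
split; first exact: cdiffM (cdiff_subc a z) dP.
have za' : z - a != 0 by rewrite subr_eq0.
have P0 : \prod_(a0 <- s) (z - a0) != 0.
  rewrite prodf_seq_neq0; apply/allP => b bs; rewrite subr_eq0.
  by apply: contraNneq zs => ->.
rewrite (derive1M (cdiff_subc a z) dP) derive1_subc.
rewrite !big_cons -lP; field.
by rewrite za' P0.
Qed.

End Count.

(** * The argument principle *)

Section LocalCount.
Variable R : realType.
Local Notation C := (Cplx R).
Implicit Types (x y z w a b c : C) (A B : set C) (f g h F G : C -> C) (k : int).

(** Cauchy's formula at [c] for [h z * (z - c)], which vanishes at [c]. *)
Lemma cint_hol0 c (rho : R) h : 0 < rho ->
  (forall z, nrm (z - c) <= 2 * rho -> cdiff h z) -> cint c rho h = 0.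
Proof.
move=> rho0 dh; have cc : nrm (c - c) <= rho / 2 by rewrite subrr nrm0; lra.
have dh' z : nrm (z - c) <= 2 * rho -> cdiff (fun z => h z * (z - c)) z.
  by move=> /dh dz; exact: cdiffM dz (cdiff_subc c z).
have := cauchy_square rho0 dh' cc; rewrite subrr mulr0 mul0r => <-.
by apply: (eq_cint rho0) => z zc; rewrite mulfK // (contour_neq rho0 zc cc).
Qed.

Lemma cint_sum c (rho : R) h (s : seq C) : 0 < rho -> bdd_on (contour c rho) h ->
  (forall a, a \in s -> nrm (a - c) <= rho / 2) ->
  cint c rho (fun z => (\sum_(a <- s) (z - a)^-1) + h z) =
    (\sum_(a <- s) ctrans c rho (fun=> 1) a) + cint c rho h /\
  bdd_on (contour c rho) (fun z => (\sum_(a <- s) (z - a)^-1) + h z).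
Proof.
move=> rho0 bh; elim: s => [|a s IH] Hs.
  rewrite big_nil add0r; split; last by have [M hM] := bh; exists M => z /hM; rewrite big_nil add0r.
  by apply: (eq_cint rho0) => z _; rewrite big_nil add0r.
have [|E bs] := IH; first by move=> b bs; apply: Hs; rewrite inE bs orbT.
have ac : nrm (a - c) <= rho / 2 by apply: Hs; rewrite inE eqxx.
have bi := bdd_inv rho0 ac.
have Ef z : (\sum_(b <- a :: s) (z - b)^-1) + h z =
    ((\sum_(b <- s) (z - b)^-1) + h z) + 1 * (z - a)^-1.
  by rewrite big_cons; ring.
split.
  rewrite (eq_cint rho0 (fun z _ => Ef z)) (cintD rho0 1 bs bi) E big_cons mul1r.
  have -> : ctrans c rho (fun=> 1) a = cint c rho (fun z => (z - a)^-1).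
    by apply: (eq_cint rho0) => z _; rewrite mul1r.
  by ring.
have [M hM] := bs; have [N hN] := bi; exists (M + N) => z zc.
rewrite Ef mul1r; apply: le_trans (nrmD _ _) _.
by apply: lerD; [exact: hM|exact: hN].
Qed.

Lemma count_cint c (rho : R) F (s : seq C) : 0 < rho ->
  (forall z, nrm (z - c) <= 2 * rho -> hol F z) ->
  (forall a, a \in s -> nrm (a - c) <= rho / 2) ->
  (forall b, nrm (b - c) <= 2 * rho -> mord F b (count_mem b s)%:Z) ->
  cint c rho (fun z => derive1 F z / F z) = \sum_(a <- s) ctrans c rho (fun=> 1) a.
Proof.
move=> rho0 hF sc oF.
pose B := [set z : C | nrm (z - c) <= 2 * rho].
have sB a : a \in s -> B a by move=> /sc; rewrite /B /=; lra.
have [|G [hG FE oG]] := @extract_zeros _ B F s hF.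
  by move=> a aS; split; [exact: sB|exists (count_mem a s) => //; apply: oF; exact: sB].
have G0 b : B b -> G b != 0.
  move=> Bb; have := oG b _ Bb (oF b Bb); rewrite subrr => o.
  by rewrite (hol_mord_val (hG _ Bb) (o : mord G b 0%N%:Z)).
have dG z : B z -> cdiff (fun z => derive1 G z / G z) z.
  move=> Bz; apply: hol_cdiff.
  exact: hol_div (hol_derive1 (hG _ Bz)) (hG _ Bz) (G0 _ Bz).
have bG : bdd_on (contour c rho) (fun z => derive1 G z / G z).
  have [M hM] : bdd_on B (fun z => derive1 G z / G z).
    by apply: compact_bdd; [exact: compact_nball|move=> z /dG /cdiff_cts].
  by exists M => z /contour_near /hM.
have [E _] := cint_sum rho0 bG sc.
rewrite (cint_hol0 rho0 dG) addr0 in E; rewrite -E.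
apply: (eq_cint rho0) => z zc.
have zs : z \notin s.
  apply/negP => /sc zr; have := contour_dist zc zr; rewrite subrr nrm0.
  by have := rho0; lra.
have Bz : B z by exact: contour_near zc.
have [dP <-] := logder_prod zs.
have P0 : \prod_(a <- s) (z - a) != 0.
  rewrite prodf_seq_neq0; apply/allP => b bs; rewrite subr_eq0.
  by apply: contraNneq zs => ->.
have Gz := G0 _ Bz.
have -> : derive1 F z = derive1 (fun y => (\prod_(a <- s) (y - a)) * G y) z.
  by apply: eq_derive1; apply: filterS (near_nrm z ltr01) => y _; exact: FE.
have -> := derive1M dP (hol_cdiff (hG _ Bz)).
rewrite (FE z).
move: P0 (derive1 (fun y => \prod_(a <- s) (y - a)) z) (derive1 G z).
move: (\prod_(a <- s) (z - a)) => P P0 dP' dG'.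
by field; rewrite Gz P0.
Qed.

Lemma simple_zero F c : hol F c -> F c = 0 -> derive1 F c != 0 -> mord F c 1.
Proof.
move=> hF F0 dF; have [f0|[m [g hg gE]]] := hol_dich hF.
  have := eq_derive1 f0; rewrite (@cder_derive1 _ (fun=> 0) _ 0).
    by move=> E; rewrite E eqxx in dF.
  move=> e e0; apply: filterS (near_nrm c ltr01) => y _.
  by rewrite mul0r !subrr nrm0 mulr_ge0 ?nrm_ge0 // ltW.
have om : mord F c m%:Z by exists g => //; exact: pnear_near gE.
have := hol_mord_val hF om; rewrite F0 eqxx; case: m om {gE} => // m om _.
have := hol_mord_val (hol_derive1 hF) (mord_derive1 hF om).
by rewrite dF; case: m om.
Qed.

(* An integer count k is determined by an approximate value of k I, with an error
   bound N that may itself grow linearly in k. *)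
Lemma int_count (I : C) (e k : nat) (N : R) : 0 < nrm I ->
  nrm (k%:R * I - e%:R * I) <= N -> 4 * (e.+1%:R) * N <= (k.+1%:R) * nrm I -> k = e.
Proof.
move=> I0; rewrite -mulrBl nrmM => h1 h2.
have E : nrm (k%:R - e%:R : C) = `|k%:R - e%:R : R|.
  by rewrite -!(rmorph_nat (real_complex R)) -rmorphB nrmR.
have : 4 * (e.+1%:R) * `|k%:R - e%:R : R| <= k.+1%:R.
  rewrite -(ler_pM2r I0); apply: le_trans h2.
  by rewrite -[X in X <= _]mulrA -E ler_wpM2l // mulr_ge0.
have key (u v : R) : 0 <= u -> 0 <= v -> 1 <= `|u - v| -> u <= v + `|u - v| ->
    ~ 4 * (v + 1) * `|u - v| <= u + 1.
  move: `|u - v| => t u0 v0 t1 uv H.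
  have : (v + 1) <= (v + 1) * t by rewrite ler_peMr //; lra.
  have : t <= (v + 1) * t by rewrite ler_peMl //; lra.
  lra.
rewrite -(natr1 e) -(natr1 k) => H; apply: contrapT => /eqP ke.
apply: (key k%:R e%:R (ler0n _ _) (ler0n _ _) _ _ H); last first.
  by rewrite -lerBlDl ler_norm.
have [ke'|ke'|ke'] := ltngtP k e; last by rewrite ke' eqxx in ke.
  by rewrite ler0_norm ?subr_le0 ?ler_nat ?(ltnW ke') // opprB lerBrDr addrC natr1 ler_nat.
by rewrite ger0_norm ?subr_ge0 ?ler_nat ?(ltnW ke') // lerBrDr addrC natr1 ler_nat.
Qed.

(** The zeros of [f - w] and of [f] are compared through [count_cint]. Both integrals are close to
    their counts times [I c], and they are close to each other for small [w], so [int_count] equates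
    the counts. *)
Lemma local_count f c (e : nat) A : hol f c -> mord f c e%:Z -> nbhs c A ->
  exists V : set C, [/\ nbhs c V, V `<=` A & exists2 d : R, 0 < d &
    forall w, nrm w < d -> exists s : seq C, [/\ size s = e,
      forall a, a \in s -> V a &
      forall b, V b -> mord (fun z => f z - w) b (count_mem b s)%:Z]].
Proof.
move=> hf; case: e => [|e] oe cA.
  have fc : f c != 0 by rewrite (hol_mord_val hf oe).
  have fc0 : 0 < nrm (f c) / 2 by rewrite divr_gt0 // nrm_gt0.
  have H : \forall z \near c, nrm (f z - f c) < nrm (f c) / 2 by exact: (hol_cts hf (near_nrm _ fc0)).
  exists (A `&` [set z | hol f z /\ nrm (f z - f c) < nrm (f c) / 2]); split.
  - by apply: filterI => //; apply: filterS2 (hol_near hf) H.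
  - by move=> z [].
  exists (nrm (f c) / 2) => // w wd; exists [::]; split=> // b [_ [hb bc]].
  apply: hol_mord; first exact: holB hb (hol_cst _ _).
  rewrite subr_eq0; apply/eqP => bw; move: bc; rewrite bw.
  by have := nrm_tri w (f c) 0; rewrite !subr0 (nrmC (f c)); lra.
have od := mord_derive1 hf oe.
have [r0 r00 r0P] : exists2 r0 : R, 0 < r0 & forall z, nrm (z - c) < r0 ->
    [/\ A z, hol f z & z != c -> f z != 0 /\ derive1 f z != 0].
  have H1 : \forall z \near c, z != c -> f z != 0 by exact: (mord_neq0 oe).
  have H2 : \forall z \near c, z != c -> derive1 f z != 0 by exact: (mord_neq0 od).
  have /nbhs_nrmP [r0 r00 H] : \forall z \near c, A z /\ hol f z.
    by apply: filterS2 cA (hol_near hf).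
  have /nbhs_nrmP [r1 r10 H'] : \forall z \near c, z != c -> f z != 0 /\ derive1 f z != 0.
    by apply: filterS2 H1 H2 => z h1 h2 zc; split; [exact: h1|exact: h2].
  exists (Num.min r0 r1); first by rewrite lt_min r00.
  by move=> z; rewrite lt_min => /andP [/H [? ?] /H' ?].
pose rho := r0 / 3; have rho0 : 0 < rho by rewrite divr_gt0.
pose B := [set z : C | nrm (z - c) <= 2 * rho].
have BP z : B z -> [/\ A z, hol f z & z != c -> f z != 0 /\ derive1 f z != 0].
  by rewrite /B /rho /= => zB; apply: r0P; lra.
have fc0 : f c = 0.
  by apply/eqP; have := hol_mord_val hf oe => /= /negbFE.
pose I := ctrans c rho (fun=> 1).
have b1 : bdd_on (contour c rho) (fun=> 1) by exact: bdd_cst.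
have cc : nrm (c - c) < rho / 2 by rewrite subrr nrm0; lra.
have I0 : 0 < nrm (I c).
  rewrite nrm_gt0 /I; have -> : ctrans c rho (fun=> 1) c = cint c rho (fun z => (z - c)^-1).
    by apply: (eq_cint rho0) => z _; rewrite mul1r.
  exact: cint_center.
(* The margin [int_count] allows for the expected count [e.+1]: with [k] zeros the total error will
   be at most [k.+1 * eta]. *)
pose eta := nrm (I c) / (4 * e.+2%:R).
have eta0 : 0 < eta by rewrite divr_gt0 // mulr_gt0.
have [r1 /andP [r10 r1r] r1P] : exists2 r1 : R, 0 < r1 < rho / 2 &
    forall z, nrm (z - c) < r1 -> nrm (I z - I c) <= eta.
  have /cdiff_cts cI := cder_cdiff (cder_ctrans rho0 b1 cc).
  have /nbhs_nrmP [d d0 dP] : \forall z \near c, nrm (I z - I c) < eta.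
    exact: (cI _ (near_nrm _ eta0)).
  exists (Num.min d (rho / 4)); first by rewrite lt_min d0 gt_min /=; apply/andP; split; lra.
  by move=> z; rewrite lt_min => /andP [/dP /ltW].
pose V := [set z : C | nrm (z - c) < r1].
have VB z : V z -> B z by rewrite /V /B /=; have := rho0; lra.
(* [f] is bounded below on the compact set of points of [B] outside [V], so for [nrm w < mu / 2]
   every zero of [f - w] in [B] lies in [V], where [I] is within [eta] of [I c]. *)
have [mu mu0 muP] : exists2 mu : R, 0 < mu & forall z, B z -> ~ V z -> mu <= nrm (f z).
  pose K := B `&` ~` V.
  have cK : compact K.
    apply: compact_closedI; first exact: compact_nball.
    apply: open_closedC; rewrite openE => z zV.
    apply/nbhs_nrmP; exists (r1 - nrm (z - c)); first by rewrite subr_gt0.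
    by move=> y yz; rewrite /V /=; have := nrm_tri z y c; lra.
  have Kc z : K z -> z != c.
    by move=> [_ nV]; apply/eqP => zc; apply: nV; rewrite zc /V /= subrr nrm0.
  have [M HM] : bdd_on K (fun z => (f z)^-1).
    apply: compact_bdd => // z Kz; have [Bz _] := Kz.
    have [_ hz /(_ (Kc _ Kz)) [fz _]] := BP _ Bz.
    by apply: hol_cts; exact: holV.
  exists (`|M| + 1)^-1; first by rewrite invr_gt0 ltr_wpDl.
  move=> z Bz nV; have Kz : K z by [].
  have [_ _ /(_ (Kc _ Kz)) [fz _]] := BP _ Bz.
  have := HM _ Kz; rewrite nrmV => h.
  rewrite -[nrm (f z)]invrK lef_pV2 ?posrE ?invr_gt0 ?nrm_gt0 ?ltr_wpDl //.
  by have := ler_norm M; lra.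
have [M2 hM2] : bdd_on B (derive1 f).
  apply: compact_bdd; first exact: compact_nball.
  by move=> z /BP [_ hz _]; exact: hol_cts (hol_derive1 hz).
have M20 : 0 <= M2.
  by apply: le_trans (hM2 c (VB _ _)); rewrite ?nrm_ge0 // /V /= subrr nrm0.
pose KK := 16 * rho * (M2 * (2 / mu ^+ 2)).
have KK0 : 0 <= KK.
  by rewrite /KK !mulr_ge0 ?invr_ge0 ?exprn_ge0 // ltW.
exists V; split.
- by apply: near_nrm.
- by move=> z /VB /BP [].
exists (Num.min (mu / 2) (eta / (KK + 1))).
  by rewrite lt_min !divr_gt0 // ltr_wpDl.
move=> w; rewrite lt_min => /andP [wmu weta].
have hFw z : B z -> hol (fun z => f z - w) z.
  by move=> /BP [_ hz _]; exact: (holB hz (hol_cst w z)).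
have nV0 z : B z -> ~ V z -> f z - w != 0.
  move=> Bz nV; rewrite subr_eq0; apply/eqP => fw.
  by have := muP _ Bz nV; rewrite fw; lra.
(* For [w = 0] the only zero is [c], repeated [e.+1] times. For [w != 0] all zeros differ from [c],
   and are simple because [derive1 f] does not vanish elsewhere in [B]. *)
have [w0|w0] := eqVneq w 0.
  exists (nseq e.+1 c); split; first by rewrite size_nseq.
    by move=> a; rewrite mem_nseq => /eqP ->; rewrite /V /= subrr nrm0.
  move=> b /VB Bb; rewrite count_nseq /=.
  have -> : (fun z => f z - w) = f by apply/funext => z; rewrite w0 subr0.
  have [<-|bc] := eqVneq c b; first by rewrite mul1n.
  have [_ hb fb] := BP _ Bb; rewrite mul0n.
  by have [fb0 _] := fb ltac:(by rewrite eq_sym); exact: (hol_mord hb fb0).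
pose P := [set z | f z = w].
have [s' s'P] : exists s : seq C, forall p, B p -> P p -> p \in s.
  apply: finite_isolated; first exact: compact_nball.
  move=> p Bp; have hp := hFw _ Bp; have [fp|fp] := eqVneq (f p - w) 0.
    have pc : p != c.
      by apply: contra_neq w0 => pc; move: fp; rewrite pc fc0 sub0r => /eqP; rewrite oppr_eq0 => /eqP.
    have [_ hfp /(_ pc) [_ dp]] := BP _ Bp.
    have dp' : derive1 (fun z => f z - w) p != 0.
      by rewrite (derive1_subk w (hol_cdiff hfp)).
    have o1 := simple_zero hp fp dp'.
    have H : \forall q \near p, q != p -> f q - w != 0 by exact: (mord_neq0 o1).
    by apply: filterS H => q h /h; rewrite subr_eq0 => /eqP.
  apply: filterS (cts_neq0 (hol_cts hp) fp) => q + _.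
  by rewrite subr_eq0 => /eqP.
pose s := undup [seq z <- s' | (nrm (z - c) <= 2 * rho) && (f z == w)].
have sE z : (z \in s) = (nrm (z - c) <= 2 * rho) && (f z == w).
  rewrite mem_undup mem_filter; apply/andb_idr => /andP [Bz /eqP fz].
  exact: s'P.
have sV a : a \in s -> V a.
  rewrite sE => /andP [Ba /eqP fa]; apply: contrapT => nV.
  by have := nV0 _ Ba nV; rewrite fa subrr eqxx.
have cs b : count_mem b s = (b \in s) by rewrite count_uniq_mem // undup_uniq.
have os b : B b -> mord (fun z => f z - w) b (count_mem b s)%:Z.
  move=> Bb; rewrite cs sE; have -> : nrm (b - c) <= 2 * rho by [].
  rewrite /=; have hb := hFw _ Bb; case: eqVneq => [fb|fb].
    have bc : b != c by apply: contra_neq w0 => bc; rewrite -fb bc.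
    have [_ hfb /(_ bc) [_ db]] := BP _ Bb.
    have db' : derive1 (fun z => f z - w) b != 0.
      by rewrite (derive1_subk w (hol_cdiff hfb)).
    have fb0 : f b - w = 0 by rewrite fb subrr.
    exact: (simple_zero hb fb0 db').
  have fb0 : f b - w != 0 by rewrite subr_eq0.
  exact: (hol_mord hb fb0).
exists s; split=> //; last by move=> b /VB /os.
have sr a : a \in s -> nrm (a - c) <= rho / 2.
  by move=> /sV; rewrite /V /=; have := r1r; lra.
have C1 := count_cint rho0 hFw sr os.
have C2 : cint c rho (fun z => derive1 f z / f z) = \sum_(a <- nseq e.+1 c) I a.
  have hBf z : nrm (z - c) <= 2 * rho -> hol f z by move=> /BP [].
  have sB a : a \in nseq e.+1 c -> nrm (a - c) <= rho / 2.
    by rewrite mem_nseq => /eqP ->; exact: ltW.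
  apply: (count_cint rho0 hBf sB) => b Bb; rewrite count_nseq /=.
  have [<-|bc] := eqVneq c b; first by rewrite mul1n.
  have [_ hb fb] := BP _ Bb; rewrite mul0n.
  by have [fb0 _] := fb ltac:(by rewrite eq_sym); exact: (hol_mord hb fb0).
have H1 : nrm ((size s)%:R * I c - \sum_(a <- s) I a) <= (size s)%:R * eta.
  elim: (s) sV => [|a t IH] tV.
    by rewrite big_nil mul0r subr0 nrm0 mul0r.
  rewrite big_cons -[size (a :: t)]/(size t).+1 -!natr1.
  have -> : ((size t)%:R + 1) * I c - (I a + \sum_(a0 <- t) I a0) =
    ((size t)%:R * I c - \sum_(a0 <- t) I a0) - (I a - I c) by ring.
  apply: le_trans (nrmB _ _) _.
  have h1 := IH (fun b bt => tV b ltac:(by rewrite inE bt orbT)).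
  have h2 := r1P _ (tV a ltac:(by rewrite inE eqxx)).
  lra.
have C2' : \sum_(a <- nseq e.+1 c) I a = e.+1%:R * I c.
  by rewrite big_nseq iter_addr_0 mulr_natl.
have bd w' : nrm w' < mu / 2 -> forall z, contour c rho z -> mu / 2 <= nrm (f z - w').
  move=> w'mu z zc; have Bz : B z by exact: contour_near zc.
  have nV : ~ V z.
    by rewrite /V /=; have := contour_far zc; have := r1r; have := rho0; lra.
  have := muP _ Bz nV; have := nrm_tri w' (f z) 0; rewrite !subr0; lra.
have n0 : nrm 0 < mu / 2 by rewrite nrm0; lra.
(* The two logarithmic derivatives differ by [w * q], with [q] bounded on the contour independently
   of [w]. *)
pose q z := derive1 f z / (f z * (f z - w)).
have qb z : contour c rho z -> nrm (q z) <= M2 * (2 / mu ^+ 2).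
  move=> zc; rewrite /q nrmM nrmV; apply: ler_pM; rewrite ?invr_ge0 ?nrm_ge0 //.
    by apply: hM2; exact: contour_near zc.
  have h1 := bd _ wmu z zc; have nV : mu <= nrm (f z).
    apply: muP; first exact: contour_near zc.
    by rewrite /V /=; have := contour_far zc; have := r1r; have := rho0; lra.
  have -> : 2 / mu ^+ 2 = (mu * (mu / 2))^-1 by field; rewrite gt_eqF.
  rewrite nrmM lef_pV2 ?posrE ?mulr_gt0 //; try lra.
  by apply: ler_pM => //; lra.
have bq : bdd_on (contour c rho) q by exists (M2 * (2 / mu ^+ 2)).
have C3 : cint c rho (fun z => derive1 (fun y => f y - w) z / (f z - w)) =
    cint c rho (fun z => derive1 f z / f z) + w * cint c rho q.
  rewrite -cintD //; last first.
    exists (M2 * (2 / mu)) => z zc; rewrite nrmM nrmV; apply: ler_pM; rewrite ?invr_ge0 ?nrm_ge0 //.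
      by apply: hM2; exact: contour_near zc.
    have := bd _ n0 z zc; rewrite subr0 => h.
    by rewrite -[2 / mu]invf_div lef_pV2 ?posrE //; lra.
  apply: (eq_cint rho0) => z zc; have Bz : B z by exact: contour_near zc.
  have [_ hz _] := BP _ Bz; rewrite derive1_subk; last exact: hol_cdiff.
  have f0 : f z != 0.
    by rewrite -nrm_gt0; have := bd _ n0 z zc; rewrite subr0; lra.
  have fw : f z - w != 0 by rewrite -nrm_gt0; have := bd _ wmu z zc; lra.
  by rewrite /q; field; rewrite f0 fw.
have H2 : nrm (w * cint c rho q) <= eta.
  rewrite nrmM; apply: (@le_trans _ _ (nrm w * KK)).
    by rewrite ler_wpM2l ?nrm_ge0 //; exact: (cint_le rho0 qb).
  have : nrm w * (KK + 1) <= eta.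
    by rewrite -ler_pdivlMr ?ltr_wpDl //; exact: ltW.
  by have := nrm_ge0 w; lra.
have H3 : nrm ((size s)%:R * I c - e.+1%:R * I c) <= (size s).+1%:R * eta.
  have -> : (size s)%:R * I c - e.+1%:R * I c =
     ((size s)%:R * I c - \sum_(a <- s) I a) + w * cint c rho q.
    by rewrite -[in RHS]C1 C3 C2 C2'; ring.
  apply: le_trans (nrmD _ _) _; rewrite -natr1; lra.
apply: int_count I0 H3 _.
have -> : 4 * (e.+2%:R) * ((size s).+1%:R * eta) = (size s).+1%:R * nrm (I c).
  have e40 : (4 * e.+2%:R : R) != 0 by rewrite mulf_neq0 ?pnatr_eq0.
  by rewrite mulrCA /eta; congr (_ * _); rewrite mulrC divfK.
by [].
Qed.

End LocalCount.

(** * Divisors on a compact surface *)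

Section Surface.
Variable R : realType.
Variable X : riemannSurface R.
Local Notation C := (Cplx R).
Implicit Types (p q : X) (i j : chart_index X) (F G : X -> C) (k l : int) (z w c : C).

Lemma near_chartV i p (P : X -> Prop) : dom i p ->
  (\forall q \near p, P q) -> \forall z \near chart i p, P (chartV i z).
Proof.
move=> ip Pp; have H : nbhs (chartV i (chart i p)) P by rewrite chartK.
exact: (@chartV_continuous _ _ _ _ ip _ H).
Qed.

Lemma near_dom i p : dom i p -> \forall q \near p, dom i q.
Proof. by move=> ip; have := dom_open i; rewrite openE => /(_ _ ip). Qed.

Lemma near_chart i p (P : C -> Prop) : dom i p ->
  (\forall z \near chart i p, P z) -> \forall q \near p, dom i q /\ P (chart i q).
Proof.
move=> ip Pp; have H : \forall q \near p, P (chart i q) := @chart_continuous _ _ _ _ ip _ Pp.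
by apply: filterS2 (near_dom ip) H.
Qed.

Lemma near_image i p : dom i p ->
  \forall z \near chart i p, dom i (chartV i z) /\ chart i (chartV i z) = z.
Proof.
move=> ip; have H : nbhs (chart i p) (chart i @` dom i).
  by have := @chart_open _ X i; rewrite openE; apply; exists p.
by apply: filterS H => z [q iq <-]; rewrite chartK.
Qed.

Lemma pnear_chartV i p (P : X -> Prop) : dom i p ->
  (\forall q \near p^', P q) -> \forall z \near (chart i p)^', P (chartV i z).
Proof.
move=> ip Pp.
have H : \forall q \near p, q != p -> P q by exact: Pp.
have K : \forall z \near chart i p, z != chart i p -> P (chartV i z).
  apply: filterS2 (near_chartV ip H) (near_image ip) => z h [iz zE] zc.
  by apply: h; apply: contra_neq zc => <-.
exact: K.
Qed.

Lemma pnear_chart i p (P : C -> Prop) : dom i p ->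
  (\forall z \near (chart i p)^', P z) -> \forall q \near p^', dom i q /\ P (chart i q).
Proof.
move=> ip Pp.
have H : \forall z \near chart i p, z != chart i p -> P z by exact: Pp.
have K : \forall q \near p, q != p -> dom i q /\ P (chart i q).
  apply: filterS (near_chart ip H) => q [iq h] qp; split=> //; apply: h.
  by apply: contra_neq qp => E; rewrite -(chartK iq) E chartK.
exact: K.
Qed.

Definition trans i j z : C := chart j (chartV i z).

Lemma hol_trans i j p : dom i p -> dom j p -> hol (trans i j) (chart i p).
Proof.
move=> ip jp; apply: filterS2 (near_chartV ip (near_dom jp)) (near_image ip).
move=> z jz [iz zE]; constructor.
by have := transition_derivable iz jz; rewrite zE.
Qed.

Lemma transK i j p : dom i p -> dom j p ->
  \forall z \near chart i p, trans j i (trans i j z) = z.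
Proof.
move=> ip jp; apply: filterS2 (near_chartV ip (near_dom jp)) (near_image ip).
by move=> z jz [iz zE]; rewrite /trans chartK.
Qed.

Lemma transE i j p : dom i p -> trans i j (chart i p) = chart j p.
Proof. by move=> ip; rewrite /trans chartK. Qed.

Lemma derive1_trans i j p : dom i p -> dom j p -> derive1 (trans i j) (chart i p) != 0.
Proof.
move=> ip jp.
have d1 := hol_cdiff (hol_trans ip jp).
have d2 : cdiff (trans j i) (trans i j (chart i p)).
  by rewrite transE //; exact: hol_cdiff (hol_trans jp ip).
have E := derive1_compC d1 d2.
have E1 : derive1 (fun z => trans j i (trans i j z)) (chart i p) = 1.
  rewrite -(derive1_var (chart i p)); exact: (eq_derive1 (transK ip jp)).
apply/eqP => d0; move: E; rewrite E1 d0 mulr0 => /eqP; by rewrite oner_eq0.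
Qed.

Lemma mord_trans i j p : dom i p -> dom j p ->
  mord (fun z => trans i j z - trans i j (chart i p)) (chart i p) 1.
Proof.
move=> ip jp; have h := hol_trans ip jp.
apply: simple_zero; first exact: (holB h (hol_cst _ _)).
  by rewrite subrr.
by rewrite (derive1_subk _ (hol_cdiff h)) derive1_trans.
Qed.

Lemma loc_trans F i j p : dom i p -> dom j p ->
  \forall z \near chart i p, F (chartV j (trans i j z)) = F (chartV i z).
Proof.
move=> ip jp; apply: filterS (near_chartV ip (near_dom jp)) => z jz.
by rewrite /trans chartK.
Qed.

Lemma mge_chart F i j p k : dom i p -> dom j p ->
  mge (fun z => F (chartV j z)) (chart j p) k -> mge (fun z => F (chartV i z)) (chart i p) k.
Proof.
move=> ip jp; rewrite -(transE j ip) => o.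
exact: eq_mge (pnear_near (loc_trans F ip jp)) (mge_comp o (hol_trans ip jp) (mord_trans ip jp)).
Qed.

Lemma mord_chart F i j p k : dom i p -> dom j p ->
  mord (fun z => F (chartV j z)) (chart j p) k -> mord (fun z => F (chartV i z)) (chart i p) k.
Proof.
move=> ip jp; rewrite -(transE j ip) => o.
exact: eq_mord (pnear_near (loc_trans F ip jp)) (mord_comp o (hol_trans ip jp) (mord_trans ip jp)).
Qed.

Definition ch p : chart_index X := projT1 (cid (dom_cover p)).

Lemma dom_ch p : dom (ch p) p.
Proof. exact: (projT2 (cid (dom_cover p))). Qed.

(** Orders are read in one chosen chart; [ord_geP] and [has_ordP] give access to any other. *)
Definition ord_ge F p k := mge (fun z => F (chartV (ch p) z)) (chart (ch p) p) k.
Definition has_ord F p k := mord (fun z => F (chartV (ch p) z)) (chart (ch p) p) k.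

Lemma ord_geP F i p k : dom i p ->
  ord_ge F p k <-> mge (fun z => F (chartV i z)) (chart i p) k.
Proof. by move=> ip; split; apply: mge_chart => //; exact: dom_ch. Qed.

Lemma has_ordP F i p k : dom i p ->
  has_ord F p k <-> mord (fun z => F (chartV i z)) (chart i p) k.
Proof. by move=> ip; split; apply: mord_chart => //; exact: dom_ch. Qed.

Lemma has_ord_ge F p k : has_ord F p k -> ord_ge F p k.
Proof. exact: mord_mge. Qed.

Lemma ord_ge_le F p k l : l <= k -> ord_ge F p k -> ord_ge F p l.
Proof. exact: mge_le. Qed.

Lemma eq_ord_ge F G p k : (\forall q \near p^', F q = G q) -> ord_ge F p k -> ord_ge G p k.
Proof. by move=> FG; apply: eq_mge; exact: (pnear_chartV (dom_ch p) FG). Qed.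

Lemma eq_has_ord F G p k : (\forall q \near p^', F q = G q) -> has_ord F p k -> has_ord G p k.
Proof. by move=> FG; apply: eq_mord; exact: (pnear_chartV (dom_ch p) FG). Qed.

Lemma ord_geD F G p k : ord_ge F p k -> ord_ge G p k -> ord_ge (fun q => F q + G q) p k.
Proof. exact: mgeD. Qed.

Lemma ord_geM F G p k l : ord_ge F p k -> ord_ge G p l -> ord_ge (fun q => F q * G q) p (k + l).
Proof. exact: mgeM. Qed.

Lemma has_ordM F G p k l : has_ord F p k -> has_ord G p l -> has_ord (fun q => F q * G q) p (k + l).
Proof. exact: mordM. Qed.

Lemma has_ordV F p k : has_ord F p k -> has_ord (fun q => (F q)^-1) p (- k).
Proof. exact: mordV. Qed.

Lemma ord_ge_cst w p : ord_ge (fun=> w) p 0.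
Proof. exact: (hol_mge (hol_cst w _)). Qed.

Lemma has_ord_cst w p : w != 0 -> has_ord (fun=> w) p 0.
Proof. exact: (@hol_mord _ (fun=> w) _ (hol_cst w _)). Qed.

Lemma ord_geZ w F p k : ord_ge F p k -> ord_ge (fun q => w * F q) p k.
Proof. by move=> o; have := ord_geM (ord_ge_cst w p) o; rewrite add0r. Qed.

Lemma has_ordZ w F p k : w != 0 -> has_ord F p k -> has_ord (fun q => w * F q) p k.
Proof. by move=> w0 o; have := has_ordM (has_ord_cst p w0) o; rewrite add0r. Qed.

Lemma ord_geB F G p k : ord_ge F p k -> ord_ge G p k -> ord_ge (fun q => F q - G q) p k.
Proof.
move=> oF /(ord_geZ (-1)) oG.
have -> : (fun q => F q - G q) = (fun q => F q + (-1) * G q).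
  by apply/funext => q; rewrite mulN1r.
exact: ord_geD.
Qed.

Lemma has_ord_ge_le F p k l : has_ord F p k -> ord_ge F p l -> l <= k.
Proof. exact: mord_mge_le. Qed.

Lemma has_ord_uniq F p k l : has_ord F p k -> has_ord F p l -> k = l.
Proof. exact: mord_uniq. Qed.

Lemma ord_dich F p k : ord_ge F p k ->
  (\forall q \near p^', F q = 0) \/ exists2 l, k <= l & has_ord F p l.
Proof.
move=> /mge_dich [F0|]; last by right.
left; apply: filterS (pnear_chart (dom_ch p) F0) => q [iq].
by rewrite chartK.
Qed.

Lemma has_ord_near F p k : has_ord F p k -> \forall q \near p^', has_ord F q 0.
Proof.
move=> /mord_near o; apply: filterS (pnear_chart (dom_ch p) o) => q [iq oq].
exact/(has_ordP _ _ iq).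
Qed.

Lemma has_ord_neq0 F p k : has_ord F p k -> \forall q \near p^', F q != 0.
Proof.
move=> /mord_neq0 o; apply: filterS (pnear_chart (dom_ch p) o) => q [iq].
by rewrite chartK.
Qed.

Lemma has_ord_not0 F p k : has_ord F p k -> ~ (\forall q \near p^', F q = 0).
Proof.
move=> o F0.
have H : ord_ge F p (k + 1).
  apply: (@eq_ord_ge (fun=> 0)); first by apply: filterS F0 => q.
  exists (fun=> 0); first exact: hol_cst.
  by apply: filterS (pnear_neq _) => z _; rewrite mulr0.
by have := has_ord_ge_le o H; rewrite gerDl.
Qed.

Lemma ord_val F p : ord_ge F p 0 -> exists2 v, ord_ge (fun q => F q - v) p 1 &
  forall w, ord_ge (fun q => F q - w) p 1 -> w = v.
Proof. exact: mge_val. Qed.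

(** [t] is the quotient of the leading coefficients, obtained as the value of [G / F], which has
    order exactly 0 at [p]. *)
Lemma ord_reduce F G p k : has_ord F p k -> has_ord G p k ->
  exists2 t, t != 0 & ord_ge (fun q => G q - t * F q) p (k + 1).
Proof.
move=> oF oG; have o0 := has_ordM oG (has_ordV oF); rewrite subrr in o0.
have [t ot _] := ord_val (has_ord_ge o0).
exists t.
  apply/eqP => t0; have := has_ord_ge_le o0.
  move=> /(_ 1); rewrite ler10 => H.
  suff : false by [].
  apply: H; apply: eq_ord_ge ot; apply: filterS (has_ord_neq0 oF) => q _.
  by rewrite t0 subr0.
have := ord_geM ot (has_ord_ge oF); rewrite addrC; apply: eq_ord_ge.
by apply: filterS (has_ord_neq0 oF) => q Fq; rewrite mulrBl divfK.
Qed.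

(** Vanishing as a meromorphic function: values at single points, arbitrary at poles, are
    disregarded. *)
Definition null F := forall p, \forall q \near p^', F q = 0.

Lemma near_pnear p (P : X -> Prop) : (\forall q \near p^', P q) ->
  \forall q \near p, \forall y \near q^', P y.
Proof.
move=> Pp; have H : \forall q \near p, q != p -> P q by exact: Pp.
apply: filterS (nbhs_near H) => q Hq.
have [->//|qp] := eqVneq q p.
have op : \forall y \near q, y != p.
  have := hausdorff_accessible (@surface_hausdorff _ X) => /accessible_closed_set1 /(_ p).
  move=> /closed_openC; rewrite openE => /(_ q) /=.
  move=> /(_ ltac:(by move=> E; rewrite E eqxx in qp)).
  by apply: filterS => y /eqP.
have K : \forall y \near q, P y.
  by apply: filterS2 Hq op => y h /h.
by apply: filterS K.
Qed.

End Surface.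

Section Mord.
Variable R : realType.
Local Notation C := (Cplx R).
Implicit Types (z w c : C) (f g : C -> C) (k l : int).

Lemma mord_dom f g c k l : mord f c k -> mge g c l -> k < l ->
  mord (fun z => f z + g z) c k.
Proof.
move=> [f1 [hf fc] fE] [g1 hg gE] kl; have : 0 < l - k by rewrite subr_gt0.
case E : (l - k) => [[|n]|//] // _.
exists (fun z => f1 z + (z - c) ^+ n.+1 * g1 z).
  split; last by rewrite subrr expr0n mul0r addr0.
  exact: holD hf (holM (holX n.+1 (hol_subc c c)) hg).
apply: filterS3 fE gE (pnear_neq c) => z -> -> zc.
rewrite mulrDr mulrA -[(z - c) ^+ n.+1]/((z - c) ^ n.+1%:Z) -E -expfzDr //.
by have -> : k + (l - k) = l by rewrite addrC subrK.
Qed.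

Lemma pnear_pnear c (P : C -> Prop) : (\forall z \near c^', P z) ->
  \forall z \near c, \forall y \near z^', P y.
Proof.
move=> Pp; have H : \forall z \near c, z != c -> P z by exact: Pp.
apply: filterS (nbhs_near H) => z Hz; have [->//|zc] := eqVneq z c.
have oc : \forall y \near z, y - c != 0.
  by apply: (cts_neq0 (hol_cts (hol_subc c z))); rewrite subr_eq0.
have K : \forall y \near z, P y.
  by apply: filterS2 Hz oc => y h; rewrite subr_eq0.
exact: pnear_near K.
Qed.

End Mord.

Lemma count_flatten_nseq (T : eqType) (us : seq T) (m : T -> nat) x : uniq us ->
  count_mem x (flatten [seq nseq (m p) p | p <- us]) = (if x \in us then m x else 0)%N.
Proof.
elim: us => //= p us IH /andP [pus uus].
rewrite count_cat count_nseq IH // inE /= [p == x]eq_sym.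
case: eqVneq => [->|xp]; first by rewrite (negPf pus) mul1n addn0.
by rewrite mul0n add0n.
Qed.

Lemma count_flatten_disjoint (T : eqType) (us : seq T) (m : T -> seq T) (D : T -> set T) x :
  uniq us -> (forall p a, p \in us -> a \in m p -> D p a) ->
  (forall p q, p \in us -> q \in us -> p != q -> forall a, D p a -> D q a -> False) ->
  forall p, p \in us -> D p x -> count_mem x (flatten [seq m p | p <- us]) = count_mem x (m p).
Proof.
move=> uus mD dD p pus Dp.
have out q : q \in us -> q != p -> count_mem x (m q) = 0%N.
  move=> qus qp; apply/count_memPn/negP => /(mD _ _ qus) Dq.
  exact: dD qus pus qp _ Dq Dp.
clear mD dD; elim: us uus pus out => //= q us IH /andP [qus uus] pus out.
rewrite count_cat; move: pus; rewrite inE => /orP [/eqP pq|pus]; last first.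
  have qp : q != p by apply: contraNneq qus => ->.
  rewrite out ?mem_head // add0n; apply: IH => // r rus rp.
  by apply: out => //; rewrite inE rus orbT.
rewrite -pq [X in (_ + X)%N](_ : _ = 0%N) ?addn0 //.
apply/count_memPn/negP => /flatten_mapP [r rus xr].
have rp : r != p by rewrite pq; apply: contraNneq qus => <-.
have := out r; rewrite inE rus orbT => /(_ isT rp) /count_memPn.
by rewrite xr.
Qed.

Lemma near_all_seq (T : topologicalType) (I : eqType) (s : seq I) (p : T) (P : I -> set T) :
  (forall x, x \in s -> nbhs p (P x)) -> \forall q \near p, forall x, x \in s -> P x q.
Proof.
elim: s => [|a s IH] H; first by apply: nearW.
have h1 := IH (fun x xs => H x ltac:(by rewrite inE xs orbT)).
have h2 : \forall q \near p, P a q := H a (mem_head _ _).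
by apply: filterS2 h1 h2 => q h1 h2 x; rewrite inE => /predU1P [->//|/h1].
Qed.

Lemma size_flatten_map (T : eqType) (us : seq T) (m m' : T -> seq T) :
  (forall p, p \in us -> size (m p) = size (m' p)) ->
  size (flatten [seq m p | p <- us]) = size (flatten [seq m' p | p <- us]).
Proof.
elim: us => //= p us IH H; rewrite !size_cat H ?mem_head // IH // => q qus.
by apply: H; rewrite inE qus orbT.
Qed.

(** * Zeros of meromorphic functions on a surface *)

Section CountSurface.
Variable R : realType.
Variable X : riemannSurface R.
Local Notation C := (Cplx R).
Implicit Types (p q : X) (i j : chart_index X) (F G : X -> C) (k l : int) (z w c : C).

(* F is meromorphic and nowhere locally zero. *)
Definition exact F := forall p, exists k, has_ord F p k.

Lemma connected_clopen (A : set X) : open A -> open (~` A) -> A !=set0 -> A = setT.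
Proof.
move=> oA oAc A0; apply: (@surface_connected _ X) => //.
  by exists A => //; rewrite setTI.
by exists A; rewrite ?setTI //; rewrite -[A]setCK; exact: open_closedC.
Qed.

(** The identity theorem: the points near which [F] vanishes form an open set, and so do the others,
    around which [F] has order 0 except at the point itself. *)
Lemma null_dich F : (forall p, exists k, ord_ge F p k) -> null F \/ exact F.
Proof.
move=> oF; pose A := [set p | \forall q \near p^', F q = 0].
have nA p : ~ A p -> exists k, has_ord F p k.
  by move=> np; have [k /ord_dich [//|[l _ o]]] := oF p; exists l.
have [[p Ap]|A0] := pselect (exists p, A p); last first.
  by right => p; apply: nA => Ap; apply: A0; exists p.
left; suff : A = setT by move=> AT q; have : A q by rewrite AT.
apply: connected_clopen; last by exists p.
- by rewrite openE => q /near_pnear.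
- rewrite openE => q /nA [k o].
  have H := has_ord_near o.
  have K : \forall y \near q, y != q -> has_ord F y 0 by exact: H.
  apply: filterS K => y h; have [->|/h oy] := eqVneq y q; [exact: has_ord_not0 o|exact: has_ord_not0 oy].
Qed.

Definition ordf F p : int := xget 0 [set k | has_ord F p k].

Lemma ordfE F p k : has_ord F p k -> ordf F p = k.
Proof.
move=> o; rewrite /ordf; case: xgetP => [l _ /= ol|/(_ k)//].
exact: has_ord_uniq ol o.
Qed.

Definition posz (k : int) : nat := if k is Posz n then n else 0%N.

Definition zn F p : nat := posz (ordf F p).

Lemma znE F p k : has_ord F p k -> zn F p = posz k.
Proof. by move=> o; rewrite /zn (ordfE o). Qed.

(** This is [local_count] in a chart, completed at poles, where small [w] produce no zero nearby. *)
Lemma local_zn F p k (A : set X) : has_ord F p k -> nbhs p A ->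
  exists V : set X, [/\ nbhs p V, V `<=` A & exists2 d : R, 0 < d &
    forall w, nrm w < d -> exists s : seq X, [/\ size s = zn F p,
      forall a, a \in s -> V a &
      forall b, V b -> zn (fun q => F q - w) b = count_mem b s]].
Proof.
move=> o pA; rewrite (znE o); have ip := dom_ch p; set i := ch p in ip.
have := o; rewrite /has_ord -/i; set c := chart i p => oc.
case: k o oc => [e|n] o oc.
  have [g [hg gc] gE] := oc.
  pose f z := (z - c) ^+ e * g z.
  have hf : hol f c by exact: holM (holX e (hol_subc c c)) hg.
  have of_ : mord f c e%:Z by exists g => //; apply: filterS (pnear_neq c).
  have Ff : \forall z \near c^', F (chartV i z) = f z by exact: gE.
  pose AC := [set z | [/\ dom i (chartV i z) /\ chart i (chartV i z) = z,
     A (chartV i z) & \forall y \near z^', F (chartV i y) = f y]].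
  have nAC : nbhs c AC.
    by apply: filterS3 (near_image ip) (near_chartV ip pA) (pnear_pnear Ff).
  have [V [cV VA [d d0 dP]]] := local_count hf of_ nAC.
  exists [set q | dom i q /\ V (chart i q)]; split.
  - exact: near_chart.
  - by move=> q [iq /VA [_ + _]]; rewrite chartK.
  exists d => // w /dP [s [ss sV os]].
  exists (map (chartV i) s); split; first by rewrite size_map.
    move=> a /mapP [z zs ->]; have Vz := sV _ zs; have [[iz zE] _ _] := VA _ Vz.
    by split; [exact: iz|rewrite zE].
  move=> b [ib Vb]; have [_ _ bE] := VA _ Vb.
  have ob : has_ord (fun q => F q - w) b (count_mem (chart i b) s)%:Z.
    apply/(has_ordP _ _ ib); apply: eq_mord (os _ Vb).
    by apply: filterS bE => y ->.
  rewrite (znE ob) /= count_map; apply: eq_in_count => z zs /=.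
  have [[iz zE] _ _] := VA _ (sV _ zs).
  apply/eqP/eqP => [->|<-]; first by rewrite chartK.
  by rewrite zE.
(* Close to a pole [F] exceeds 1 in modulus, hence avoids every [w] with [nrm w < 1]. *)
have big : \forall z \near c^', nrm (F (chartV i z))^-1 < 1.
  have [g [hg gc] gE] := mordV oc.
  pose f z := (z - c) ^+ n.+1 * g z.
  have hf : hol f c by exact: holM (holX n.+1 (hol_subc c c)) hg.
  have fc : f c = 0 by rewrite /f subrr expr0n mul0r.
  have H : \forall z \near c, nrm (f z - f c) < 1.
    exact: (hol_cts hf (near_nrm _ ltr01)).
  apply: filterS2 gE (pnear_near H) => z ->.
  by rewrite fc subr0 NegzE opprK.
have N : \forall z \near c^', [/\ nrm (F (chartV i z))^-1 < 1,
    hol (fun z => F (chartV i z)) z & F (chartV i z) != 0].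
  apply: filterS3 big (mge_hol_near (mord_mge oc)) (mord_neq0 oc).
  by [].
have N' := pnear_chart ip N.
have {N'} N' : \forall q \near p, q != p -> dom i q /\ [/\ nrm (F (chartV i (chart i q)))^-1 < 1,
    hol (fun z => F (chartV i z)) (chart i q) & F (chartV i (chart i q)) != 0] by exact: N'.
exists (A `&` [set q | q != p -> dom i q /\ [/\ nrm (F (chartV i (chart i q)))^-1 < 1,
    hol (fun z => F (chartV i z)) (chart i q) & F (chartV i (chart i q)) != 0]]); split.
- exact: filterI.
- by move=> q [].
exists 1 => // w w1; exists [::]; split=> // b [_ bP].
have [bp|bp] := eqVneq b p.
  have H := mord_dom oc (hol_mge (hol_cst (- w) c)) (isT : Negz n < 0).
  have ob : has_ord (fun q => F q - w) b (Negz n) by rewrite bp.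
  by rewrite (znE ob).
have [ib [b1 hb b0]] := bP bp.
have ob : has_ord (fun q => F q - w) b 0.
  apply/(has_ordP _ _ ib); apply: hol_mord; first exact: holB hb (hol_cst _ _).
  rewrite subr_eq0; apply/eqP => bw; move: b1 b0; rewrite bw nrmV => h w0.
  have w00 : 0 < nrm w by rewrite nrm_gt0.
  by move: h; rewrite invf_lt1 //; lra.
by rewrite (znE ob).
Qed.

(* F has n zeros counted with multiplicity. *)
Definition zc F n := exists2 s : seq X, size s = n & forall p, count_mem p s = zn F p.

Lemma zc_uniq F m n : zc F m -> zc F n -> m = n.
Proof.
move=> [s <- sF] [t <- tF]; apply: perm_size; apply/permP => a.
apply/permP; apply/allP => p _ /=; apply/eqP; by rewrite sF tF.
Qed.

Hypothesis cX : compact [set: X].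

Lemma finite_ord F : exact F -> exists s : seq X, forall p, zn F p != 0%N -> p \in s.
Proof.
move=> eF; have [|s sP] := @finite_isolated X setT [set p | zn F p != 0%N] cX.
  move=> p _; have [k /has_ord_near o] := eF p.
  have H : \forall q \near p, q != p -> has_ord F q 0 by exact: o.
  by apply: filterS H => q h /h oq; rewrite /= (znE oq).
by exists s => p; exact: sP.
Qed.

Lemma zc_exists F : exact F -> exists n, zc F n.
Proof.
move=> /finite_ord [s sP].
exists (size (flatten [seq nseq (zn F p) p | p <- undup s])).
exists (flatten [seq nseq (zn F p) p | p <- undup s]) => // p.
rewrite count_flatten_nseq ?undup_uniq // mem_undup.
by case: ifPn => // ps; apply/esym/eqP; apply: contraNT ps => /sP.
Qed.

Lemma separate (us : seq X) : exists D : X -> set X,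
  (forall p, p \in us -> nbhs p (D p)) /\
  (forall p q, p \in us -> q \in us -> p != q -> forall a, D p a -> D q a -> False).
Proof.
have H (pq : X * X) : exists V : set X * set X, pq.1 != pq.2 ->
    [/\ nbhs pq.1 V.1, nbhs pq.2 V.2 & forall a, V.1 a -> V.2 a -> False].
  case: pq => p q /=.
  have [->|pq] := eqVneq p q; first by exists (setT, setT).
  have := @surface_hausdorff _ X; rewrite open_hausdorff => /(_ p q pq).
  move=> [[A B] /= [pA qB] [oA oB AB]]; exists (A, B) => _ /=; split.
  - by move: oA; rewrite openE => /(_ p); apply; exact: set_mem.
  - by move: oB; rewrite openE => /(_ q); apply; exact: set_mem.
  - move=> a Aa Ba; have : (A `&` B) a by [].
    by move/eqP : AB => ->.
have [U HU] := choice H.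
exists (fun p => [set a | forall q, q \in us -> q != p -> (U (p, q)).1 a /\ (U (q, p)).2 a]).
split.
  move=> p pus; apply: (@near_all_seq X X us p
    (fun q => [set a | q != p -> (U (p, q)).1 a /\ (U (q, p)).2 a])) => q qus.
  have [->|qp] := eqVneq q p; first by apply: nearW.
  have [h1 _ _] := HU (p, q) ltac:(by rewrite eq_sym).
  have [_ h2 _] := HU (q, p) qp.
  by apply: filterS2 h1 h2.
move=> p q pus qus pq a /(_ q qus) h1 /(_ p pus pq) h2.
have [_ _ H2] := HU (p, q) pq.
by apply: (H2 a); [case: h1 => //; rewrite eq_sym|case: h2].
Qed.

(** Disjoint neighbourhoods of the zeros of [F] keep their counts by [local_zn]; on the compact
    remainder no zero appears for small [w], again by [local_zn] and near-covering. *)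
Lemma zc_local F n : exact F -> zc F n ->
  \forall w \near (0 : C), zc (fun q => F q - w) n.
Proof.
move=> eF [s0 <- s0P].
pose us := undup s0.
have uus : uniq us by exact: undup_uniq.
have usP p : zn F p != 0%N -> p \in us.
  by move=> zp; rewrite mem_undup -has_pred1 has_count s0P lt0n.
have szE : size s0 = size (flatten [seq nseq (zn F p) p | p <- us]).
  apply: perm_size; apply/permP => a; apply/permP; apply/allP => p _ /=; apply/eqP.
  rewrite count_flatten_nseq // s0P; case: ifPn => // ps.
  by apply/eqP; apply: contraNT ps => /usP.
have [D [Dn Dd]] := separate us.
have loc p : exists Vd : set X * R, p \in us -> [/\ nbhs p Vd.1, Vd.1 `<=` D p, 0 < Vd.2 &
    forall w, nrm w < Vd.2 -> exists s : seq X, [/\ size s = zn F p,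
      forall a, a \in s -> Vd.1 a &
      forall b, Vd.1 b -> zn (fun q => F q - w) b = count_mem b s]].
  have [pus|] := boolP (p \in us); last by exists (setT, 1).
  have [k o] := eF p; have [V [h1 h2 [d d0 h3]]] := local_zn o (Dn p pus).
  by exists (V, d).
have [Vd VdP] := choice loc.
(* Interiors are taken so that [W] is open and its complement compact, whatever the neighbourhoods
   supplied by [local_zn]. *)
pose W : set X := [set q | exists2 p, p \in us & nbhs q (Vd p).1].
have oW : open W.
  rewrite openE => q [p pus qV]; apply: filterS (nbhs_near qV) => y yV.
  by exists p.
have cK : compact (~` W).
  apply: (subclosed_compact _ cX) => //; exact: open_closedC.
have HK : \forall w \near (0 : C), ~` W `<=` [set q | zn (fun q => F q - w) q = 0%N].
  have := iffLR (compact_near_coveringP _) cK C (nbhs (0 : C))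
     (fun w q => zn (fun q => F q - w) q = 0%N) _.
  apply=> q nW; have z0 : zn F q = 0%N.
    apply/eqP; apply: contrapT => /negP /usP qus; apply: nW; exists q => //.
    by have [] := VdP _ qus.
  have [k o] := eF q; have [V [h1 _ [d d0 h3]]] := local_zn o (@filterT _ (nbhs q) _).
  exists (V, [set w | nrm w < d]).
    split; first exact: h1.
    by apply/nbhs_nrmP; exists d => // y; rewrite subr0.
  move=> [b w] /= [Vb wd]; have [s [ss _ sP]] := h3 _ wd.
  rewrite sP //; move: ss; rewrite z0 => /size0nil ->.
  by [].
have Hd : \forall w \near (0 : C), forall p, p \in us -> nrm w < (Vd p).2.
  apply: (@near_all_seq C X us 0 (fun p => [set w | nrm w < (Vd p).2])) => p pus.
  have [_ _ d0 _] := VdP _ pus.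
  by apply/nbhs_nrmP; exists (Vd p).2 => // y; rewrite subr0.
apply: filterS2 HK Hd => w wK wd.
have sel p : exists s : seq X, p \in us -> [/\ size s = zn F p,
      forall a, a \in s -> (Vd p).1 a &
      forall b, (Vd p).1 b -> zn (fun q => F q - w) b = count_mem b s].
  have [pus|] := boolP (p \in us); last by exists [::].
  have [_ _ _ h] := VdP _ pus; have [s sP] := h w (wd p pus).
  by exists s.
have [m mP] := choice sel.
exists (flatten [seq m p | p <- us]).
  rewrite szE; apply: size_flatten_map => p pus.
  by rewrite size_nseq; have [] := mP _ pus.
move=> b; have [[p pus Vb]|nV] := pselect (exists2 p, p \in us & (Vd p).1 b).
  have [_ _ ->//] := mP _ pus.
  apply: (count_flatten_disjoint uus (D := fun p => (Vd p).1)) => //.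
    by move=> q a qus; have [_ h _] := mP _ qus; exact: h.
  move=> q r qus rus qr a qa ra.
  have [_ qD _ _] := VdP _ qus; have [_ rD _ _] := VdP _ rus.
  exact: Dd qus rus qr a (qD _ qa) (rD _ ra).
have bW : (~` W) b by move=> [p pus bV]; apply: nV; exists p => //; exact: nbhs_singleton bV.
rewrite (wK _ bW); apply/count_memPn/negP => /flatten_mapP [p pus bp].
by apply: nV; exists p => //; have [_ h _] := mP _ pus; exact: h.
Qed.

End CountSurface.

(** * Equality of zeros and poles, and divisors *)

Section Degree.
Variable R : realType.
Variable X : riemannSurface R.
Local Notation C := (Cplx R).
Implicit Types (p q : X) (F G : X -> C) (k l : int) (z w c : C) (zs ps : seq X).
Hypothesis cX : compact [set: X].

(** Along the real line [t |-> t * w] the count is locally constant by [zc_local], so the set of [t]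
    with count [n] is open and closed; it contains 0. *)
Lemma zc_const F n : (forall w, exact (fun q => F q - w)) -> zc F n ->
  forall w, zc (fun q => F q - w) n.
Proof.
move=> eF zF w.
pose A := [set t : R | zc (fun q => F q - t%:C%C * w) n].
have loc t m : zc (fun q => F q - t%:C%C * w) m ->
    \forall t' \near t, zc (fun q => F q - t'%:C%C * w) m.
  move=> zt; have /nbhs_nrmP [d d0 dP] := zc_local cX (eF _) zt.
  have w1 : 0 < nrm w + 1 by rewrite ltr_wpDl ?nrm_ge0.
  have dw : 0 < d / (nrm w + 1) by rewrite divr_gt0.
  have H : \forall t' \near t, `|t - t'| < d / (nrm w + 1) by apply: (@cvgr_dist_lt _ _ _ (nbhs t) _ id t).
  apply: filterS H => t' tt'.
  have := dP ((t' - t)%:C%C * w); rewrite subr0 nrmM nrmR distrC.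
  have -> : (fun q => F q - t%:C%C * w - (t' - t)%:C%C * w) = (fun q => F q - t'%:C%C * w).
    by apply/funext => q; rewrite rmorphB /=; ring.
  apply; move: tt'; rewrite ltr_pdivlMr //; apply: le_lt_trans.
  by rewrite ler_wpM2l //; lra.
have oA : open A by rewrite openE => t /loc.
have oAc : open (~` A).
  rewrite openE => t nA; have [m zm] := zc_exists cX (eF (t%:C%C * w)).
  apply: filterS (loc _ _ zm) => t' zt' At'; apply: nA.
  by rewrite /A /= (zc_uniq At' zt').
have cR : connected [set: R] by apply/connected_intervalP.
have AT : A = setT.
  apply: cR.
  - exists 0; rewrite /A /= rmorph0 mul0r.
    by have -> : (fun q => F q - 0) = F by apply/funext => q; rewrite subr0.
  - by exists A => //; rewrite setTI.
  - by exists A; rewrite ?setTI //; rewrite -[A]setCK; exact: open_closedC.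
have : A 1 by rewrite AT.
by rewrite /A /= rmorph1 mul1r.
Qed.

Lemma exact_inv F : exact F -> exact (fun q => (F q)^-1).
Proof. by move=> eF p; have [k o] := eF p; exists (- k); exact: has_ordV. Qed.

Lemma has_ord_dom F G p k l : has_ord F p k -> ord_ge G p l -> k < l ->
  has_ord (fun q => F q + G q) p k.
Proof. exact: mord_dom. Qed.

Lemma exact_sub F : exact F -> (exists2 w, w != 0 & null (fun q => F q - w)) \/
  forall w, exact (fun q => F q - w).
Proof.
move=> eF; have [[w nw]|H] := pselect (exists w, null (fun q => F q - w)).
  left; exists w => //; apply/eqP => w0.
  have [p _] := @surface_nonempty _ X; have [k o] := eF p.
  apply: (has_ord_not0 o); apply: filterS (nw p) => q.
  by rewrite w0 subr0.
right => w; have [|n|//] := @null_dich _ _ (fun q => F q - w); last by case: H; exists w.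
move=> p; have [k /has_ord_ge o] := eF p; exists (Num.min k 0).
apply: ord_geB; first by apply: ord_ge_le o; rewrite ge_min lexx.
by apply: ord_ge_le (ord_ge_cst w p); rewrite ge_min lexx orbT.
Qed.

Lemma zc_inv F n m : exact F -> zc F n -> zc (fun q => (F q)^-1) m -> n = m.
Proof.
move=> eF zF zV; have [[w w0 nw]|eFw] := exact_sub eF.
  have oF p : has_ord F p 0.
    apply: eq_has_ord (has_ord_cst p w0); apply: filterS (nw p) => q /eqP.
    by rewrite subr_eq0 => /eqP ->.
  have [s <- sP] := zF; have [t <- tP] := zV.
  have s0 p : count_mem p s = 0%N by rewrite sP (znE (oF p)).
  have t0 p : count_mem p t = 0%N.
    by rewrite tP (znE (has_ordV (oF p))).
  apply: perm_size; apply/permP => a; apply/permP; apply/allP => p _ /=.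
  by rewrite s0 t0.
(* For [1 / F] a small nonzero [w] is enough; the value [w^-1] of [F] is then large and is reached
   by [zc_const]. *)
have /nbhs_nrmP [d d0 dP] := zc_local cX (exact_inv eF) zV.
pose w : C := (d / 2)%:C%C.
have wn : nrm w = d / 2 by rewrite nrmR gtr0_norm // divr_gt0.
have w0 : w != 0 by rewrite -nrm_gt0 wn divr_gt0.
have zw : zc (fun q => (F q)^-1 - w) m by apply: dP; rewrite subr0 wn; lra.
have zF' := zc_const eFw zF w^-1.
apply: zc_uniq zF' _; have [s ss sP] := zw; exists s => // p; rewrite sP.
have [k o] := eF p.
have ow v : v != 0 -> has_ord (fun=> - v) p 0.
  by move=> v0; apply: has_ord_cst; rewrite oppr_eq0.
have oV := has_ordV o.
have Vw0 : w^-1 != 0 by rewrite invr_eq0.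
(* At zeros and poles of [F] neither function has a zero; elsewhere they differ by the factor
   [- w / F], of order 0. *)
have [k0|k0|k0] := ltgtP k 0.
- have o1 := has_ord_dom o (has_ord_ge (ow _ Vw0)) k0.
  have o2 : has_ord (fun q => (F q)^-1 - w) p 0.
    apply: eq_has_ord (has_ord_dom (ow _ w0) (has_ord_ge oV) _); last by rewrite oppr_gt0.
    by apply: filterS (has_ord_neq0 o) => q _; rewrite addrC.
  by rewrite (znE o1) (znE o2); case: k k0 {o o1 oV}.
- have o1 : has_ord (fun q => F q - w^-1) p 0.
    apply: eq_has_ord (has_ord_dom (ow _ Vw0) (has_ord_ge o) k0).
    by apply: filterS (has_ord_neq0 o) => q _; rewrite addrC.
  have o2 : has_ord (fun q => (F q)^-1 - w) p (- k).
    by apply: has_ord_dom oV (has_ord_ge (ow _ w0)) _; rewrite oppr_lt0.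
  by rewrite (znE o1) (znE o2); case: k k0 {o o1 o2 oV} => // -[].
- subst k; have [l ol] := eFw w^-1 p.
  have o2 : has_ord (fun q => (F q)^-1 - w) p l.
    have := has_ordM (ow _ w0) (has_ordM ol oV); rewrite oppr0 addr0 add0r.
    apply: eq_has_ord; apply: filterS (has_ord_neq0 o) => q Fq.
    by rewrite mulrBl divff // mulrBr mulr1 mulrA mulNr divff // mulN1r opprK addrC.
  by rewrite (znE ol) (znE o2).
Qed.

(* Divisors are differences of lists of points: zeros minus poles. *)
Definition dv zs ps p : int := (count_mem p zs)%:Z - (count_mem p ps)%:Z.

Definition divge F zs ps := forall p, ord_ge F p (dv zs ps p).
Definition diveq F zs ps := forall p, has_ord F p (dv zs ps p).

Lemma size_count_le (T : eqType) (s t : seq T) :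
  (forall x, count_mem x s <= count_mem x t)%N -> (size s <= size t)%N.
Proof.
move=> /count_subseqP [u ut /perm_size ->]; exact: size_subseq.
Qed.

(** For a nonzero [F], the zeros of [F] together with [ps] contain [zs] together with the poles of
    [F]. As there are as many zeros as poles, [zs] would be no longer than [ps]. *)
Lemma divge_null F zs ps : divge F zs ps -> (size ps < size zs)%N -> null F.
Proof.
move=> dF szs; have [|//|eF] := @null_dich _ _ F; first by move=> p; exists (dv zs ps p).
exfalso; have [n zF] := zc_exists cX eF; have [m zV] := zc_exists cX (exact_inv eF).
have nm := zc_inv eF zF zV; have [s sn sP] := zF; have [t tm tP] := zV.
have : (size (zs ++ t) <= size (s ++ ps))%N.
  apply: size_count_le => p; rewrite !count_cat sP tP.
  have [k o] := eF p; rewrite (znE o) (znE (has_ordV o)).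
  have := has_ord_ge_le o (dF p); rewrite /dv.
  move: (count_mem p zs) (count_mem p ps) => a b.
  case: k {o} => [e|e] /=; first by case: e => [|e] /=; lia.
  by lia.
rewrite !size_cat sn tm nm; move: szs; lia.
Qed.

(** A point where the order exceeds the bound could be added to [zs], and [divge_null] would
    apply. *)
Lemma divge_exact F zs ps : divge F zs ps -> size zs = size ps ->
  null F \/ diveq F zs ps.
Proof.
move=> dF szE; have [|nF|eF] := @null_dich _ _ F; first by move=> p; exists (dv zs ps p).
  by left.
have [nF|nF] := pselect (null F); [by left|right => p].
have [k o] := eF p; have := has_ord_ge_le o (dF p); rewrite le_eqVlt => /predU1P [->//|kl].
exfalso; apply: nF; apply: (@divge_null F (p :: zs) ps); last by rewrite /= szE.
move=> q; have [<-|pq] := eqVneq p q.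
  apply: ord_ge_le (has_ord_ge o); move: kl; rewrite /dv /= eqxx; lia.
by have := dF q; rewrite /dv /= (negPf pq) add0n.
Qed.

(** Subtracting the value at one point creates a zero with no pole to balance it. *)
Lemma divge_const F : divge F [::] [::] -> exists c, null (fun q => F q - c).
Proof.
move=> dF; have [p0 _] := @surface_nonempty _ X.
have d0 p : ord_ge F p 0 by have := dF p; rewrite /dv /= subrr.
have [v ov _] := ord_val (d0 p0).
suff H : divge (fun q => F q - v) [:: p0] [::].
  by exists v; exact: (divge_null H isT).
move=> q; rewrite /dv /= addn0 subr0.
have [<-|pq] := eqVneq p0 q; first exact: ov.
exact: ord_geB (d0 q) (ord_ge_cst v q).
Qed.

End Degree.

(** * Covers of the sphere *)

Section SurfaceMaps.
Variable R : realType.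
Local Notation C := (Cplx R).
Implicit Types (z w c : C).

(** One pair of charts at each point suffices; transition maps carry differentiability to all
    others. *)
Lemma holomorphic_local (X Y : riemannSurface R) (f : X -> Y) :
  (forall p, exists i j, exists e : C -> C, [/\ dom i p, dom j (f p),
     \forall q \near p, f q = chartV j (e (chart i q)),
     cdiff e (chart i p) & e (chart i p) = chart j (f p)]) -> holomorphic f.
Proof.
move=> Hf; split.
  move=> p; have [i [j [e [ip jp fE de eE]]]] := Hf p.
  move=> U fU; have H1 : nbhs (chartV j (e (chart i p))) U by rewrite eE chartK.
  have H2 : \forall z \near e (chart i p), U (chartV j z).
    rewrite eE in H1 *; exact: (@chartV_continuous _ _ _ _ jp _ H1).
  have H3 : \forall z \near chart i p, U (chartV j (e z)) by exact: (cdiff_cts de H2).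
  have H4 : \forall q \near p, U (chartV j (e (chart i q))).
    exact: (@chart_continuous _ _ _ _ ip _ H3).
  have H5 : \forall q \near p, U (f q) by apply: filterS2 fE H4 => q ->.
  exact: H5.
move=> i' j' p ip' jp'; have [i [j [e [ip jp fE de eE]]]] := Hf p.
apply/cdiffP.
have E1 := transE i ip'.
have d1 : cdiff (fun z => e (trans i' i z)) (chart i' p).
  by apply: cdiff_comp; [exact: hol_cdiff (hol_trans ip' ip)|rewrite E1].
have d2 : cdiff (fun z => trans j j' (e (trans i' i z))) (chart i' p).
  apply: (@cdiff_comp _ (fun z => e (trans i' i z)) (trans j j') _ d1).
  by rewrite E1 eE; exact: hol_cdiff (hol_trans jp jp').
apply: eq_cdiff d2; apply: filterS (near_chartV ip' fE) => z zE.
by rewrite /local_expr /= zE.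
Qed.

Lemma holomorphic_comp (X Y Z : riemannSurface R) (f : X -> Y) (h : Y -> Z) :
  holomorphic f -> holomorphic h -> holomorphic (h \o f).
Proof.
move=> [cf df] [ch' dh]; split.
  by move=> p; apply: continuous_comp; [exact: cf|exact: ch'].
move=> i k p ip kp; apply/cdiffP; have jp := dom_ch (f p); set j := ch (f p) in jp.
have E : local_expr f i j (chart i p) = chart j (f p) by rewrite /local_expr /= chartK.
have d1 : cdiff (local_expr f i j) (chart i p) by apply/cdiffP; exact: df.
have d2 : cdiff (local_expr h j k) (local_expr f i j (chart i p)).
  by rewrite E; apply/cdiffP; exact: dh.
apply: eq_cdiff (cdiff_comp d1 d2).
have H : \forall q \near p, dom j (f q) by exact: (cf p _ (near_dom jp)).
apply: filterS (near_chartV ip H) => z jz.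
by rewrite /local_expr /= chartK.
Qed.

Lemma antihol_hol_comp (X Y Z : riemannSurface R) (f : X -> Y) (h : Y -> Z) :
  holomorphic f -> antiholomorphic h -> antiholomorphic (h \o f).
Proof.
move=> [cf df] [ch' dh]; split.
  by move=> p; apply: continuous_comp; [exact: cf|exact: ch'].
move=> i k p ip kp; apply/cdiffP; have jp := dom_ch (f p); set j := ch (f p) in jp.
have E : local_expr f i j (chart i p) = chart j (f p) by rewrite /local_expr /= chartK.
have d1 : cdiff (local_expr f i j) (chart i p) by apply/cdiffP; exact: df.
have d2 : cdiff (fun z => (local_expr h j k z)^*) (local_expr f i j (chart i p)).
  by rewrite E; apply/cdiffP; exact: dh.
apply: eq_cdiff (cdiff_comp d1 d2).
have H : \forall q \near p, dom j (f q) by exact: (cf p _ (near_dom jp)).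
apply: filterS (near_chartV ip H) => z jz.
by rewrite /local_expr /= chartK.
Qed.

Lemma hol_antihol_comp (X Y Z : riemannSurface R) (f : X -> Y) (h : Y -> Z) :
  antiholomorphic f -> holomorphic h -> antiholomorphic (h \o f).
Proof.
move=> [cf df] [ch' dh]; split.
  by move=> p; apply: continuous_comp; [exact: cf|exact: ch'].
move=> i k p ip kp; apply/cdiffP; have jp := dom_ch (f p); set j := ch (f p) in jp.
have E : local_expr f i j (chart i p) = chart j (f p) by rewrite /local_expr /= chartK.
have d1 : cdiff (fun z => (local_expr f i j z)^*) (chart i p) by apply/cdiffP; exact: df.
have d2 : cdiff (fun z => (local_expr h j k z^*)^*) ((local_expr f i j (chart i p))^*).
  apply: cder_cdiff; apply: cder_conj; rewrite E; apply: cdiff_cder.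
  by apply/cdiffP; exact: dh.
apply: eq_cdiff (cdiff_comp d1 d2).
have H : \forall q \near p, dom j (f q) by exact: (cf p _ (near_dom jp)).
apply: filterS (near_chartV ip H) => z jz.
by rewrite conjCK /local_expr /= chartK.
Qed.

Local Notation CP1 := (CP1 R).

Definition mobJ (p : CP1) : CP1 :=
  if p is Some z then (if z == 0 then None else Some z^-1) else Some 0.

Definition mobT (a b : C) (p : CP1) : CP1 :=
  if p is Some z then Some (a * z + b) else None.

Definition mobK (p : CP1) : CP1 := if p is Some z then Some z^* else None.

Lemma mobJK : involutive mobJ.
Proof.
move=> [z|] /=; rewrite ?eqxx //; case: eqVneq => [->//|z0] /=.
by rewrite invr_eq0 (negPf z0) invrK.
Qed.

Lemma mobKK : involutive mobK.
Proof. by move=> [z|] //=; rewrite conjCK. Qed.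

Lemma mobTK a b : a != 0 -> cancel (mobT a b) (mobT a^-1 (- (a^-1 * b))).
Proof. by move=> a0 [z|] //=; rewrite mulrDr mulKf // addrK. Qed.

Lemma mobTVK a b : a != 0 -> cancel (mobT a^-1 (- (a^-1 * b))) (mobT a b).
Proof. by move=> a0 [z|] //=; rewrite mulrDr mulVKf // mulrN mulVKf // subrK. Qed.

Lemma sphere_chartVK b z : sphere_chart b (sphere_chartV b z) = z.
Proof.
case: b => //=; rewrite /sphere_chartV; case: eqVneq => [->//|z0] /=.
by rewrite invrK.
Qed.

Lemma sphere_domV b z : sphere_dom b (sphere_chartV b z).
Proof.
case: b; last by [].
rewrite /sphere_chartV /sphere_dom; case: (eqVneq z 0) => [_|z0]; first by [].
by apply/eqP => -[/eqP]; rewrite invr_eq0 (negPf z0).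
Qed.

Lemma holomorphic_mobJ : holomorphic mobJ.
Proof.
apply: holomorphic_local => p; have [b pb] := sphere_dom_cover p.
(* Read from one chart of the sphere into the other, [1 / z] is the identity. *)
have E q : sphere_dom b q -> mobJ q = sphere_chartV (~~ b) (sphere_chart b q).
  case: b {pb} q => -[z|] /= z0; rewrite /sphere_chartV //.
    have z1 : z != 0 by apply: contraNneq z0 => ->.
    by rewrite (negPf z1).
have E' : sphere_dom (~~ b) (mobJ p).
  by rewrite E //; exact: sphere_domV.
exists b, (~~ b : chart_index CP1), (fun z => z); split.
- exact: pb.
- exact: E'.
- by apply: filterS (@near_dom _ CP1 b p pb) => q qb; exact: E.
- exact: cdiff_id.
- by rewrite (E p pb) /= sphere_chartVK.
Qed.

Lemma holomorphic_mobT a b : a != 0 -> holomorphic (mobT a b).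
Proof.
move=> a0; apply: holomorphic_local => -[z|].
  exists (false : chart_index CP1), (false : chart_index CP1), (fun w => a * w + b).
  split; [by []|by []| | |by []].
  - by apply: filterS (@near_dom _ CP1 false (Some z) _) => // -[w|].
  - by apply: cdiffD (cdiff_cst _ _); apply: cdiffM (cdiff_cst _ _) (cdiff_id _).
(* At infinity, with [w = 1 / z], the map [a z + b] becomes [w / (a + b w)]. *)
exists (true : chart_index CP1), (true : chart_index CP1), (fun w => w / (a + b * w)).
have hd : hol (fun w => a + b * w) 0.
  exact: holD (hol_cst a 0) (holM (hol_cst b 0) (hol_id 0)).
have n0 : (fun w => a + b * w) 0 != 0 by rewrite mulr0 addr0.
split; [by []|by []| | |by rewrite /= mul0r].
- have H := @near_chart _ CP1 true None _ (isT : sphere_dom true None) (cts_neq0 (hol_cts hd) n0).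
  apply: filterS H => -[w|] [/= dw]; last first.
    by rewrite /sphere_chartV mul0r eqxx.
  move=> h; rewrite /sphere_chartV; case: (eqVneq w 0) => [w0|w0].
    by rewrite w0 eqxx in dw.
  rewrite mulf_eq0 !invr_eq0 (negPf w0) (negPf h) /=; congr Some.
  by rewrite invf_div invrK mulrDl -mulrA mulVf // mulr1.
- exact: hol_cdiff (hol_div (hol_id 0) hd n0).
Qed.

Lemma antiholomorphic_mobK : antiholomorphic mobK.
Proof.
have E b q : sphere_dom b q -> mobK q = sphere_chartV b ((sphere_chart b q)^*).
  case: b q => -[z|] //= z0; rewrite /sphere_chartV //= ?rmorph0 ?eqxx //.
  have z1 : z != 0 by apply: contraNneq z0 => ->.
  by rewrite conjC_eq0 invr_eq0 (negPf z1) fmorphV invrK.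
have E2 b q : sphere_chart b (mobK q) = (sphere_chart b q)^*.
  by case: b q => -[z|] //=; rewrite ?fmorphV ?rmorph0.
split.
  move=> p; have [b pb] := sphere_dom_cover p.
  move=> U HU; have H1 : nbhs (sphere_chartV b ((sphere_chart b p)^*)) U by rewrite -(E b p pb).
  have H2 : \forall z \near (sphere_chart b p)^*, U (sphere_chartV b z).
    exact: (@sphere_chartV_continuous _ b _ _ H1).
  have H3 : \forall z \near sphere_chart b p, U (sphere_chartV b z^*).
    have /nbhs_nrmP [d d0 dP] := H2; apply/nbhs_nrmP; exists d => // z zd; apply: dP.
    by rewrite -rmorphB nrm_conj.
  have H4 : \forall q \near p, U (sphere_chartV b (sphere_chart b q)^*).
    exact: (@sphere_chart_continuous _ b p pb _ H3).
  have H5 : \forall q \near p, U (mobK q).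
    by apply: filterS2 (@near_dom _ CP1 b p pb) H4 => q qb; rewrite (E b q qb).
  exact: H5.
move=> i j p ip jp.
have jp' : sphere_dom j p.
  by move: jp; case: (j) (p) => -[z|] //= h; apply: contraNneq h => -[->]; rewrite rmorph0.
have -> : (fun z => (local_expr mobK i j z)^*) = chart j \o @chartV _ CP1 i.
  by apply/funext => z; rewrite /local_expr /= E2 conjCK.
exact: sphere_transition ip jp'.
Qed.

(** [t] satisfies [t (f p) = f (s p)]; as every point of the sphere is some [f p], it is an
    involution because [s] is. *)
Lemma real_structure_lift (X : riemannSurface R) (f : X -> CP1) (s : X -> X)
    (M N : CP1 -> CP1) (a b : C) : (forall w : CP1, exists p, f p = w) -> involutive s ->
  holomorphic M -> holomorphic N -> cancel M N -> cancel N M -> a != 0 ->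
  (forall p, mobK (M (f (s p))) = mobT a b (M (f p))) ->
  exists t : CP1 -> CP1, real_structure t /\ t \o f \o s = f.
Proof.
move=> sf sK hM hN MK NK a0 H.
pose t := N \o (mobK \o (mobT a b \o M)).
have tf p : t (f p) = f (s p) by rewrite /t /= -H mobKK MK.
exists t; split; last by apply/funext => p /=; rewrite tf sK.
split.
  have h1 := holomorphic_comp hM (holomorphic_mobT b a0).
  exact: (hol_antihol_comp (antihol_hol_comp h1 antiholomorphic_mobK) hN).
by move=> w; have [p <-] := sf w; rewrite tf tf sK.
Qed.

End SurfaceMaps.

(** * Multiplicities as orders *)

Section Multiplicity.
Variable R : realType.
Local Notation C := (Cplx R).

Lemma hol_local_expr (X Y : riemannSurface R) (f : X -> Y) i j p : holomorphic f ->
  dom i p -> dom j (f p) -> hol (local_expr f i j) (chart i p).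
Proof.
move=> [cf df] ip jp.
have H : \forall q \near p, dom j (f q) by exact: (cf p _ (near_dom jp)).
apply: filterS2 (near_chartV ip H) (near_image ip) => z jz [iz zE].
by apply/cdiffP; have := df _ _ _ iz jz; rewrite zE.
Qed.

(** The order is found in one target chart. Passing to another multiplies the difference of values
    by the unit [u] of the transition map, so one [e] serves all charts. *)
Lemma local_order (X Y : riemannSurface R) (f : X -> Y) p : holomorphic f ->
  ~ (\forall q \near p^', f q = f p) ->
  exists2 e : nat, (0 < e)%N & forall j, dom j (f p) ->
    has_ord (fun q => chart j (f q) - chart j (f p)) p e%:Z.
Proof.
move=> hf nf; have ip := dom_ch p; set i := ch p in ip.
have jp := dom_ch (f p); set j := ch (f p) in jp.
have hE := hol_local_expr hf ip jp.
have Ep : local_expr f i j (chart i p) = chart j (f p) by rewrite /local_expr /= chartK.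
have H0 : hol (fun z => local_expr f i j z - chart j (f p)) (chart i p).
  exact: holB hE (hol_cst _ _).
have near_j k : dom k (f p) -> \forall q \near p, dom k (f q).
  by move=> kp; exact: (hf.1 p _ (near_dom kp)).
have [F0|[e0 ee oe]] := mge_dich (hol_mge H0).
  exfalso; apply: nf; have G : \forall q \near p^', dom j (f q).
    by have := near_j j jp; apply: filterS.
  have K := pnear_chart ip F0.
  apply: filterS2 G K => q jq [iq /eqP]; rewrite subr_eq0 /local_expr /= chartK // => /eqP E.
  by rewrite -(chartK jq) E chartK.
case: e0 ee oe => // e _ oe.
have e0 : (0 < e)%N.
  by have := hol_mord_val H0 oe; rewrite Ep subrr eqxx lt0n => /esym ->.
exists e => // k kp; apply/(has_ordP _ _ ip).
have hk := hol_local_expr hf ip kp.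
have [u [hu uc] uE] := mord_trans jp kp.
have hu' : hol (fun z => u (local_expr f i j z)) (chart i p).
  by apply: hol_comp hE _; rewrite Ep.
have ou : mord (fun z => u (local_expr f i j z)) (chart i p) 0.
  by apply: hol_mord hu' _; rewrite Ep.
have oM := mordM oe ou; rewrite addr0 in oM; apply: eq_mord oM.
have uE' : \forall w \near chart j (f p), w != chart j (f p) ->
    trans j k w - trans j k (chart j (f p)) = (w - chart j (f p)) ^ 1%:Z * u w by exact: uE.
have N1 : \forall q \near p, chart j (f q) != chart j (f p) ->
    trans j k (chart j (f q)) - trans j k (chart j (f p)) =
      (chart j (f q) - chart j (f p)) ^ 1%:Z * u (chart j (f q)).
  have H : \forall w \near f p, chart j w != chart j (f p) ->
    trans j k (chart j w) - trans j k (chart j (f p)) =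
      (chart j w - chart j (f p)) ^ 1%:Z * u (chart j w).
    by apply: filterS (near_chart jp uE') => w [].
  exact: (hf.1 p _ H).
apply: pnear_near; apply: filterS2 (near_chartV ip N1) (near_chartV ip (near_j j jp)) => z zE jz.
rewrite /local_expr /= -(transE k jz) -(transE k jp).
have [->|zp] := eqVneq (chart j (f (chartV i z))) (chart j (f p)).
  by rewrite !subrr mul0r.
by rewrite zE // expr1z.
Qed.

Lemma is_multiplicity_uniq (X Y : riemannSurface R) (f : X -> Y) p m n :
  is_multiplicity f p m -> is_multiplicity f p n -> m = n.
Proof.
wlog mn : m n / (m <= n)%N.
  by move=> H hm hn; case: (leqP m n) => [mn|/ltnW nm]; [exact: H|apply/esym; exact: H].
move=> [m0 hm] [n0 hn]; have [//|mn'] := eqVneq m n.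
have [a1 _] := hm _ _ (dom_ch p) (dom_ch (f p)).
have [_ a2] := hn _ _ (dom_ch p) (dom_ch (f p)).
by move: a1; rewrite a2 ?eqxx // m0 ltn_neqAle mn' mn.
Qed.

Lemma is_multiplicity_order (X Y : riemannSurface R) (f : X -> Y) p (e : nat) :
  holomorphic f -> (0 < e)%N ->
  (forall j, dom j (f p) -> has_ord (fun q => chart j (f q) - chart j (f p)) p e%:Z) ->
  is_multiplicity f p e.
Proof.
move=> hf e0 oe; split=> // i j ip jp; case: e e0 oe => // e _ oe.
by have := derive1n_mord (hol_local_expr hf ip jp) (iffLR (has_ordP _ _ ip) (oe j jp)).
Qed.

Lemma multiplicityE (X Y : riemannSurface R) (f : X -> Y) p m :
  is_multiplicity f p m -> multiplicity f p = m.
Proof.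
move=> hm; rewrite /multiplicity; case: xgetP => [n _ /= hn|/(_ m)//].
exact: is_multiplicity_uniq hn hm.
Qed.

Lemma critical_multiplicity (X Y : riemannSurface R) (f : X -> Y) p m :
  is_multiplicity f p m -> critical_points f p -> (1 < m)%N.
Proof.
move=> [m0 hm] cp; rewrite ltn_neqAle m0 andbT; apply/eqP => E.
have [+ _] := hm _ _ (dom_ch p) (dom_ch (f p)).
by rewrite -E derive1n1 (cp _ _ (dom_ch p) (dom_ch (f p))) eqxx.
Qed.

End Multiplicity.

(** * Fibres as divisors *)

Section Cover.
Variable R : realType.
Variable X : riemannSurface R.
Local Notation C := (Cplx R).
Local Notation CP1 := (CP1 R).
Implicit Types (p q : X) (f phi : X -> CP1) (v : C).

Definition fin (w : CP1) : C := sphere_chart false w.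

(* At a pole of phi, fin takes the junk value 0; orders only see punctured
   neighbourhoods. *)
Definition is_cover phi (fib : CP1 -> seq X) d :=
  [/\ forall w, size (fib w) = d, forall w p, p \in fib w <-> phi p = w &
      forall v, diveq (fun q => fin (phi q) - v) (fib (Some v)) (fib None)].

(** Points are not isolated: otherwise the constant 1, which has order 0, would vanish on a
    punctured neighbourhood of [p]. *)
Lemma finite_fibre_near f p : finite_set (f @^-1` [set f p]) ->
  ~ (\forall q \near p^', f q = f p).
Proof.
move=> ff H; have fA : finite_set ((f @^-1` [set f p]) `\ p) by exact: finite_setD.
have cA : closed ((f @^-1` [set f p]) `\ p).
  have aX := hausdorff_accessible (@surface_hausdorff _ X).
  exact: (iffLR accessible_finite_set_closed aX _ fA).
have H2 : \forall q \near p, ~ ((f @^-1` [set f p]) `\ p) q.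
  by have := closed_openC cA; rewrite openE => /(_ p); apply; case => _; apply.
have H' : \forall q \near p, q != p -> f q = f p by exact: H.
have H3 : \forall q \near p^', (fun=> 1 : C) q = 0.
  have K : \forall q \near p, q != p -> (1 : C) = 0.
    by apply: filterS2 H' H2 => q h1 h2 qp; exfalso; apply: h2; split;
      [exact: h1|exact/eqP].
  exact: K.
exact: has_ord_not0 (has_ord_cst p (oner_neq0 C)) H3.
Qed.

Lemma finite_order f p : holomorphic f -> finite_set (f @^-1` [set f p]) ->
  [/\ (0 < multiplicity f p)%N,
      forall b, sphere_dom b (f p) ->
        has_ord (fun q => sphere_chart b (f q) - sphere_chart b (f p)) p (multiplicity f p)%:Z &
      critical_points f p -> (1 < multiplicity f p)%N].
Proof.
move=> hf ff; have [e e0 oe] := local_order hf (finite_fibre_near ff).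
have me := is_multiplicity_order hf e0 oe.
rewrite (multiplicityE me); split=> //; exact: critical_multiplicity me.
Qed.

Lemma fin_inv (w : CP1) : sphere_chart true w = (fin w)^-1.
Proof. by case: w => [z|] //=; rewrite invr0. Qed.

(** Each fibre is listed with its points repeated by multiplicity, so that the degree is a length
    and orders are counts. *)
Lemma degree_cover f d : holomorphic f -> has_degree f d ->
  exists2 fib, is_cover f fib d &
    forall p, critical_points f p -> (1 < count_mem p (fib (f p)))%N.
Proof.
move=> hf df.
pose fib w := flatten [seq nseq (multiplicity f p) p | p <- finmap.enum_fset (fset_set (f @^-1` [set w]))].
have fibc w p : count_mem p (fib w) = (if f p == w then multiplicity f p else 0)%N.
  rewrite count_flatten_nseq ?finmap.fset_uniq //; have [fw _] := df w.
  have -> : (p \in finmap.enum_fset (fset_set (f @^-1` [set w]))) = (f p == w); last by [].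
  rewrite -[LHS]/(p \in fset_set (f @^-1` [set w])) in_fset_set //.
  by apply/idP/eqP => [/set_mem|h]; [|exact/mem_set].
have fo p := finite_order hf (df (f p)).1.
exists fib; last by move=> p cp; rewrite fibc eqxx; have [_ _] := fo p; apply.
split.
- move=> w; have [fw <-] := df w; rewrite fsbig_finite //=.
  rewrite /fib size_flatten /shape -map_comp sumnE big_map.
  by apply: eq_bigr => p _; rewrite /= size_nseq.
- move=> w p; rewrite -has_pred1 has_count fibc; case: (eqVneq (f p) w) => [E|/eqP E]; last by split.
  by have [-> _ _] := fo p.
- move=> v p; rewrite /dv !fibc; have [m0 om _] := fo p.
  case E : (f p) => [u|].
    rewrite /= subr0; have := om false; rewrite E /= => /(_ isT) ou.
    have [[<-]|uv] := eqVneq (Some u : CP1) (Some v); first exact: ou.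
    have uv0 : u - v != 0 by rewrite subr_eq0; apply: contraNneq uv => ->.
    have o1 := has_ord_dom (has_ord_cst p uv0) (has_ord_ge ou) (m0 : 0 < (multiplicity f p)%:Z).
    have -> : (fun q => fin (f q) - v) = fun q => u - v + (fin (f q) - u); last exact: o1.
    by apply/funext => q; ring.
  rewrite /= sub0r; have := om true; rewrite E /= => /(_ isT) ou.
  have ov : has_ord (fun q => fin (f q)) p (- (multiplicity f p)%:Z).
    apply: eq_has_ord (has_ordV ou); apply: filterE => q.
    by rewrite subr0 fin_inv invrK.
  have h : - (multiplicity f p)%:Z < 0 by rewrite oppr_lt0.
  exact: has_ord_dom ov (ord_ge_cst (- v) p) h.
Qed.

End Cover.

(** * Orders under an antiholomorphic involution *)

Section Conjugation.
Variable R : realType.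
Local Notation C := (Cplx R).

Lemma mord_conj (f : C -> C) c k : mord f c k -> mord (fun z => (f z^*)^* : C) (c^* : C) k.
Proof.
move=> [g [hg gc] fg]; have [h hh fh] := mge_conj (mord_mge (ex_intro2 _ _ g (conj hg gc) fg)).
exists (fun z => (g z^*)^* : C); first by split; [exact: hol_conj|rewrite /= conjCK conjC_eq0].
have /nbhs_nrmP [d d0 dP] := fg; apply/nbhs_nrmP; exists d => // y yc yc'.
have h1 : nrm (y^* - c) < d by rewrite -nrm_conj rmorphB /= conjCK.
have h2 : y^* != c by apply: contra_neq yc' => <-; rewrite conjCK.
by rewrite (dP _ h1 h2) rmorphM /= conj_exprz rmorphB /= conjCK.
Qed.

Section RealSurface.
Variable X : riemannSurface R.
Variable s : X -> X.
Hypothesis rs : real_structure s.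
Implicit Types (p q : X) (G : X -> C) (k : int).

Let S i j z : C := (chart j (s (chartV i z)))^*.

Lemma hol_antihol_expr i j p : dom i p -> dom j (s p) -> hol (S i j) (chart i p).
Proof.
have [[cs ds] _] := rs => ip jp.
have H : \forall q \near p, dom j (s q) by exact: (cs p _ (near_dom jp)).
apply: filterS2 (near_chartV ip H) (near_image ip) => z jz [iz zE].
by apply/cdiffP; have := ds _ _ _ iz jz; rewrite zE.
Qed.

Lemma antihol_exprK i j p : dom i p -> dom j (s p) ->
  \forall z \near chart i p, (S j i (S i j z)^*)^* = z.
Proof.
have [[cs ds] sK] := rs => ip jp.
have H : \forall q \near p, dom j (s q) by exact: (cs p _ (near_dom jp)).
apply: filterS2 (near_chartV ip H) (near_image ip) => z jz [iz zE].
by rewrite /S !conjCK chartK // sK.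
Qed.

Lemma mord_antihol i j p : dom i p -> dom j (s p) ->
  mord (fun z => S i j z - S i j (chart i p)) (chart i p) 1.
Proof.
move=> ip jp; have h := hol_antihol_expr ip jp.
have sK : s (s p) = p by have [_] := rs; apply.
have jp' : dom i (s (s p)) by rewrite sK.
have h2 := hol_conj (hol_antihol_expr jp jp').
apply: simple_zero; first exact: (holB h (hol_cst _ _)).
  by rewrite subrr.
rewrite (derive1_subk _ (hol_cdiff h)).
have E0 : S i j (chart i p) = (chart j (s p))^* by rewrite /S chartK.
have d2 : cdiff (fun z => (S j i z^*)^*) (S i j (chart i p)).
  by rewrite E0; exact: hol_cdiff h2.
have E := derive1_compC (hol_cdiff h) d2.
have E1 : derive1 (fun z => (S j i (S i j z)^*)^*) (chart i p) = 1.
  rewrite -(derive1_var (chart i p)); exact: (eq_derive1 (antihol_exprK ip jp)).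
apply/eqP => d0; move: E; rewrite E1 d0 mulr0 => /eqP; by rewrite oner_eq0.
Qed.

(** In charts the new function is [w |-> conj (G (conj w))] after the map [S], which is holomorphic
    with nonzero derivative because [s] is an antiholomorphic involution. *)
Lemma has_ord_conj G p k : has_ord G (s p) k -> has_ord (fun q => (G (s q))^*) p k.
Proof.
move=> oG; have ip := dom_ch p; set i := ch p in ip.
have jp := dom_ch (s p); set j := ch (s p) in jp.
have [[cs _] _] := rs.
have H : \forall q \near p, dom j (s q) by exact: (cs p _ (near_dom jp)).
have o1 := mord_conj (iffLR (has_ordP _ _ jp) oG).
have E0 : (chart j (s p))^* = S i j (chart i p) by rewrite /S chartK.
rewrite E0 in o1.
have o2 := mord_comp o1 (hol_antihol_expr ip jp) (mord_antihol ip jp).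
apply/(has_ordP _ _ ip); apply: eq_mord o2; apply: pnear_near.
apply: filterS (near_chartV ip H) => z jz.
by rewrite /S conjCK chartK.
Qed.

End RealSurface.
End Conjugation.

(** * Covers composed with Moebius maps and with conjugation *)

Section Covers.
Variable R : realType.
Variable X : riemannSurface R.
Local Notation C := (Cplx R).
Local Notation CP1 := (CP1 R).
Implicit Types (p q : X) (phi psi : X -> CP1) (v : C) (w : CP1) (fib : CP1 -> seq X) (d : nat).

Lemma cover_neq phi fib d w p : is_cover phi fib d -> \forall q \near p^', phi q != w.
Proof.
move=> [_ _ dphi]; case: w => [v|].
  apply: filterS (has_ord_neq0 (dphi v p)) => q; apply: contraNneq => ->.
  by rewrite subrr.
apply: filterS (has_ord_neq0 (dphi 0 p)) => q; apply: contraNneq => ->.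
by rewrite subr0.
Qed.

Lemma cover_mobT phi fib d (a b : C) : a != 0 -> is_cover phi fib d ->
  is_cover (mobT a b \o phi) (fib \o mobT a^-1 (- (a^-1 * b))) d.
Proof.
move=> a0 cphi; have [sf mf dphi] := cphi; split.
- by move=> w; exact: sf.
- move=> w p; split => [/mf/= ->|<-]; first exact: mobTVK.
  by apply/mf; rewrite /= mobTK.
- move=> v p; have o := has_ordZ a0 (dphi (a^-1 * v - a^-1 * b) p).
  apply: eq_has_ord o; apply: filterS (cover_neq None p cphi) => q /=.
  case: (phi q) => [u|] // _; rewrite /fin /=.
  by rewrite !mulrBr !mulVKf //; ring.
Qed.

Lemma cover_mobJ phi fib d : is_cover phi fib d -> is_cover (mobJ (R := R) \o phi) (fib \o mobJ (R := R)) d.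
Proof.
move=> cphi; have [sf mf dphi] := cphi; split.
- by move=> w; exact: sf.
- move=> w p; split => [/mf/= ->|<-]; first exact: mobJK.
  by apply/mf; rewrite /= mobJK.
- move=> v p.
  have E q : fin (mobJ (phi q)) = (fin (phi q))^-1.
    case: (phi q) => [u|]; last by rewrite /fin /= invr0.
    by rewrite /fin /=; case: eqVneq => [->|] //=; rewrite invr0.
  have o0 := dphi 0 p; have [->|v0] := eqVneq v 0.
    have := has_ordV o0; rewrite /dv /= eqxx opprB; apply: eq_has_ord.
    by apply: filterE => q; rewrite !subr0 E.
  have v0' : - v != 0 by rewrite oppr_eq0.
  (* [1 / F - v = - v (F - 1 / v) / F], and the poles of [F] cancel from the divisor. *)
  have := has_ordM (has_ordZ v0' (dphi v^-1 p)) (has_ordV o0).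
  have -> : dv (fib (Some v^-1)) (fib None) p + - dv (fib (Some 0)) (fib None) p =
     dv ((fib \o mobJ (R:=R)) (Some v)) ((fib \o mobJ (R:=R)) None) p.
    by rewrite /dv /= (negPf v0); ring.
  apply: eq_has_ord; apply: filterS (has_ord_neq0 o0) => q; rewrite subr0 /= E => u0.
  by field; rewrite u0 v0.
Qed.

Lemma cover_conj phi fib d (s : X -> X) : real_structure s -> is_cover phi fib d ->
  is_cover (mobK (R := R) \o (phi \o s)) (fun w => map s (fib (mobK w))) d.
Proof.
move=> rs cphi; have [sf mf dphi] := cphi; have [_ sK] := rs.
have sI : injective s := inv_inj sK.
have E t p : count_mem p (map s t) = count_mem (s p) t.
  rewrite count_map; apply: eq_count => q /=.
  by rewrite -(inj_eq sI) sK.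
have M t p : (p \in map s t) = (s p \in t) by rewrite -{1}(sK p) mem_map.
split.
- by move=> w; rewrite size_map sf.
- move=> w p; rewrite M; split => [/mf/= ->|<-]; first exact: mobKK.
  by apply/mf; rewrite /= mobKK.
- move=> v p; rewrite /dv !E /=; have := has_ord_conj rs (dphi v^* (s p)).
  apply: eq_has_ord; apply: filterE => q /=.
  rewrite rmorphB /= conjCK; congr (_ - _).
  by case: (phi (s q)) => [u|] //=; rewrite /fin /= rmorph0.
Qed.

(** [null] says nothing about [p] itself, but it equates the divisors of [phi - v] and [psi - v],
    whose coefficient at [p] is positive exactly when the map takes the value [v] there. This
    recovers all values, infinity included. *)
Lemma eq_cover_sub phi psi fib fib' d d' : is_cover phi fib d -> is_cover psi fib' d' ->
  null (fun q => fin (phi q) - fin (psi q)) -> forall p, phi p = psi p.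
Proof.
move=> cphi cpsi nul p; have [_ m1 d1] := cphi; have [_ m2 d2] := cpsi.
have N v : \forall q \near p^', fin (phi q) - v = fin (psi q) - v.
  by apply: filterS (nul p) => q /eqP; rewrite subr_eq0 => /eqP ->.
have D v : dv (fib (Some v)) (fib None) p = dv (fib' (Some v)) (fib' None) p.
  by apply: has_ord_uniq (d2 v p); exact: eq_has_ord (N v) (d1 v p).
have P1 ph (fb : CP1 -> seq X) n w : is_cover ph fb n -> ph p = w -> exists m, count_mem p (fb w) = m.+1.
  move=> [_ m _] E; exists (count_mem p (fb w)).-1.
  by rewrite prednK // -has_count has_pred1; apply/m.
have P0 ph (fb : CP1 -> seq X) n w : is_cover ph fb n -> ph p <> w -> count_mem p (fb w) = 0%N.
  by move=> [_ m _] E; apply/count_memPn/negP => /m.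
case E : (psi p) => [v|].
  have E1 : psi p <> None by rewrite E.
  case E' : (phi p) => [u|].
    have [->//|uv] := eqVneq u v.
    have E2 : phi p <> Some v by rewrite E' => -[uE]; rewrite uE eqxx in uv.
    have := D v; rewrite /dv (P0 _ _ _ _ cphi E2) (P0 _ _ _ _ cpsi E1).
    by have [m ->] := P1 _ _ _ _ cpsi E => h; exfalso; move: h; rewrite subr0 sub0r; case: (count_mem p (fib None)).
  have E2 : phi p <> Some v by rewrite E'.
  have := D v; rewrite /dv (P0 _ _ _ _ cphi E2) (P0 _ _ _ _ cpsi E1).
  by have [m ->] := P1 _ _ _ _ cpsi E => h; exfalso; move: h; rewrite subr0 sub0r; case: (count_mem p (fib None)).
case E' : (phi p) => [v|] //.
have E1 : psi p <> Some v by rewrite E.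
have E2 : phi p <> None by rewrite E'.
have := D v; rewrite /dv (P0 _ _ _ _ cphi E2) (P0 _ _ _ _ cpsi E1).
by have [m ->] := P1 _ _ _ _ cpsi E => h; exfalso; move: h; rewrite subr0 sub0r; case: (count_mem p (fib None)).
Qed.

Lemma double_fibre (s : seq X) c : (1 < count_mem c s)%N ->
  exists t, perm_eq s [:: c, c & t].
Proof.
move=> h; have cs : c \in s by rewrite -has_pred1 has_count; apply: leq_trans h.
have p1 := perm_to_rem cs; have cs' : c \in rem c s.
  rewrite -has_pred1 has_count; have /permP := p1.
  by move=> /(_ (pred1 c)) E; rewrite E /= eqxx in h.
exists (rem c (rem c s)); apply: (perm_trans p1); rewrite perm_cons.
exact: perm_to_rem.
Qed.

Lemma eq_diveq (F : X -> C) zs ps zs' ps' : perm_eq zs zs' -> perm_eq ps ps' ->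
  diveq F zs ps -> diveq F zs' ps'.
Proof. by move=> /permP e1 /permP e2 H p; have := H p; rewrite /dv e1 e2. Qed.

End Covers.

(** * Functions with few poles *)

Section Divisors.
Variable R : realType.
Variable X : riemannSurface R.
Local Notation C := (Cplx R).
Implicit Types (p q c : X) (F G u v : X -> C) (k l : int) (zs ps : seq X) (t w : C).
Hypothesis cX : compact [set: X].

Lemma diveqM F G zs ps zs' ps' : diveq F zs ps -> diveq G zs' ps' ->
  diveq (fun q => F q * G q) (zs ++ zs') (ps ++ ps').
Proof.
move=> dF dG p; have := has_ordM (dF p) (dG p).
by rewrite /dv !count_cat !PoszD; congr has_ord; ring.
Qed.

Lemma diveqV F zs ps : diveq F zs ps -> diveq (fun q => (F q)^-1) ps zs.
Proof. by move=> dF p; have := has_ordV (dF p); rewrite /dv opprB. Qed.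

Lemma eq_diveq_fun F G zs ps : (forall p, \forall q \near p^', F q = G q) ->
  diveq F zs ps -> diveq G zs ps.
Proof. by move=> FG dF p; exact: eq_has_ord (FG p) (dF p). Qed.

Lemma diveq_dv F zs ps zs' ps' : (forall p, dv zs ps p = dv zs' ps' p) ->
  diveq F zs ps -> diveq F zs' ps'.
Proof. by move=> E dF p; rewrite -E. Qed.

Lemma diveq_neq0 F zs ps p : diveq F zs ps -> \forall q \near p^', F q != 0.
Proof. by move=> dF; exact: has_ord_neq0 (dF p). Qed.

Lemma diveq_ratio F G zs ps zs' ps' : (forall p, dv zs ps p = dv zs' ps' p) ->
  diveq F zs ps -> diveq G zs' ps' -> exists2 t, t != 0 & null (fun q => G q - t * F q).
Proof.
move=> E dF dG; have dQ : diveq (fun q => G q / F q) [::] [::].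
  by move=> p; have := has_ordM (dG p) (has_ordV (dF p)); rewrite E subrr.
have [t tP] := divge_const cX (fun p => has_ord_ge (dQ p)).
exists t.
  apply/eqP => t0; have [p _] := @surface_nonempty _ X.
  apply: (has_ord_not0 (dQ p)); apply: filterS (tP p) => q; by rewrite t0 subr0.
move=> p; have tp := tP p; have np := diveq_neq0 p dF; apply: filterS2 tp np => q /eqP.
by rewrite subr_eq0 => /eqP tE Fq; rewrite -tE divfK // subrr.
Qed.

Lemma ord_ge1_cst w p : ord_ge (fun=> w) p 1 -> w = 0.
Proof.
move=> o; apply/eqP; apply: contraT => w0.
by have := has_ord_ge_le (has_ord_cst p w0) o.
Qed.

(** [v] has a single simple pole, so subtracting its value at [p] leaves exactly one zero, at
    [p]. *)
Lemma coord_val v z e p : z != e -> p != e -> diveq v [:: z] [:: e] ->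
  exists t, diveq (fun q => v q - t) [:: p] [:: e].
Proof.
move=> ze pe dv0; have pe' : (e == p) = false by rewrite eq_sym (negPf pe).
have o0 : ord_ge v p 0.
  by apply: ord_ge_le (has_ord_ge (dv0 p)); rewrite /dv /= pe'; lia.
have [t ot _] := ord_val o0; exists t.
have dg : divge (fun q => v q - t) [:: p] [:: e].
  move=> q; have [<-|pq] := eqVneq p q.
    by rewrite /dv /= eqxx pe'.
  rewrite /dv /= (negPf pq); apply: ord_geB.
    by apply: ord_ge_le (has_ord_ge (dv0 q)); rewrite /dv /=; lia.
  by apply: ord_ge_le (ord_ge_cst t q); lia.
have [nv|//] := divge_exact cX dg erefl.
have oe : has_ord v e (-1) by have := dv0 e; rewrite /dv /= eqxx (negPf ze).
have h : (-1 : int) < 0 by [].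
have o1 := has_ord_dom oe (ord_ge_cst (- t) e) h.
by case: (has_ord_not0 o1 (nv e)).
Qed.

(** Comparison of the first two Taylor coefficients in the local coordinate [v - t]. *)
Lemma jet_eq0 v p (A B t : C) (E : X -> C) : has_ord (fun q => v q - t) p 1 -> ord_ge E p 0 ->
  ord_ge (fun q => A + B * (v q - t) + (v q - t) ^+ 2 * E q) p 2 -> A = 0 /\ B = 0.
Proof.
move=> ov oE oP.
have o2 : ord_ge (fun q => (v q - t) ^+ 2 * E q) p 2.
  by have := ord_geM (has_ord_ge (has_ordM ov ov)) oE; rewrite addr0.
have o1 : ord_ge (fun q => A + B * (v q - t)) p 2.
  apply: eq_ord_ge (ord_geB oP o2); apply: filterE => q; exact: addrK.
have A0 : A = 0.
  apply: (@ord_ge1_cst _ p).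
  have h1 : ord_ge (fun q => A + B * (v q - t)) p 1 by exact: ord_ge_le o1.
  apply: eq_ord_ge (ord_geB h1 (ord_geZ B (has_ord_ge ov))); apply: filterE => q; exact: addrK.
split=> //; apply/eqP; apply: contraT => B0.
have := has_ord_ge_le (has_ordZ B0 ov) (k:=1) (l:=2).
have o1' : ord_ge (fun q => B * (v q - t)) p 2.
  by apply: eq_ord_ge o1; apply: filterE => q; rewrite A0 add0r.
by move=> /(_ o1').
Qed.

(** When [u] is not constant, its pole is genuine and each [u - u(p)] has a single zero: [u] is then
    a global coordinate with [c] at infinity. *)
Lemma one_pole_dich u c : divge u [::] [:: c] -> (exists t, null (fun q => u q - t)) \/
  has_ord u c (-1) /\ forall p, p != c -> exists t, diveq (fun q => u q - t) [:: p] [:: c].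
Proof.
move=> du.
have dc t : divge (fun q => u q - t) [::] [:: c].
  move=> q; apply: ord_geB (du q) _; apply: ord_ge_le (ord_ge_cst t q).
  by rewrite /dv /=; lia.
have oc : ord_ge u c (-1) by have := du c; rewrite /dv /= eqxx.
have op p : p != c -> ord_ge u p 0.
  by rewrite eq_sym => /negPf pc; have := du p; rewrite /dv /= pc.
have [nu|eu] := null_dich (fun p => ex_intro _ _ (du p)).
  by left; exists 0 => p; apply: filterS (nu p) => q ->; rewrite subr0.
have [k ok] := eu c; have k1 := has_ord_ge_le ok oc.
have [k0|k0] := leP 0 k.
  left; apply: (divge_const cX) => p; rewrite /dv /=.
  by have [->|/op] := eqVneq p c; [apply: ord_ge_le (has_ord_ge ok)|].
have kE : k = -1 by lia.
rewrite {}kE {k1 k0} in ok; right; split=> // p pc.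
have [v ov _] := ord_val (op p pc); exists v.
have pc' : (c == p) = false by rewrite eq_sym (negPf pc).
have dg : divge (fun q => u q - v) [:: p] [:: c].
  move=> q; have [<-|pq] := eqVneq p q; first by rewrite /dv /= eqxx pc'.
  by have := dc v q; rewrite /dv /= (negPf pq).
have [nv|//] := divge_exact cX dg erefl.
have h : (-1 : int) < 0 by [].
by case: (has_ord_not0 (has_ord_dom ok (ord_ge_cst (- v) c) h) (nv c)).
Qed.

End Divisors.

(** * Differentials of functions with a simple pole, and holomorphic forms *)

Section PoleDerivative.
Variable R : realType.
Local Notation C := (Cplx R).

Lemma derive1V (f : C -> C) z : cdiff f z -> f z != 0 ->
  derive1 (fun y => (f y)^-1) z = - (derive1 f z) / f z ^+ 2.
Proof.
move=> df fz; have E := derive1M df (cdiffV fz df).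
have E1 : derive1 (fun y => f y * (f y)^-1) z = 0.
  have H : \forall y \near z, f y * (f y)^-1 = 1.
    by apply: filterS (cts_neq0 (cdiff_cts df) fz) => y fy; rewrite divff.
  rewrite (eq_derive1 H); apply: cder_derive1 => e e0.
  apply: filterS (near_nrm z ltr01) => y _.
  by rewrite mul0r !subrr nrm0 mulr_ge0 ?nrm_ge0 // ltW.
rewrite E1 in E; have key (D d a : C) : a != 0 -> 0 = d * a^-1 + a * D -> D = - d / a ^+ 2.
  move=> a0 H; have -> : d = - (a ^+ 2 * D); last by field.
    by apply/eqP; rewrite -addr_eq0 -(mulIr_eq0 _ (mulIf (invr_neq0 a0))) mulrDl H; apply/eqP; field.
exact: key fz E.
Qed.

Lemma pnear_eq_derive1 (f g : C -> C) c : (\forall z \near c^', f z = g z) ->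
  \forall z \near c^', derive1 f z = derive1 g z.
Proof.
move=> fg; have H := pnear_pnear fg.
have fg' : \forall z \near c, z != c -> f z = g z by exact: fg.
have K : \forall z \near c, z != c -> derive1 f z = derive1 g z.
  apply: filterS (nbhs_near fg') => z Hz zc; apply: eq_derive1.
  have op : \forall y \near z, y != c.
    have zc' : z - c != 0 by rewrite subr_eq0.
    by apply: filterS (cts_neq0 (hol_cts (hol_subc c z)) zc') => y; rewrite subr_eq0.
  by apply: filterS2 Hz op => y h /h.
exact: K.
Qed.

(** Through the reciprocal [r = 1 / f], which has a simple zero: [f' = - r' / r^2]. *)
Lemma mord_derive1_pole (f : C -> C) c : mord f c (-1) -> mord (derive1 f) c (-2).
Proof.
move=> [g [hg gc] fg]; pose r z := (z - c) * (g z)^-1.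
have hr : hol r c := holM (hol_subc c c) (holV hg gc).
have or : mord r c 1.
  exists (fun z => (g z)^-1); first by split; [exact: holV|rewrite invr_eq0].
  by apply: filterS (pnear_neq c) => z _; rewrite expr1z.
have or' : mord (derive1 r) c 0 := mord_derive1 hr or.
have fr : \forall z \near c^', (r z)^-1 = f z.
  by apply: filterS fg => z ->; rewrite /r invfM invrK; congr (_ * _).
have o2 := mordM or' (mordV (mordM or or)).
have N1 : - 1 != 0 :> C by rewrite oppr_eq0 oner_neq0.
have o3 := mordM (hol_mord (hol_cst (-1) c) N1) o2.
apply: eq_mord o3.
have H1 : \forall z \near c^', cdiff r z by apply: pnear_near; exact: hr.
apply: filterS3 (pnear_eq_derive1 fr) H1 (mord_neq0 or) => z <- dr rz.
by rewrite derive1V // expr2 mulN1r mulNr.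
Qed.

End PoleDerivative.

Section Genus.
Variable R : realType.
Variable X : riemannSurface R.
Local Notation C := (Cplx R).
Hypothesis cX : compact [set: X].

Lemma hol_form (w : chart_index X -> X -> C) i p : holomorphic_form w -> dom i p ->
  hol (fun z => w i (chartV i z)) (chart i p).
Proof.
move=> [dw _] ip; apply: filterS (near_image ip) => z [iz zE].
by apply/cdiffP; have := dw i _ iz; rewrite zE.
Qed.

(* The quotient w / du has no poles, and vanishes doubly at c since u has a simple
   pole there. *)
Lemma form_eq0 (u : X -> C) c (w : chart_index X -> X -> C) :
  has_ord u c (-1) ->
  (forall p, p != c -> exists v, has_ord (fun q => u q - v) p 1) ->
  holomorphic_form w -> forall i p, dom i p -> w i p = 0.
Proof.
move=> uc up hw.
pose U i z : C := u (chartV i z).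
(* The chart changes with [q]. [GE] shows that any fixed chart gives the same quotient, [w] and [du]
   transforming by the same factor. *)
pose G q : C := w (ch q) q / derive1 (U (ch q)) (chart (ch q) q).
have oU i p : dom i p -> exists k, mge (U i) (chart i p) k.
  move=> ip; have [E|/up [v ov]] := eqVneq p c.
    by exists (-1); apply: (iffLR (ord_geP u (-1) ip)); rewrite E; exact: has_ord_ge uc.
  exists 0; apply: (iffLR (ord_geP u 0 ip)).
  have o0 := ord_geD (ord_ge_le (ler01 : (0 : int) <= 1) (has_ord_ge ov)) (ord_ge_cst v p).
  by apply: eq_ord_ge o0; apply: filterE => q; rewrite subrK.
have GE i p : dom i p -> \forall z \near (chart i p)^', G (chartV i z) =
   w i (chartV i z) / derive1 (U i) z.
  move=> ip; have [k ok] := oU i p ip.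
  have H1 : \forall z \near chart i p, dom i (chartV i z) /\ chart i (chartV i z) = z := near_image ip.
  have H2 : \forall z \near (chart i p)^', dom i (chartV i z) /\ chart i (chartV i z) = z := pnear_near H1.
  apply: filterS2 H2 (mge_hol_near ok) => z [iz zE] hz.
  set q := chartV i z in iz zE *; rewrite /G.
  have jq := dom_ch q; set j := ch q in jq *.
  have -> : w i q = w j q * derive1 (trans i j) z by have := hw.2 _ _ _ iz jq; rewrite zE.
  have hUj : cdiff (U j) (trans i j z).
    rewrite -zE transE //.
    have h1 : cdiff (fun y => U i (trans j i y)) (chart j q).
      apply: cdiff_comp (hol_cdiff (hol_trans jq iz)) _.
      by rewrite transE // zE; exact: hol_cdiff hz.
    apply: eq_cdiff h1; exact: (loc_trans u jq iz).
  have hT : hol (trans i j) z by rewrite -zE; exact: hol_trans.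
  have E : derive1 (U i) z = derive1 (U j) (chart j q) * derive1 (trans i j) z.
    rewrite -(transE j iz) zE -(derive1_compC (hol_cdiff hT) hUj).
    have H : \forall y \near chart i q, U j (trans i j y) = U i y := loc_trans u iz jq.
    by rewrite zE in H; rewrite (eq_derive1 H).
  have T0 : derive1 (trans i j) z != 0 by rewrite -zE; exact: derive1_trans.
  by rewrite E -mulf_div divff // mulr1.
have oD i p : dom i p -> mord (derive1 (U i)) (chart i p) (if p == c then -2 else 0).
  move=> ip; case: (eqVneq p c) => [E|/up [v ov]].
    by apply: mord_derive1_pole; apply: (iffLR (has_ordP u (-1) ip)); rewrite E.
  have [g [hg gc] gE] := iffLR (has_ordP _ _ ip) ov.
  pose r z := (z - chart i p) * g z.
  have hr : hol r (chart i p) by exact: holM (hol_subc _ _) hg.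
  have or : mord r (chart i p) 1.
    by exists g => //; apply: filterE => z; rewrite expr1z.
  have UE : \forall z \near (chart i p)^', U i z = r z - (- v).
    by apply: filterS gE => z zE; rewrite opprK /r -[z - _]expr1z -zE subrK.
  apply: eq_mord (mord_derive1 hr or).
  have H1 : \forall z \near (chart i p)^', cdiff r z by apply: pnear_near; exact: hr.
  by apply: filterS2 (pnear_eq_derive1 UE) H1 => z -> dr; rewrite derive1_subk.
have oG : divge G [:: c; c] [::].
  move=> p; have ip := dom_ch p; apply: (iffRL (ord_geP G _ ip)).
  have o1 := mgeM (hol_mge (hol_form hw ip)) (mord_mge (mordV (oD _ _ ip))).
  have -> : dv [:: c; c] [::] p = 0 - (if p == c then -2 else 0).
    by rewrite /dv /= eq_sym; case: (p == c).
  by rewrite sub0r -[X in mge _ _ X]add0r; apply: eq_mge o1; apply: filterS (GE _ p ip) => z ->.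
move=> i p ip; have nG := divge_null cX oG (isT : (0 < 2)%N).
rewrite -[p in LHS](chartK ip).
apply: (@cts_pnear0 _ (fun z => w i (chartV i z)) (chart i p)).
  exact: hol_cts (hol_form hw ip).
apply: filterS3 (GE i p ip) (pnear_chartV ip (nG p)) (mord_neq0 (oD i p ip)) => z -> /eqP.
by rewrite mulf_eq0 invr_eq0 => /orP [/eqP|] // U0 /negPf; rewrite U0.
Qed.

(** A nonconstant [u] would make every holomorphic form vanish, hence also the sum of the basis
    forms, against their independence when [g > 0]. *)
Lemma genus_const (g : nat) (u : X -> C) c : has_genus X g -> (0 < g)%N ->
  divge u [::] [:: c] -> exists t, null (fun q => u q - t).
Proof.
move=> [w [hw free _]] g0 du; have [//|[oc uP]] := one_pole_dich cX du; exfalso.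
have H p : p != c -> exists v, has_ord (fun q => u q - v) p 1.
  move=> pc; have [v dv1] := uP p pc; exists v.
  by have := dv1 p; rewrite /dv /= eqxx [c == p]eq_sym (negPf pc).
have := free (fun=> 1) _ (Ordinal g0); move=> /(_ _)/eqP; rewrite oner_eq0.
suff K : forall i p, dom i p -> \sum_k0 1 * w k0 i p = 0 by move=> /(_ K).
move=> i p ip; apply: big1 => j _.
by rewrite (form_eq0 oc H (hw j) ip) mulr0.
Qed.

End Genus.

(** * Cubic covers *)

Section Real.
Variable R : realType.
Local Notation C := (Cplx R).
Implicit Types (l be al c x : C).

(* 3 be - (1 + l) is a square root of 1 - l + l ^+ 2 > 0. *)
Lemma conj_root l be : l^* = l -> 3 * be ^+ 2 - 2 * (1 + l) * be + l = 0 -> be^* = be.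
Proof.
move=> lr E; have [r rdef] : exists r, r = 3 * be - (1 + l) by exists (3 * be - (1 + l)).
have rE : r ^+ 2 = (l - 2^-1) ^+ 2 + 3 / 4.
  have : r ^+ 2 = 3 * (3 * be ^+ 2 - 2 * (1 + l) * be + l) + ((l - 2^-1) ^+ 2 + 3 / 4).
    by rewrite rdef; field.
  by rewrite E mulr0 add0r.
have lR : l - 2^-1 \is Num.real by apply/CrealP; rewrite rmorphB /= lr fmorphV rmorph_nat.
have s0 : 0 < r ^+ 2.
  by rewrite rE ltr_wpDl ?divr_gt0 ?ltr0n // real_exprn_even_ge0.
have sr : (r^*) ^+ 2 = r ^+ 2.
  rewrite -rmorphXn /=; apply/CrealP; exact: gtr0_real.
have rr : r^* = r.
  have /eqP := sr; rewrite eqf_sqr => /orP [/eqP//|/eqP rN].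
  have := mul_conjC_ge0 r; rewrite rN mulrN -expr2 oppr_ge0 => h.
  by have := lt_le_trans s0 h; rewrite ltxx.
have -> : be = (r + (1 + l)) / 3 by rewrite rdef; field.
by rewrite rmorphM rmorphD rmorphD /= rr lr fmorphV rmorph1 rmorph_nat.
Qed.

(** For [F (v - be) = c v^2 (v - al)], the equations say that [F] takes the value 1 doubly at
    [v = 1] and the value [x] doubly at [v = l]: [e1] and [e3] compare values, [e2] and [e4]
    derivatives. *)
Lemma conj_crit_value l be al c x : l^* = l -> l != 0 -> l != 1 -> c != 0 ->
  c * (1 - al) = 1 - be -> c * (3 - 2 * al) = 1 ->
  c * l ^+ 2 * (l - al) = x * (l - be) -> c * (3 * l ^+ 2 - 2 * al * l) = x -> x^* = x.
Proof.
move=> lr l0 l1 c0 e1 e2 e3 e4.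
have l1' : l - 1 != 0 by rewrite subr_eq0.
have a1 : 2 - al - 3 * be + 2 * al * be = 0.
  have : c * (1 - al) = c * (3 - 2 * al) * (1 - be) by rewrite e1 e2 mul1r.
  rewrite -mulrA => /(mulfI c0) E.
  have -> : 2 - al - 3 * be + 2 * al * be = (3 - 2 * al) * (1 - be) - (1 - al) by ring.
  by rewrite -E subrr.
have a2 : 2 * l ^+ 2 - al * l - 3 * be * l + 2 * al * be = 0.
  have cl0 : c * l != 0 by rewrite mulf_neq0.
  have : c * l * (l * (l - al)) = c * l * ((3 * l - 2 * al) * (l - be)).
    have -> : c * l * (l * (l - al)) = c * l ^+ 2 * (l - al) by ring.
    by rewrite e3 -e4; ring.
  move=> /(mulfI cl0) E.
  have -> : 2 * l ^+ 2 - al * l - 3 * be * l + 2 * al * be =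
    (3 * l - 2 * al) * (l - be) - l * (l - al) by ring.
  by rewrite -E subrr.
(* Once [c] and [x] are eliminated, the two equations differ by a multiple of [l - 1]. *)
have a3 : al = 2 * (l + 1) - 3 * be.
  have : (l - 1) * (2 * (l + 1) - (al + 3 * be)) = 0.
    by rewrite -(subrr (0 : C)) -{1}a2 -a1; ring.
  by move/eqP; rewrite mulf_eq0 (negPf l1') subr_eq0 => /eqP ->; ring.
(* Substituting [al] makes the equation [a1] equal to [-2] times the quadratic of [conj_root]. *)
have br : be^* = be.
  apply: (conj_root lr); have : - (2 - al - 3 * be + 2 * al * be) / 2 = 0.
    by rewrite a1 oppr0 mul0r.
  by rewrite a3 => <-; field.
have lR : l \is Num.real by apply/CrealP.
have bR : be \is Num.real by apply/CrealP.
have aR : al \is Num.real by rewrite a3 rpredB // rpredM ?rpredD ?rpred1 ?realn.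
have n0 : 3 - 2 * al != 0.
  by apply/eqP => E; move: e2; rewrite E mulr0 => /eqP; rewrite eq_sym oner_eq0.
have cR : c \is Num.real.
  have -> : c = (3 - 2 * al)^-1 by rewrite -[RHS]mul1r -{1}e2 mulfK.
  by rewrite rpredV rpredB ?rpredM ?realn.
by apply/CrealP; rewrite -e4 rpredM // rpredB // ?rpredM ?rpredX ?realn.
Qed.

End Real.

Section OnePole.
Variable R : realType.
Variable X : riemannSurface R.
Local Notation C := (Cplx R).
Implicit Types (p q c : X) (F G h u v : X -> C) (k l : int) (zs ps : seq X) (t w : C).
Hypothesis cX : compact [set: X].

(** The constant [D] can be absorbed in two ways, using the values at [ci] or those at [cj], and
    each form shows one double zero. The bound has degree 0, as [divge_exact] requires. *)
Lemma comb_divge F h e1 ci cj ai aj ai' aj' b b' (A B D f e f' e' : C) : ci != cj ->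
  diveq (fun q => F q - f) [:: ci; ci; ai] [:: e1; e1; b] ->
  diveq (fun q => h q - f') [:: ci; ci; ai'] [:: e1; e1; b'] ->
  diveq (fun q => F q - e) [:: cj; cj; aj] [:: e1; e1; b] ->
  diveq (fun q => h q - e') [:: cj; cj; aj'] [:: e1; e1; b'] ->
  A * f' + B * f + D = 0 -> A * e' + B * e + D = 0 ->
  divge (fun q => A * h q + B * F q + D) [:: ci; ci; cj; cj] [:: e1; e1; b; b'].
Proof.
move=> cij dF dh dF' dh' E1 E2 p.
have [ep|ep] := eqVneq cj p.
  have cp : (ci == p) = false by rewrite -ep (negPf cij).
  apply: (@eq_ord_ge _ _ (fun q => A * (h q - e') + B * (F q - e))).
    by apply: filterE => q; apply/eqP; rewrite -subr_eq0 -oppr_eq0 -E2; apply/eqP; ring.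
  apply: ord_geD; apply: ord_geZ.
    by apply: ord_ge_le (has_ord_ge (dh' p)); rewrite /dv /= cp; lia.
  by apply: ord_ge_le (has_ord_ge (dF' p)); rewrite /dv /= cp; lia.
apply: (@eq_ord_ge _ _ (fun q => A * (h q - f') + B * (F q - f))).
  by apply: filterE => q; apply/eqP; rewrite -subr_eq0 -oppr_eq0 -E1; apply/eqP; ring.
apply: ord_geD; apply: ord_geZ.
  by apply: ord_ge_le (has_ord_ge (dh p)); rewrite /dv /= (negPf ep); lia.
by apply: ord_ge_le (has_ord_ge (dF p)); rewrite /dv /= (negPf ep); lia.
Qed.

Lemma comb_null F h (A B D : C) : A != 0 -> null (fun q => A * h q + B * F q + D) ->
  exists t s, null (fun q => h q - (t * F q + s)).
Proof.
move=> A0 nu; exists (- B / A), (- D / A) => p; apply: filterS (nu p) => q E.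
have -> : h q - (- B / A * F q + - D / A) = (A * h q + B * F q + D) / A by field.
by rewrite E mul0r.
Qed.

End OnePole.

(** Coincidences between points become arbitrary naturals, so divisor identities hold whether or not
    the points involved are distinct. *)
Ltac dvlia := repeat match goal with |- context [nat_of_bool (?a == ?b)] =>
  move: (nat_of_bool (a == b)) => ? end; clear; lia.

Section Cubic.
Variable R : realType.
Variable X : riemannSurface R.
Local Notation C := (Cplx R).
Implicit Types (p q c : X) (u v : X -> C) (k l : int) (t w : C).
Hypothesis cX : compact [set: X].

(** The conjugate of [v] has the same zero and pole, both real points, hence is [k * v]; the value 1
    at the real point [c3] gives [k = 1], and the value at the real point [c4] is then real. *)
Lemma real_coordinate (s : X -> X) v (c1 c2 c3 c4 : X) : real_structure s ->
  c2 != c3 -> c1 != c3 -> c1 != c4 -> s c1 = c1 -> s c2 = c2 -> s c3 = c3 -> s c4 = c4 ->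
  diveq v [:: c2] [:: c1] -> diveq (fun q => v q - 1) [:: c3] [:: c1] ->
  forall l : C, diveq (fun q => v q - l) [:: c4] [:: c1] -> l^* = l.
Proof.
move=> rs c23 c13 c14 s1 s2 s3 s4 dv0 dv1 l dvl; have [_ sK] := rs.
have sI : injective s := inv_inj sK.
have ds : diveq (fun q => (v (s q))^*) [:: c2] [:: c1].
  move=> p; have := has_ord_conj rs (dv0 (s p)).
  by rewrite /dv /= -{1}s2 -{1}s1 !(inj_eq sI).
have [k k0 kP] := diveq_ratio cX (fun=> erefl) dv0 ds.
have near_k p : \forall q \near p^', (v (s q))^* = k * v q.
  by apply: filterS (kP p) => q /eqP; rewrite subr_eq0 => /eqP.
have c13' : (c1 == c3) = false by exact: negPf.
have c14' : (c1 == c4) = false by exact: negPf.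
have o3 : has_ord (fun q => v q - 1) c3 1 by have := dv1 c3; rewrite /dv /= eqxx c13'.
have o4 : has_ord (fun q => v q - l) c4 1 by have := dvl c4; rewrite /dv /= eqxx c14'.
have k1 : k = 1.
  have o3' : has_ord (fun q => v q - 1) (s c3) 1 by rewrite s3.
  have := ord_geB (has_ord_ge (has_ord_conj rs o3')) (ord_geZ k (has_ord_ge o3)).
  move=> H; apply/eqP; rewrite -subr_eq0; apply/eqP; apply: (@ord_ge1_cst _ _ _ c3).
  apply: eq_ord_ge H; apply: filterS (near_k c3) => q.
  by rewrite rmorphB rmorph1 /= => ->; ring.
have o4' : has_ord (fun q => v q - l) (s c4) 1 by rewrite s4.
have := ord_geB (has_ord_ge o4) (has_ord_ge (has_ord_conj rs o4')).
move=> H; apply/eqP; rewrite -subr_eq0; apply/eqP; apply: (@ord_ge1_cst _ _ _ c4).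
apply: eq_ord_ge H; apply: filterS (near_k c4) => q.
by rewrite rmorphB /= => ->; rewrite k1; ring.
Qed.

(** To first order in [v - l] the function [F] is the constant [x], so the cubic polynomial has the
    1-jet of [x * (e * v + be)]. The coefficient [e] may be 0, for an [F] polynomial in [v]. *)
Lemma double_value (F v : X -> C) (x l e be al c : C) p : has_ord (fun q => v q - l) p 1 ->
  ord_ge (fun q => F q - x) p 2 -> null (fun q => F q * (e * v q + be) - c * (v q ^+ 2 * (v q - al))) ->
  c * l ^+ 2 * (l - al) = x * (e * l + be) /\ c * (3 * l ^+ 2 - 2 * al * l) = x * e.
Proof.
move=> ov oF nu.
have ov0 : ord_ge v p 0.
  have := ord_geD (ord_ge_le (ler01 : (0 : int) <= 1) (has_ord_ge ov)) (ord_ge_cst l p).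
  by apply: eq_ord_ge; apply: filterE => q; rewrite subrK.
have oe : ord_ge (fun q => e * v q + be) p 0 := ord_geD (ord_geZ e ov0) (ord_ge_cst be p).
have oE : ord_ge (fun q => c * (v q + (2 * l - al))) p 0.
  exact: ord_geZ (ord_geD ov0 (ord_ge_cst _ p)).
have H := ord_geM oF oe; rewrite addr0 in H.
have [] := @jet_eq0 _ _ v p (c * l ^+ 2 * (l - al) - x * (e * l + be))
  (c * (3 * l ^+ 2 - 2 * al * l) - x * e) l _ ov oE.
  apply: eq_ord_ge H; apply: filterS (nu p) => q /eqP; rewrite subr_eq0 => /eqP E.
  by rewrite mulrBl E; ring.
by move=> /eqP + /eqP; rewrite !subr_eq0 => /eqP -> /eqP ->.
Qed.

(** [y - x] and [y - xb] are the multiples of [F / s4] and [h / s4] by [x - xb], so their divisors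
    are known. The relation [y' = t * y + kap] then forces [t * y + m] to equal [y' / h], which has
    a pole at [a'], whereas [y] is regular there. *)
Lemma cubic_const (F h s4 s3 s2 y y' : X -> C) (c1 c2 c3 c4 a b a' b' : X) (x xb t kap : C) :
  (forall q, s4 q = h q - F q) -> (forall q, s3 q = x * h q - xb * F q) ->
  (forall q, s2 q = (h q - 1) - (xb - 1) / (x - 1) * (F q - 1)) ->
  (forall q, y q = s3 q / s4 q) -> (forall q, y' q = s3 q / s2 q) ->
  diveq F [:: c2; c2; a] [:: c1; c1; b] -> diveq h [:: c2; c2; a'] [:: c1; c1; b'] ->
  diveq s4 [:: c2; c2; c3; c3] [:: c1; c1; b; b'] ->
  diveq s2 [:: c3; c3; c4; c4] [:: c1; c1; b; b'] ->
  diveq y [:: c4; c4] [:: c3; c3] -> diveq y' [:: c2; c2] [:: c3; c3] ->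
  null (fun q => y' q - t * y q - kap) ->
  b != c2 -> b != c3 -> b != a -> a' != c1 -> a' != b' -> a' != c3 ->
  x != xb -> x != 1 -> False.
Proof.
move=> s4E s3E s2E yE y'E dF dh d4 d2 dy dy' nu bc2 bc3 ba ac1 ab ac3 xx x1.
have x1' : x - 1 != 0 by rewrite subr_eq0.
have xx' : x - xb != 0 by rewrite subr_eq0.
have near0 p : \forall q \near p^', [/\ s4 q != 0, s2 q != 0 & y' q = t * y q + kap].
  apply: filterS3 (diveq_neq0 p d4) (diveq_neq0 p d2) (nu p) => q h4 h2 E; split=> //.
  by apply/eqP; rewrite -subr_eq0 opprD addrA E.
have yx (w : C) q : s4 q != 0 -> y q - w = ((x - w) * h q + (w - xb) * F q) / s4 q.
  by move=> h4; rewrite yE -{1}(mulfK h4 w) -mulrBl s3E s4E; congr (_ / _); ring.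
have dyx : diveq (fun q => y q - x) [:: a; b'] [:: c3; c3].
  have H p := has_ordZ xx' (diveqM dF (diveqV d4) p).
  have H2 : diveq (fun q => y q - x) ([:: c2; c2; a] ++ [:: c1; c1; b; b'])
      ([:: c1; c1; b] ++ [:: c2; c2; c3; c3]).
    apply: eq_diveq_fun H => p; apply: filterS (near0 p) => q [h4 _ _].
    by rewrite yx // subrr mul0r add0r mulrA.
  apply: (diveq_dv _ H2) => p.
  by rewrite /dv /=; dvlia.
have dyb : diveq (fun q => y q - xb) [:: a'; b] [:: c3; c3].
  have H p := has_ordZ xx' (diveqM dh (diveqV d4) p).
  have H2 : diveq (fun q => y q - xb) ([:: c2; c2; a'] ++ [:: c1; c1; b; b'])
      ([:: c1; c1; b'] ++ [:: c2; c2; c3; c3]).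
    apply: eq_diveq_fun H => p; apply: filterS (near0 p) => q [h4 _ _].
    by rewrite yx // subrr mul0r addr0 mulrA.
  apply: (diveq_dv _ H2) => p.
  by rewrite /dv /=; dvlia.
have [m mE] : exists m, m = kap - t - x + 1 + t * xb by exists (kap - t - x + 1 + t * xb).
have ot p : p != c3 -> ord_ge (fun q => t * y q + m) p 0.
  move=> pc; apply: ord_geD (ord_ge_cst m p); apply: ord_geZ.
  have pc' : (c3 == p) = false by rewrite eq_sym (negPf pc).
  by apply: ord_ge_le (has_ord_ge (dy p)); rewrite /dv /= pc'; dvlia.
(* From [(x - 1) * s2 = (y - 1) * s4 - (x - xb)]: multiplying by [F * y' / (s2 * s4)] eliminates
   [h], and the constant [m] is chosen to split off the factor [y - xb]. *)
have K1 p : \forall q \near p^',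
    F q * ((y q - xb) * (t * y q + m) + (m * xb - kap)) = y' q * (y q - x).
  apply: filterS (near0 p) => q [h4 h2 E].
  have -> : (y q - xb) * (t * y q + m) + (m * xb - kap) = y' q * (y q - 1) - (x - 1) * y q.
    by rewrite E mE; ring.
  rewrite (yx x q h4) (yx 1 q h4) yE y'E.
  have E2 : (x - 1) * s2 q = (x - 1) * h q + (1 - xb) * F q - (x - xb).
    by rewrite s2E; field.
  have -> : F q * (s3 q / s2 q * (((x - 1) * h q + (1 - xb) * F q) / s4 q) - (x - 1) * (s3 q / s4 q)) =
    F q * (s3 q / s2 q / s4 q) * ((x - 1) * h q + (1 - xb) * F q - (x - 1) * s2 q).
    by field; rewrite h4 h2.
  by rewrite E2 subrr mul0r add0r opprB; field; rewrite h4 h2.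
(* At the pole [b] of [F] both [y' * (y - x) / F] and [y - xb] vanish, leaving the constant
   alone. *)
have mk : m * xb - kap = 0.
  have bc2' : (c2 == b) = false by rewrite eq_sym (negPf bc2).
  have bc3' : (c3 == b) = false by rewrite eq_sym (negPf bc3).
  have ba' : (a == b) = false by rewrite eq_sym (negPf ba).
  apply: (@ord_ge1_cst _ _ _ b).
  have o1 := ord_geM (ord_geM (has_ord_ge (dy' b)) (has_ord_ge (dyx b))) (has_ord_ge (has_ordV (dF b))).
  have o2 := ord_geM (has_ord_ge (dyb b)) (ot b bc3).
  have o1' : ord_ge (fun q => y' q * (y q - x) * (F q)^-1) b 1.
    by apply: ord_ge_le o1; rewrite /dv /= bc2' bc3' ba' eqxx; dvlia.
  have o2' : ord_ge (fun q => (y q - xb) * (t * y q + m)) b 1.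
    by apply: ord_ge_le o2; rewrite /dv /= bc3' eqxx; dvlia.
  apply: eq_ord_ge (ord_geB o1' o2'); apply: filterS2 (K1 b) (diveq_neq0 b dF) => q <- F0.
  by rewrite [F q * _]mulrC mulfK // addrC addKr.
(* [F * (y - xb) = h * (y - x)], so [y - x] cancels from the relation and [t * y + m = y' / h]
   remains. *)
have K2 : diveq (fun q => t * y q + m) ([:: c2; c2] ++ [:: c1; c1; b']) ([:: c3; c3] ++ [:: c2; c2; a']).
  apply: eq_diveq_fun (diveqM dy' (diveqV dh)) => p.
  have H : \forall q \near p^', h q != 0 /\ y q - x != 0.
    by apply: filterS2 (diveq_neq0 p dh) (diveq_neq0 p dyx).
  apply: filterS3 (K1 p) (near0 p) H => q; rewrite mk addr0 => E [h4 _ _] [h0 yx0].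
  have E3 : F q * (y q - xb) = h q * (y q - x).
    by rewrite (yx x q h4) (yx xb q h4); ring.
  rewrite mulrA E3 in E; apply: (mulIf yx0).
  by rewrite -mulrA [_^-1 * _]mulrC mulrA -E; field.
have := has_ord_ge_le (K2 a') (ot a' ac3).
have e1 : (c1 == a') = false by rewrite eq_sym (negPf ac1).
have e3 : (c3 == a') = false by rewrite eq_sym (negPf ac3).
have eb : (b' == a') = false by rewrite eq_sym (negPf ab).
by rewrite /dv /= !eqxx e1 e3 eb; dvlia.
Qed.

End Cubic.

Section Cubic2.
Variable R : realType.
Variable X : riemannSurface R.
Local Notation C := (Cplx R).
Implicit Types (p q c : X) (u v : X -> C) (k l : int) (t w : C).
Hypothesis cX : compact [set: X].

(** The Moebius change of [u] sending the values at [c1] and [c2] to infinity and 0; the pole [c3]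
    of [u] goes to 1. *)
Lemma cross_ratio_coordinate u (c1 c2 c3 : X) : c1 != c2 -> c1 != c3 -> c2 != c3 ->
  (forall p, p != c3 -> exists t, diveq (fun q => u q - t) [:: p] [:: c3]) ->
  exists v : X -> C, diveq v [:: c2] [:: c1] /\ diveq (fun q => v q - 1) [:: c3] [:: c1].
Proof.
move=> c12 c13 c23 uP; have [u1 d1] := uP _ c13; have [u2 d2] := uP _ c23.
have u12 : u1 - u2 != 0.
  rewrite subr_eq0; apply/eqP => E; have := d1 c1; rewrite E => o1.
  have := has_ord_uniq o1 (d2 c1); rewrite /dv /= eqxx [c2 == c1]eq_sym (negPf c12).
  by dvlia.
exists (fun q => (u q - u2) / (u q - u1)); split.
  by apply: (diveq_dv _ (diveqM d2 (diveqV d1))) => p; rewrite /dv /=; dvlia.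
have H p : has_ord (fun q => (u1 - u2) * (u q - u1)^-1) p (dv [:: c3] [:: c1] p).
  exact: has_ordZ u12 (diveqV d1 p).
apply: (eq_diveq_fun _ H) => p; apply: filterS (diveq_neq0 p d1) => q h.
by rewrite -[X in _ = _ - X](divff h) -mulrBl; congr (_ / _); ring.
Qed.

Lemma cubic_nonconst (s : X -> X) (F u : X -> C) (c1 c2 c3 c4 a a3 a4 b : X) (x : C) :
  real_structure s -> s c1 = c1 -> s c2 = c2 -> s c3 = c3 -> s c4 = c4 ->
  c1 != c2 -> c1 != c3 -> c1 != c4 -> c2 != c3 -> c2 != c4 -> c3 != c4 ->
  diveq F [:: c2; c2; a] [:: c1; c1; b] ->
  diveq (fun q => F q - 1) [:: c3; c3; a3] [:: c1; c1; b] ->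
  diveq (fun q => F q - x) [:: c4; c4; a4] [:: c1; c1; b] ->
  a != c1 -> b != c3 -> b != c4 ->
  (forall p, p != c3 -> exists t, diveq (fun q => u q - t) [:: p] [:: c3]) -> x^* = x.
Proof.
move=> rs s1 s2 s3 s4 c12 c13 c14 c23 c24 c34 d0 d1 dx ac1 bc3 bc4 uP.
have [v [dv0 dv1]] := cross_ratio_coordinate c12 c13 c23 uP.
have c21 : c2 != c1 by rewrite eq_sym.
have c41 : c4 != c1 by rewrite eq_sym.
have [l dl] := coord_val cX c21 c41 dv0.
have lr := real_coordinate cX rs c23 c13 c14 s1 s2 s3 s4 dv0 dv1 dl.
have l0 : l != 0.
  apply/eqP => E; have := dl c4; rewrite E => o.
  have o' : has_ord v c4 (dv [:: c4] [:: c1] c4).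
    by apply: eq_has_ord o; apply: filterE => q; rewrite subr0.
  have := has_ord_uniq o' (dv0 c4); rewrite /dv /= eqxx (negPf c24) (negPf c14); dvlia.
have l1 : l != 1.
  apply/eqP => E; have := dl c4; rewrite E => o.
  have := has_ord_uniq o (dv1 c4); rewrite /dv /= eqxx (negPf c34) (negPf c14); dvlia.
have [al dal] := coord_val cX c21 ac1 dv0.
have dA : diveq (fun q => v q ^+ 2 * (v q - al)) ([:: c2] ++ [:: c2] ++ [:: a]) ([:: c1] ++ [:: c1] ++ [:: c1]).
  apply: (eq_diveq_fun _ (diveqM dv0 (diveqM dv0 dal))) => p; apply: filterE => q.
  by rewrite expr2 mulrA.
have [e [be [eP [c c0 nu]]]] : exists e be, (e = 0 /\ be = 1 \/ e = 1) /\
    exists2 c, c != 0 & null (fun q => F q * (e * v q + be) - c * (v q ^+ 2 * (v q - al))).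
  have [bE|bc1] := eqVneq b c1.
    exists 0, 1; split; first by left.
    have dB : diveq (fun q => F q * (0 * v q + 1)) [:: c2; c2; a] [:: c1; c1; b].
      by apply: (eq_diveq_fun _ d0) => p; apply: filterE => q; rewrite mul0r add0r mulr1.
    by apply: (diveq_ratio cX _ dA dB) => p; rewrite bE /dv /=; dvlia.
  have [bt dbt] := coord_val cX c21 bc1 dv0.
  exists 1, (- bt); split; first by right.
  have dB : diveq (fun q => F q * (1 * v q - bt)) ([:: c2; c2; a] ++ [:: b]) ([:: c1; c1; b] ++ [:: c1]).
    by apply: (eq_diveq_fun _ (diveqM d0 dbt)) => p; apply: filterE => q; rewrite mul1r.
  by apply: (diveq_ratio cX _ dA dB) => p; rewrite /dv /=; dvlia.
have ord1 (w : C) p : p != c1 -> diveq (fun q => v q - w) [:: p] [:: c1] -> has_ord (fun q => v q - w) p 1.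
  by rewrite eq_sym => /negPf pc d; have := d p; rewrite /dv /= eqxx pc.
have ord2 (w : C) p a5 : p != c1 -> b != p -> diveq (fun q => F q - w) [:: p; p; a5] [:: c1; c1; b] ->
    ord_ge (fun q => F q - w) p 2.
  rewrite eq_sym => /negPf pc /negPf bp d; apply: ord_ge_le (has_ord_ge (d p)).
  by rewrite /dv /= eqxx pc bp; dvlia.
have c31 : c3 != c1 by rewrite eq_sym.
have [e1 e2] := double_value (ord1 _ _ c31 dv1) (ord2 _ _ _ c31 bc3 d1) nu.
have [e3 e4] := double_value (ord1 _ _ c41 dl) (ord2 _ _ _ c41 bc4 dx) nu.
case: eP => [[e0 be1]|eE]; rewrite ?e0 ?be1 ?eE in e1 e2 e3 e4; last first.
  apply: (@conj_crit_value _ l (- be) al c x lr l0 l1 c0); rewrite ?opprK.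
  - by rewrite -[LHS]mul1r mulrA mul1r; move: e1; rewrite expr1n mulr1 => ->; ring.
  - by move: e2; rewrite expr1n !mulr1 => ->.
  - by rewrite e3; ring.
  - by rewrite e4 mulr1.
(* A polynomial [c v^2 (v - al)] has only one nonzero critical point, so [v = 1] and [v = l] cannot
   both be critical. *)
exfalso; move: l1; rewrite -subr_eq0 => /eqP; apply.
move/eqP: e2; rewrite mulr0 mulf_eq0 (negPf c0) /= expr1n !mulr1 subr_eq0 => /eqP a3E.
move/eqP: e4; rewrite mulr0 mulf_eq0 (negPf c0) /= -a3E => /eqP E.
have : 3 * l * (l - 1) = 0 by rewrite -E; ring.
by move/eqP; rewrite !mulf_eq0 (negPf l0) pnatr_eq0 => /eqP.
Qed.

Lemma cubic_linear (s : X -> X) (F h : X -> C) (c1 c2 c3 c4 a a3 a4 b a' a3' a4' b' : X) (x : C) :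
  real_structure s -> s c1 = c1 -> s c2 = c2 -> s c3 = c3 -> s c4 = c4 ->
  c1 != c2 -> c1 != c3 -> c1 != c4 -> c2 != c3 -> c2 != c4 -> c3 != c4 ->
  diveq F [:: c2; c2; a] [:: c1; c1; b] ->
  diveq (fun q => F q - 1) [:: c3; c3; a3] [:: c1; c1; b] ->
  diveq (fun q => F q - x) [:: c4; c4; a4] [:: c1; c1; b] ->
  diveq h [:: c2; c2; a'] [:: c1; c1; b'] ->
  diveq (fun q => h q - 1) [:: c3; c3; a3'] [:: c1; c1; b'] ->
  diveq (fun q => h q - x^*) [:: c4; c4; a4'] [:: c1; c1; b'] ->
  a != c1 -> b != c2 -> b != c3 -> b != c4 -> b != a ->
  a' != c1 -> a' != b' -> a' != c3 -> x != 0 -> x != 1 ->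
  exists t r : C, null (fun q => h q - (t * F q + r)).
Proof.
move=> rs s1 s2 s3 s4 c12 c13 c14 c23 c24 c34 d0 d1 dx h0 h1 hx.
move=> ac1 bc2 bc3 bc4 ba ac1' ab' ac3' x0 x1.
have x1' : x - 1 != 0 by rewrite subr_eq0.
have d0' : diveq (fun q => F q - 0) [:: c2; c2; a] [:: c1; c1; b].
  by apply: (eq_diveq_fun _ d0) => p; apply: filterE => q; rewrite subr0.
have h0' : diveq (fun q => h q - 0) [:: c2; c2; a'] [:: c1; c1; b'].
  by apply: (eq_diveq_fun _ h0) => p; apply: filterE => q; rewrite subr0.
pose comb (A B D : C) q := A * h q + B * F q + D.
have one := oner_neq0 C.
have g4 : divge (comb 1 (-1) 0) [:: c2; c2; c3; c3] [:: c1; c1; b; b'].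
  by apply: (comb_divge c23 d0' h0' d1 h1); ring.
have g3 : divge (comb x (- x^*) 0) [:: c2; c2; c4; c4] [:: c1; c1; b; b'].
  by apply: (comb_divge c24 d0' h0' dx hx); ring.
(* The slope of the line through the pairs of values of [F] and [h] at [c3] and [c4]. *)
pose rho := (x^* - 1) / (x - 1).
have g2 : divge (comb 1 (- rho) (rho - 1)) [:: c3; c3; c4; c4] [:: c1; c1; b; b'].
  apply: (comb_divge c34 d1 h1 dx hx); first by ring.
  by rewrite /rho; field.
have [n4|d4] := divge_exact cX g4 erefl; first exact: comb_null one n4.
have [n3|d3] := divge_exact cX g3 erefl; first exact: comb_null x0 n3.
have [n2|d2] := divge_exact cX g2 erefl; first exact: comb_null one n2.
pose y q := comb x (- x^*) 0 q / comb 1 (-1) 0 q.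
pose y' q := comb x (- x^*) 0 q / comb 1 (- rho) (rho - 1) q.
have dy : diveq y [:: c4; c4] [:: c3; c3].
  by apply: (diveq_dv _ (diveqM d3 (diveqV d4))) => p; rewrite /dv /=; dvlia.
have dy' : diveq y' [:: c2; c2] [:: c3; c3].
  by apply: (diveq_dv _ (diveqM d3 (diveqV d2))) => p; rewrite /dv /=; dvlia.
have c43 : (c4 == c3) = false by rewrite eq_sym (negPf c34).
(* For real [x] the combination used for [y] in the numerator is [x] times the one in the
   denominator, which would inherit a double zero at [c4]. *)
have xx : x != x^*.
  apply/eqP => xx; have e4 : (c3 == c4) = false by exact: negPf.
  have H : ord_ge (comb 1 (-1) 0) c4 (dv [:: c2; c2; c4; c4] [:: c1; c1; b; b'] c4).
    apply: eq_ord_ge (ord_geZ x^-1 (g3 c4)); apply: filterE => q.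
    by rewrite /comb -xx; field.
  have := has_ord_ge_le (d4 c4) H.
  by rewrite /dv /= e4 (negPf c24) eqxx; dvlia.
have oy : has_ord y c3 (-2) by have := dy c3; rewrite /dv /= c43 eqxx.
have oy' : has_ord y' c3 (-2) by have := dy' c3; rewrite /dv /= (negPf c23) eqxx.
have [t t0 ot] := ord_reduce oy oy'.
have gu : divge (fun q => y' q - t * y q) [::] [:: c3].
  move=> p; have [<-|pc] := eqVneq c3 p; first by rewrite /dv /= eqxx.
  rewrite /dv /= (negPf pc); apply: ord_geB.
    by apply: ord_ge_le (has_ord_ge (dy' p)); rewrite /dv /= (negPf pc); dvlia.
  by apply: ord_geZ; apply: ord_ge_le (has_ord_ge (dy p)); rewrite /dv /= (negPf pc); dvlia.
have [[kap nk]|[_ uP]] := one_pole_dich cX gu; exfalso; last first.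
  have xr := cubic_nonconst rs s1 s2 s3 s4 c12 c13 c14 c23 c24 c34 d0 d1 dx ac1 bc3 bc4 uP.
  by rewrite xr eqxx in xx.
apply: (@cubic_const _ _ F h (comb 1 (-1) 0) (comb x (- x^*) 0) (comb 1 (- rho) (rho - 1)) y y'
  c1 c2 c3 c4 a b a' b' x x^* t kap) => //.
- by move=> q; rewrite /comb; ring.
- by move=> q; rewrite /comb; ring.
- by move=> q; rewrite /comb /rho; field.
Qed.

End Cubic2.

(** * Real structures *)

Section Moebius.
Variable R : realType.
Variable X : riemannSurface R.
Local Notation C := (Cplx R).
Local Notation CP1 := (CP1 R).
Implicit Types (p q c : X) (phi f : X -> CP1) (w : CP1) (fib : CP1 -> seq X) (d : nat) (s : X -> X).

(** Fibres move by the inverse map, hence the pair [M], [N] instead of [M] alone. *)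
Definition moebius (M N : CP1 -> CP1) :=
  [/\ holomorphic M, holomorphic N, cancel M N, cancel N M &
      forall phi fib d, is_cover phi fib d -> is_cover (M \o phi) (fib \o N) d].

Lemma moebius_mobT (a b : C) : a != 0 -> moebius (mobT a b) (mobT a^-1 (- (a^-1 * b))).
Proof.
move=> a0; have a0' : a^-1 != 0 by rewrite invr_eq0.
split; [exact: holomorphic_mobT a0|exact: holomorphic_mobT a0'|exact: mobTK|exact: mobTVK|].
by move=> phi fib d; exact: cover_mobT.
Qed.

Lemma moebius_mobJ : moebius (mobJ (R := R)) (mobJ (R := R)).
Proof.
split; [exact: holomorphic_mobJ|exact: holomorphic_mobJ|exact: mobJK|exact: mobJK|].
by move=> phi fib d; exact: cover_mobJ.
Qed.

Lemma moebius_comp (M N M' N' : CP1 -> CP1) : moebius M N -> moebius M' N' ->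
  moebius (M' \o M) (N \o N').
Proof.
move=> [hM hN MK NK cM] [hM' hN' MK' NK' cM']; split.
- exact: holomorphic_comp hM hM'.
- exact: holomorphic_comp hN' hN.
- by move=> w /=; rewrite MK' MK.
- by move=> w /=; rewrite NK NK'.
- by move=> phi fib d /cM /cM'.
Qed.

Lemma moebius_infty w : exists M N, moebius M N /\ M w = None.
Proof.
case: w => [v|]; last first.
  by exists (mobT 1 0), (mobT 1^-1 (- (1^-1 * 0))); split=> //; exact: moebius_mobT (oner_neq0 C).
have H := moebius_comp (moebius_mobT (- v) (oner_neq0 C)) moebius_mobJ.
by eexists _, _; split; [exact: H|rewrite /= mul1r subrr eqxx].
Qed.

Lemma moebius_normal w1 w2 w3 : w1 <> w2 -> w1 <> w3 -> w2 <> w3 ->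
  exists M N, [/\ moebius M N, M w1 = None, M w2 = Some 0 & M w3 = Some 1].
Proof.
move=> w12 w13 w23; have [M [N [mM M1]]] := moebius_infty w1.
have [_ _ MK _ _] := mM; have Minj := can_inj MK.
case E2 : (M w2) => [v2|]; last by case: w12; apply: Minj; rewrite M1 E2.
case E3 : (M w3) => [v3|]; last by case: w13; apply: Minj; rewrite M1 E3.
have v0 : v3 - v2 != 0.
  by rewrite subr_eq0; apply/eqP => E; apply: w23; apply: Minj; rewrite E2 E3 E.
have v0' : (v3 - v2)^-1 != 0 by rewrite invr_eq0.
have H := moebius_comp mM (moebius_mobT (- (v2 / (v3 - v2))) v0').
eexists _, _; split; first exact: H.
- by rewrite /= M1.
- by rewrite /= E2 /= mulrC subrr.
- by rewrite /= E3 /= [_^-1 * _]mulrC -mulrBl divff.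
Qed.

(** The relation only concerns finite parts; [eq_cover_sub] turns it into an equality of maps to the
    sphere. With [t = 0] the conjugate cover would be constant, against its divisors. *)
Lemma linear_real_structure f fib d s (M N : CP1 -> CP1) (t r : C) :
  is_cover f fib d -> (0 < d)%N -> real_structure s -> moebius M N ->
  null (fun q => fin (mobK (M (f (s q)))) - (t * fin (M (f q)) + r)) ->
  exists tau : CP1 -> CP1, real_structure tau /\ tau \o f \o s = f.
Proof.
move=> cf d0 rs [hM hN MK NK cM] nu.
have cphi := cM _ _ _ cf; have cpsi := cover_conj rs cphi.
have t0 : t != 0.
  apply/eqP => t0; have [p _] := @surface_nonempty _ X.
  have [_ _ dpsi] := cpsi; apply: (has_ord_not0 (dpsi r p)).
  by apply: filterS (nu p) => q; rewrite t0 mul0r add0r.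
have E := eq_cover_sub cpsi (cover_mobT r t0 cphi).
have sf w : exists p, f p = w.
  have [sz mf _] := cf; have := sz w; case F : (fib w) => [|p l] => [|_].
    by move=> d0'; move: d0; rewrite -d0'.
  by exists p; apply/mf; rewrite F mem_head.
have [_ sK] := rs.
apply: (real_structure_lift sf sK hM hN MK NK t0) => p; apply: E => {}p.
apply: filterS2 (cover_neq None p cphi) (nu p) => q /=.
by case: (M (f q)).
Qed.

(* Since s c = c, the conjugate cover has the same double point c. *)
Lemma real_double_fibre phi fib d s c : is_cover phi fib d -> s c = c ->
  (1 < count_mem c (fib (phi c)))%N -> exists t, [/\ size t = (d - 2)%N,
   perm_eq (fib (phi c)) [:: c, c & t] & perm_eq (map s (fib (phi c))) [:: c, c & map s t]].
Proof.
move=> [sz _ _] sc /double_fibre [t pt]; exists t; split=> //.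
  by rewrite -(sz (phi c)) (perm_size pt) /= subn2.
by have := perm_map s pt; rewrite /= sc.
Qed.

Lemma critical_seq f n k : (critical_points f #= `I_n)%card -> (k <= n)%N ->
  exists c : nat -> X, (forall i, (i < k)%N -> critical_points f (c i)) /\
    forall i j, (i < k)%N -> (j < k)%N -> c i = c j -> i = j.
Proof.
move=> /card_set_bijP [b [_ _ bsurj]] kn.
have H i : exists p, (i < n)%N -> critical_points f p /\ b p = i.
  have [p0 _] := @surface_nonempty _ X.
  have [ik|_] := ltnP i n; last by exists p0.
  by have [p cp bp] := bsurj i ik; exists p.
have [c cP] := choice H; exists c; split=> [i ik|i j ik jk E].
  by have [] := cP i (leq_trans ik kn).
have [_ bi] := cP i (leq_trans ik kn); have [_ bj] := cP j (leq_trans jk kn).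
by rewrite -bi E bj.
Qed.

End Moebius.

(** * The quadratic and cubic cases *)

Section Main.
Variable R : realType.
Variable X : riemannSurface R.
Local Notation C := (Cplx R).
Local Notation CP1 := (CP1 R).
Implicit Types (p q c : X) (f : X -> CP1) (s : X -> X).
Hypothesis cX : compact [set: X].

Lemma quadratic_positive_genus g f s : real_structure s -> has_genus X g -> (0 < g)%N ->
  holomorphic f -> has_degree f 2 -> critical_points f `&` real_part s !=set0 ->
  exists tau : CP1 -> CP1, real_structure tau /\ tau \o f \o s = f.
Proof.
move=> rs gX g0 hf df [c [cc rc]].
have [fib cf critf] := degree_cover hf df.
have [M [N [mM Mc]]] := moebius_infty X (f c).
have [_ _ MK NK cM] := mM; have cphi := cM _ _ _ cf; have cpsi := cover_conj rs cphi.
have Nc : N None = f c by rewrite -Mc MK.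
have [t [sz pt pst]] := real_double_fibre (s := s) cf rc (critf c cc).
have {sz}t0 : t = [::] by case: t sz {pt pst}.
rewrite {}t0 in pt pst.
have [_ m1 d1] := cphi; have [_ m2 d2] := cpsi.
have cn0 (fb : CP1 -> seq X) (ph : X -> CP1) : (forall w p, p \in fb w <-> ph p = w) -> ph c = None ->
    count_mem c (fb (Some 0)) = 0%N.
  by move=> m phc; apply/count_memPn/negP => /m; rewrite phc.
have oF : has_ord (fun q => fin (M (f q)) - 0) c (-2).
  have := d1 0 c; rewrite /dv (cn0 _ _ m1) //= Nc.
  by have /permP -> := pt; rewrite /= eqxx.
have oh : has_ord (fun q => fin (mobK (M (f (s q)))) - 0) c (-2).
  have := d2 0 c; rewrite /dv (cn0 _ _ m2) /= ?rc ?Mc // Nc.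
  by have /permP -> := pst; rewrite /= eqxx.
have [k k0 ok] := ord_reduce oF oh.
have gu : divge (fun q => fin (mobK (M (f (s q)))) - 0 - k * (fin (M (f q)) - 0)) [::] [:: c].
  move=> p; have [<-|pc] := eqVneq c p; first by rewrite /dv /= eqxx.
  rewrite /dv /= (negPf pc); apply: ord_geB.
    apply: ord_ge_le (has_ord_ge (d2 0 p)); rewrite /dv /= Nc.
    by have /permP -> := pst; rewrite /= (negPf pc); dvlia.
  apply: ord_geZ; apply: ord_ge_le (has_ord_ge (d1 0 p)); rewrite /dv /= Nc.
  by have /permP -> := pt; rewrite /= (negPf pc); dvlia.
have [r nr] := genus_const cX gX g0 gu.
apply: (@linear_real_structure _ _ f fib 2 s M N k r cf _ rs mM) => // p.
apply: filterS (nr p) => q; rewrite !subr0 => E.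
by rewrite opprD addrA.
Qed.

Lemma quadratic_real f s n : real_structure s -> holomorphic f -> has_degree f 2 ->
  (critical_points f #= `I_n)%card -> (2 <= n)%N -> {in critical_points f &, injective f} ->
  critical_points f `<=` real_part s ->
  exists tau : CP1 -> CP1, real_structure tau /\ tau \o f \o s = f.
Proof.
move=> rs hf df cn n2 finj creal.
have [fib cf critf] := degree_cover hf df.
have [c [cc cinj]] := critical_seq cn n2.
have f12 : f (c 0%N) <> f (c 1%N).
  move=> /(finj _ _ (mem_set (cc 0%N isT)) (mem_set (cc 1%N isT))).
  by move=> /(cinj 0%N 1%N isT isT).
have [M [N [mM M1]]] := moebius_infty X (f (c 0%N)).
have [_ _ MK NK cM] := mM; have cphi := cM _ _ _ cf; have cpsi := cover_conj rs cphi.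
case M2 : (M (f (c 1%N))) => [v|]; last by case: f12; apply: (can_inj MK); rewrite M1 M2.
have N1 : N None = f (c 0%N) by rewrite -M1 MK.
have N2 : N (Some v) = f (c 1%N) by rewrite -M2 MK.
have r1 := creal _ (cc 0%N isT); have r2 := creal _ (cc 1%N isT).
have [t1 [sz1 p1 ps1]] := real_double_fibre (s := s) cf r1 (critf _ (cc 0%N isT)).
have [t2 [sz2 p2 ps2]] := real_double_fibre (s := s) cf r2 (critf _ (cc 1%N isT)).
have {sz1}t10 : t1 = [::] by case: t1 sz1 {p1 ps1}.
have {sz2}t20 : t2 = [::] by case: t2 sz2 {p2 ps2}.
rewrite {}t10 {}t20 in p1 ps1 p2 ps2.
have [_ _ d1] := cphi; have [_ _ d2] := cpsi.
have dF : diveq (fun q => fin (M (f q)) - v) [:: c 1%N; c 1%N] [:: c 0%N; c 0%N].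
  by apply: eq_diveq (d1 v); rewrite /= ?N1 ?N2.
have dh : diveq (fun q => fin (mobK (M (f (s q)))) - v^*) [:: c 1%N; c 1%N] [:: c 0%N; c 0%N].
  by apply: eq_diveq (d2 v^*); rewrite /= ?conjCK ?N1 ?N2.
have [k _ nk] := diveq_ratio cX (fun=> erefl) dF dh.
apply: (@linear_real_structure _ _ f fib 2 s M N k (v^* - k * v) cf _ rs mM) => // p.
by apply: filterS (nk p) => q E; rewrite -E; ring.
Qed.

Lemma cubic_real f s n : real_structure s -> holomorphic f -> has_degree f 3 ->
  (critical_points f #= `I_n)%card -> (4 <= n)%N -> {in critical_points f &, injective f} ->
  critical_points f `<=` real_part s ->
  exists tau : CP1 -> CP1, real_structure tau /\ tau \o f \o s = f.
Proof.
move=> rs hf df cn n4 finj creal; have [_ sK] := rs.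
have [fib cf critf] := degree_cover hf df.
have [c [cc cinj]] := critical_seq cn n4.
have cneq i j : (i < 4)%N -> (j < 4)%N -> i != j -> c i != c j.
  by move=> i4 j4; apply: contra_neq => /(cinj _ _ i4 j4).
have fneq i j : (i < 4)%N -> (j < 4)%N -> i != j -> f (c i) <> f (c j).
  move=> i4 j4 /eqP ij /(finj _ _ (mem_set (cc i i4)) (mem_set (cc j j4))).
  by move=> /(cinj i j i4 j4).
have [M [N [mM M1 M2 M3]]] := moebius_normal X (fneq 0%N 1%N isT isT isT)
  (fneq 0%N 2%N isT isT isT) (fneq 1%N 2%N isT isT isT).
have [_ _ MK NK cM] := mM; have cphi := cM _ _ _ cf; have cpsi := cover_conj rs cphi.
have Mneq i j : (i < 4)%N -> (j < 4)%N -> i != j -> M (f (c i)) <> M (f (c j)).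
  by move=> i4 j4 ij /(can_inj MK); exact: fneq.
case M4 : (M (f (c 3%N))) => [x|]; last first.
  by case: (Mneq 0%N 3%N isT isT isT); rewrite M1 M4.
have x0 : x != 0.
  by apply/eqP => E; case: (Mneq 1%N 3%N isT isT isT); rewrite M2 M4 E.
have x1 : x != 1.
  by apply/eqP => E; case: (Mneq 2%N 3%N isT isT isT); rewrite M3 M4 E.
(* A fibre has three points, so beside the double point exactly one is left; conjugation fixes the
   former and moves the latter to its image by [s]. *)
have fibre i : (i < 4)%N -> exists t,
    perm_eq (fib (f (c i))) [:: c i; c i; t] /\
    perm_eq (map s (fib (f (c i)))) [:: c i; c i; s t].
  move=> i4; have ri := creal _ (cc i i4).
  have [t [sz p1 p2]] := real_double_fibre cf ri (critf _ (cc i i4)).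
  by case: t sz p1 p2 => [|t []] // _ p1 p2; exists t.
have [b [p1 q1]] := fibre 0%N isT; have [a [p2 q2]] := fibre 1%N isT.
have [a3 [p3 q3]] := fibre 2%N isT; have [a4 [p4 q4]] := fibre 3%N isT.
have N1 : N None = f (c 0%N) by rewrite -M1 MK.
have N2 : N (Some 0) = f (c 1%N) by rewrite -M2 MK.
have N3 : N (Some 1) = f (c 2%N) by rewrite -M3 MK.
have N4 : N (Some x) = f (c 3%N) by rewrite -M4 MK.
have third i t : perm_eq (fib (f (c i))) [:: c i; c i; t] -> f t = f (c i).
  have [_ m _] := cf => pt; apply/m; by rewrite (perm_mem pt) !inE eqxx !orbT.
have fb := third _ _ p1; have fa := third _ _ p2.
have tneq i j t : (i < 4)%N -> (j < 4)%N -> i != j -> f t = f (c i) -> t != c j.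
  by move=> i4 j4 ij ft; apply/eqP => E; apply: (fneq i j i4 j4 ij); rewrite -ft E.
have ab : b != a by apply/eqP => E; apply: (fneq 0%N 1%N isT isT isT); rewrite -fa -fb E.
have sneq t i : (i < 4)%N -> t != c i -> s t != c i.
  move=> i4; apply: contra_neq => E; rewrite -[t]sK E; exact: creal (cc i i4).
have [_ _ d1] := cphi; have [_ _ d2] := cpsi.
have subr0_div (F : X -> C) zs ps : diveq (fun q => F q - 0) zs ps -> diveq F zs ps.
  by apply: eq_diveq_fun => p; apply: filterE => q; rewrite subr0.
(* Here [h] is the finite part of the conjugate cover. The required distinctness of points holds
   because they lie over different critical values, and passes to conjugates because [s] is
   injective and fixes each [c i]. *)
have [t [r nr]] : exists t r : C,
    null (fun q => fin (mobK (M (f (s q)))) - (t * fin (M (f q)) + r)).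
  apply: (cubic_linear cX (x := x) (a := a) (a3 := a3) (a4 := a4) (b := b)
    (a' := s a) (a3' := s a3) (a4' := s a4) (b' := s b) rs
    (creal _ (cc 0%N isT)) (creal _ (cc 1%N isT)) (creal _ (cc 2%N isT)) (creal _ (cc 3%N isT))
    (cneq 0%N 1%N isT isT isT) (cneq 0%N 2%N isT isT isT) (cneq 0%N 3%N isT isT isT)
    (cneq 1%N 2%N isT isT isT) (cneq 1%N 3%N isT isT isT) (cneq 2%N 3%N isT isT isT)).
  - by apply: subr0_div; apply: eq_diveq (d1 0); rewrite /= ?N1 ?N2.
  - by apply: eq_diveq (d1 1); rewrite /= ?N1 ?N3.
  - by apply: eq_diveq (d1 x); rewrite /= ?N1 ?N4.
  - by apply: subr0_div; apply: eq_diveq (d2 0); rewrite /= ?rmorph0 ?N1 ?N2.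
  - by apply: eq_diveq (d2 1); rewrite /= ?rmorph1 ?N1 ?N3.
  - by apply: eq_diveq (d2 x^*); rewrite /= ?conjCK ?N1 ?N4.
  - exact: (tneq 1%N 0%N _ isT isT isT fa).
  - exact: (tneq 0%N 1%N _ isT isT isT fb).
  - exact: (tneq 0%N 2%N _ isT isT isT fb).
  - exact: (tneq 0%N 3%N _ isT isT isT fb).
  - exact: ab.
  - exact: (sneq _ 0%N isT (tneq 1%N 0%N _ isT isT isT fa)).
  - by rewrite (inj_eq (inv_inj sK)) eq_sym.
  - exact: (sneq _ 2%N isT (tneq 1%N 2%N _ isT isT isT fa)).
  - exact: x0.
  - exact: x1.
exact: (@linear_real_structure _ _ f fib 3 s M N t r cf isT rs mM nr).
Qed.

End Main.

Theorem corollary1 (R : realType) (X : riemannSurface R) (sigma : X -> X)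
    (g : nat) (hcompact : compact [set: X]) (hsigma : real_structure sigma)
    (hgenus : has_genus X g) :
  (forall (d : nat) (f : X -> CP1 R),
     d = 2%N \/ d = 3%N ->
     holomorphic f -> has_degree f d ->
     (critical_points f #= `I_(2 * d - 2 + 2 * g))%card ->
     {in critical_points f &, injective f} ->
     critical_points f `<=` real_part sigma ->
     exists tau' : CP1 R -> CP1 R,
       real_structure tau' /\ tau' \o f \o sigma = f) /\
  ((0 < g)%N -> forall f : X -> CP1 R,
     holomorphic f -> has_degree f 2 ->
     critical_points f `&` real_part sigma !=set0 ->
     exists tau' : CP1 R -> CP1 R,
       real_structure tau' /\ tau' \o f \o sigma = f).
Proof.
split=> [d f [->|->] hf df cn finj creal|g0 f hf df cf].
(* [2 * d - 2] computes to 2 for [d = 2] and to 4 for [d = 3], which gives enough critical points in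
   every genus. *)
- exact: (quadratic_real hcompact hsigma hf df cn (leq_addr _ 2) finj creal).
- exact: (cubic_real hcompact hsigma hf df cn (leq_addr _ 4) finj creal).
- exact: (quadratic_positive_genus hcompact hsigma hgenus g0 hf df cf).
Qed.
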